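(* Let $n>1$ and $(\mu,\lambda)\in\Lambda_{\mathcal{B}}$. There is a canonical decomposition of $W^{\lambda/\mu}$ into one-dimensional spaces $$W^{\lambda/\mu}=\bigoplus_{\substack{\gamma\in\Lambda_n\\ \mu<\gamma<\lambda^+}}W^{\lambda/\gamma/\mu},$$ where $W^{\lambda/\gamma/\mu}$ is the weight space of the diagonal torus $T_L$ of $L=\prod_{i=1}^nSL_2$, acting on $W^{\lambda/\mu}$ through the representation $\Phi$, for the weight $(t_1,\dots,t_n)\mapsto\prod_{i=1}^nt_i^{2\gamma_i-x_i-y_i}$; here $(x_1\ge y_1\ge\cdots\ge x_n\ge y_n)$ is the non-increasing rearrangement of $(\mu_1,\dots,\mu_{n-1},\lambda_1,\dots,\lambda_n,0)$. In particular, $\mathcal{B}$ has a basis which is unique up to scalar, namely one obtained by choosing one nonzero vector in each $W^{\lambda/\gamma/\mu}$, for $(\mu,\lambda)\in\Lambda_{\mathcal{B}}$ and $\mu<\gamma<\lambda^+$.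
   Context: All groups are over $\mathbb{C}$. $\Lambda_k$ is the semigroup of weakly decreasing sequences of $k$ non-negative integers; $\Lambda_{n-1,n}=\Lambda_{n-1}\times\Lambda_n$; for $\lambda\in\Lambda_n$, $\lambda^+\in\Lambda_{n+1}$ is $\lambda$ with a zero appended. For $\mu\in\Lambda_{k-1}$, $\gamma\in\Lambda_k$, $\mu<\gamma$ means $\mu$ interlaces $\gamma$: $\gamma_i\ge\mu_i\ge\gamma_{i+1}$ for $i=1,\dots,k-1$. Let $s_n$ be the $n\times n$ antidiagonal matrix of ones, $J_n=\begin{bmatrix}0&s_n\\-s_n&0\end{bmatrix}$, $Sp_{2n}=\{g\in GL_{2n}: g^tJ_ng=J_n\}$, with standard basis of $\mathbb{C}^{2n}$ labelled $e_{\pm1},\dots,e_{\pm n}$, $e_{-i}=e_{2n+1-i}$. Let $T_{C_n},U_{C_n},\overline{U}_{C_n}$ be the intersections of $Sp_{2n}$ with the diagonal, upper-triangular unipotent and lower-triangular unipotent matrices. $Sp_{2n-2}\subset Sp_{2n}$ is the subgroup fixing $e_{\pm n}$; $T_{C_{n-1}}=T_{C_n}\cap Sp_{2n-2}$, $U_{C_{n-1}}=U_{C_n}\cap Sp_{2n-2}$. The branching algebra is $$\mathcal{B}=\{f\in\mathcal{O}(Sp_{2n}): f(\overline{u}gu)=f(g)\ \forall\,\overline{u}\in\overline{U}_{C_n},\,u\in U_{C_{n-1}}\}=\bigoplus_{(\mu,\lambda)\in\Lambda_{n-1,n}}W^{\lambda/\mu},$$ where $W^{\lambda/\mu}=\{f\in\mathcal{B}: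 f(tgs)=t^\lambda s^\mu f(g)\ \forall\, t\in T_{C_n},\,s\in T_{C_{n-1}}\}$ (with $t^\lambda=\prod_{i\le n}t_i^{\lambda_i}$ for $t=\mathrm{diag}(t_1,\dots,t_n,t_n^{-1},\dots,t_1^{-1})$, similarly $s^\mu$). The natural $SL_2$-action on $\mathcal{B}$ is right translation by $SL_2=\{g\in Sp_{2n}: ge_{\pm i}=e_{\pm i},\ i=1,\dots,n-1\}$. $\Lambda_{\mathcal{B}}=\{(\mu,\lambda)\in\Lambda_{n-1,n}: W^{\lambda/\mu}\neq\{0\}\}$. An order type $\sigma=(\sigma_1\cdots\sigma_{n-1})$ is a word of length $n-1$ in the alphabet $\{\ge,\le\}$. $(\mu,\lambda)\in\Lambda_{\mathcal{B}}$ is of order type $\sigma$ if for each $i=1,\dots,n-1$: $\mu_i\ge\lambda_{i+1}$ when $\sigma_i$ is $\ge$, and $\mu_i\le\lambda_{i+1}$ when $\sigma_i$ is $\le$. $\mathcal{B}_\sigma$ is the subalgebra of $\mathcal{B}$ which is the sum of the $W^{\lambda/\mu}$ with $(\mu,\lambda)\in\Lambda_{\mathcal{B}}$ of order type $\sigma$. With $x_i,y_i$ as in the claim, $A^{\lambda/\mu}=\bigotimes_{i=1}^nF^{x_i-y_i}$ is the irreducible $L$-module on which the $i$-th factor $SL_2$ acts on the $i$-th tensor factor ($F^k$ being the $(k+1)$-dimensional irreducible $SL_2$-module). $\Phi$ is the unique representation of $L$ on $\mathcal{B}$ such that each $W^{\lambda/\mu}$, $(\mu,\lambda)\in\Lambda_{\mathcal{B}}$,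 is $L$-invariant and isomorphic to $A^{\lambda/\mu}$, $L$ acts by algebra automorphisms on every $\mathcal{B}_\sigma$, and the restriction of $\Phi$ to the diagonal $SL_2\subset L$ is the natural $SL_2$-action. $T_L=T_{SL_2}\times\cdots\times T_{SL_2}$ with $T_{SL_2}=\{\mathrm{diag}(t,t^{-1})\}$, which corresponds to $SL_2\cap T_{C_n}$; $(t_1,\dots,t_n)$ denotes the element of $T_L$ with components $\mathrm{diag}(t_i,t_i^{-1})$. ''Canonical'' means depending only on the choice of torus $T_{C_n}\subset Sp_{2n}$. *)

(* Defs.v *)
From HB Require Import structures.
From mathcomp Require Import all_boot all_order all_algebra.
From mathcomp Require Import boolp classical_sets functions.
From mathcomp Require mpoly.
From mathcomp Require Import zify ring.

Set Implicit Arguments.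
Unset Strict Implicit.
Unset Printing Implicit Defensive.

Import GRing.Theory.
Local Open Scope classical_set_scope.
Local Open Scope ring_scope.

(* Vectors of C^(2n) are indexed by 'I_(n + n): for i : 'I_n, the vector
   labelled e_(i+1) has index [epos i] and the one labelled e_-(i+1) has
   index [eneg i]. *)
Definition epos n (i : 'I_n) : 'I_(n + n) := lshift n i.
Definition eneg n (i : 'I_n) : 'I_(n + n) := rev_ord (epos i).

Section SymplecticGroup.
Variables (C : fieldType) (n : nat).

Definition antidiag_mx : 'M[C]_n := \matrix_(i, j) (j == rev_ord i)%:R.

Definition Jmx : 'M[C]_(n + n) := block_mx 0 antidiag_mx (- antidiag_mx) 0.

Record Sp := MkSp { sp_mx :> 'M[C]_(n + n);
                    _ : sp_mx^T *m Jmx *m sp_mx == Jmx }.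
HB.instance Definition _ := [isSub for sp_mx].
HB.instance Definition _ := [Choice of Sp by <:].

Lemma antidiag_mxK : antidiag_mx *m antidiag_mx = 1%:M.
Proof.
apply/matrixP => i j; rewrite !mxE (bigD1 (rev_ord i)) //= !mxE eqxx mul1r.
rewrite rev_ordK big1 ?addr0 => [|k kNi]; first by rewrite eq_sym.
by rewrite !mxE (negPf kNi) mul0r.
Qed.

Lemma Jmx_unit : Jmx \in unitmx.
Proof.
suff /mulmx1_unit [] : Jmx *m (- Jmx) = 1%:M by [].
rewrite mulmxN mulmx_block !mulmx0 !mul0mx !addr0 !add0r.
rewrite mulmxN mulNmx antidiag_mxK opp_block_mx !opprK !oppr0.
by rewrite -scalar_mx_block.
Qed.

Lemma spP (g : Sp) : g^T *m Jmx *m g = Jmx.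
Proof. by case: g => g /= /eqP. Qed.

Lemma sp_unit (g : Sp) : (g : 'M_(n + n)) \in unitmx.
Proof.
have: g^T *m Jmx *m g \in unitmx by rewrite spP Jmx_unit.
by rewrite unitmx_mul => /andP[].
Qed.

Fact sp_one_subproof : (1%:M : 'M[C]_(n + n))^T *m Jmx *m 1%:M == Jmx.
Proof. by rewrite trmx1 mul1mx mulmx1. Qed.

Fact sp_mul_subproof (g h : Sp) : (g *m h)^T *m Jmx *m (g *m h) == Jmx.
Proof. by rewrite trmx_mul -!mulmxA (mulmxA g^T) (mulmxA _ g) spP mulmxA spP. Qed.

Fact sp_inv_subproof (g : Sp) : (invmx g)^T *m Jmx *m invmx g == Jmx.
Proof.
have gU := sp_unit g; have gTU : (g : 'M_(n + n))^T \in unitmx by rewrite unitmx_tr.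
by rewrite trmx_inv -[X in _ *m X *m _](spP g) !mulmxA mulVmx // mul1mx mulmxK.
Qed.

Definition sp_one := MkSp sp_one_subproof.
Definition sp_mul g h := MkSp (sp_mul_subproof g h).
Definition sp_inv g := MkSp (sp_inv_subproof g).

Fact sp_mulA : associative sp_mul.
Proof. by move=> g h k; apply/val_inj; rewrite /= mulmxA. Qed.
Fact sp_mul1 : left_id sp_one sp_mul.
Proof. by move=> g; apply/val_inj; rewrite /= mul1mx. Qed.
Fact sp_mulr1 : right_id sp_one sp_mul.
Proof. by move=> g; apply/val_inj; rewrite /= mulmx1. Qed.
Fact sp_mulV : left_inverse sp_one sp_inv sp_mul.
Proof. by move=> g; apply/val_inj; rewrite /= mulVmx // sp_unit. Qed.
Fact sp_mulrV : right_inverse sp_one sp_inv sp_mul.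
Proof. by move=> g; apply/val_inj; rewrite /= mulmxV // sp_unit. Qed.

HB.instance Definition _ :=
  isGroup.Build Sp sp_mulA sp_mul1 sp_mulr1 sp_mulV sp_mulrV.

Definition torus : set Sp := [set t | is_diag_mx t].

Definition lower_unip : set Sp :=
  [set g | is_trig_mx g /\ forall i, g i i = 1].

Definition upper_unip : set Sp :=
  [set g | is_trig_mx g^T /\ forall i, g i i = 1].

Definition fixes_e (g : Sp) (c : 'I_(n + n)) : Prop := col c g = delta_mx c 0.

(* The subgroup Sp_(2n-2), fixing e_n and e_-n. *)
Definition Sp_sub : set Sp :=
  [set g | forall i : 'I_n, i.+1 = n -> fixes_e g (epos i) /\ fixes_e g (eneg i)].

(* t^lam, where t_(i+1) is the diagonal entry at [epos i]. As [nth] defaults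
   to 0, the same formula gives s^mu for a sequence mu of length n - 1. *)
Definition tchar (lam : seq nat) (t : Sp) : C :=
  \prod_(i < n) t (epos i) (epos i) ^+ nth 0%N lam i.

(* O(Sp_2n). Since Sp_2n is closed in the space of matrices, regular functions
   are the restrictions of polynomials in the matrix entries. *)
Definition regular_fun : set (Sp -> C^o) :=
  [set f | exists p : mpoly.mpoly ((n + n) * (n + n)) C,
     forall g : Sp, f g = mpoly.meval (fun k => mxvec g 0 k) p].

Definition branching_algebra : set (Sp -> C^o) :=
  [set f | regular_fun f /\
     forall v g u : Sp, lower_unip v -> upper_unip u -> Sp_sub u ->
       f (v * g * u)%g = f g].

(* W^(lam/mu) *)
Definition Wspace (mu : n.-1.-tuple nat) (lam : n.-tuple nat) : set (Sp -> C^o) :=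
  [set f | branching_algebra f /\
     forall t g s : Sp, torus t -> torus s -> Sp_sub s ->
       f (t * g * s)%g = tchar lam t * tchar mu s * f g].

Definition LambdaB (mu : n.-1.-tuple nat) (lam : n.-tuple nat) : Prop :=
  [/\ sorted geq mu, sorted geq lam & exists2 f, Wspace mu lam f & f <> 0].

End SymplecticGroup.

Arguments branching_algebra C n : clear implicits.
Arguments Wspace C {n} mu lam.
Arguments LambdaB C {n} mu lam.

Section SL2.
Variable C : fieldType.

Record SL2 := MkSL2 { sl2_mx :> 'M[C]_2; _ : \det sl2_mx == 1 }.
HB.instance Definition _ := [isSub for sl2_mx].
HB.instance Definition _ := [Choice of SL2 by <:].

Lemma sl2P (h : SL2) : \det h = 1. Proof. by case: h => h /= /eqP. Qed.
Lemma sl2_unit (h : SL2) : (h : 'M_2) \in unitmx.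
Proof. by rewrite unitmxE sl2P unitr1. Qed.

Fact sl2_one_subproof : \det (1%:M : 'M[C]_2) == 1.
Proof. by rewrite det1. Qed.
Fact sl2_mul_subproof (g h : SL2) : \det (g *m h) == 1.
Proof. by rewrite det_mulmx !sl2P mulr1. Qed.
Fact sl2_inv_subproof (h : SL2) : \det (invmx h) == 1.
Proof. by rewrite det_inv sl2P invr1. Qed.

Definition sl2_one := MkSL2 sl2_one_subproof.
Definition sl2_mul g h := MkSL2 (sl2_mul_subproof g h).
Definition sl2_inv h := MkSL2 (sl2_inv_subproof h).

Fact sl2_mulA : associative sl2_mul.
Proof. by move=> g h k; apply/val_inj; rewrite /= mulmxA. Qed.
Fact sl2_mul1 : left_id sl2_one sl2_mul.
Proof. by move=> g; apply/val_inj; rewrite /= mul1mx. Qed.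
Fact sl2_mulr1 : right_id sl2_one sl2_mul.
Proof. by move=> g; apply/val_inj; rewrite /= mulmx1. Qed.
Fact sl2_mulV : left_inverse sl2_one sl2_inv sl2_mul.
Proof. by move=> g; apply/val_inj; rewrite /= mulVmx // sl2_unit. Qed.
Fact sl2_mulrV : right_inverse sl2_one sl2_inv sl2_mul.
Proof. by move=> g; apply/val_inj; rewrite /= mulmxV // sl2_unit. Qed.

HB.instance Definition _ :=
  isGroup.Build SL2 sl2_mulA sl2_mul1 sl2_mulr1 sl2_mulV sl2_mulrV.

(* F^k = Sym^k(C^2) in the monomial basis: column j is the image
   (a e1 + c e2)^(k-j) (b e1 + d e2)^j of e1^(k-j) e2^j under
   h = [a, b; c, d], with e1^(k-i) e2^i recorded as 'X^i. *)
Definition Fmx (k : nat) (h : 'M[C]_2) : 'M[C]_k.+1 :=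
  \matrix_(i < k.+1, j < k.+1)
    (((h 0 0)%:P + h 1 0 *: 'X) ^+ (k - j) *
     ((h 0 1)%:P + h 1 1 *: 'X) ^+ j)`_i.

End SL2.

(* The group L, with componentwise multiplication. *)
Notation Lgroup C n := {ffun 'I_n -> SL2 C}.

(* The tensor product of the F^(k i), as coordinate vectors in the basis of
   pure tensors of monomials. *)
Notation tensF C k := {ffun {dffun forall i, 'I_(k i).+1} -> C^o}.

(* The Kronecker product of the matrices [Fmx (k i) (l i)]. *)
Definition tensF_act (C : fieldType) n (k : 'I_n -> nat) (l : Lgroup C n)
    (a : tensF C k) : tensF C k :=
  [ffun r : {dffun forall i, 'I_(k i).+1} =>
    \sum_(c : {dffun forall i, 'I_(k i).+1})
      (\prod_(i < n) Fmx (k i) (l i) (r i) (c i)) * a c].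

Section SL2Embedding.
Variables (C : fieldType) (n : nat).

Definition last2_mx : 'M[C]_(n + n, 2) :=
  \matrix_(r, c) (r == n.-1 + c :> nat)%N%:R.

(* The matrix acting as h on span(e_n, e_-n), in this ordered basis, and
   fixing the other e_i and e_-i. *)
Definition sl2_emb_mx (h : 'M[C]_2) : 'M[C]_(n + n) :=
  1%:M + last2_mx *m (h - 1%:M) *m last2_mx^T.

Lemma JmxE (i j : 'I_(n + n)) :
  Jmx C n i j = (-1) ^+ (n <= i)%N * (j == rev_ord i)%:R.
Proof.
rewrite /Jmx; case: (split_ordP i) => a ->; case: (split_ordP j) => b ->;
  rewrite ?(block_mxEul, block_mxEur, block_mxEdl, block_mxEdr) !mxE -val_eqE /=.
- rewrite leqNgt ltn_ord mul1r; case: eqP => //= ba.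
  by have := ltn_ord b; have := ltn_ord a; lia.
- rewrite leqNgt ltn_ord mul1r -val_eqE /=; congr (nat_of_bool _)%:R.
  by apply/eqP/eqP; have := ltn_ord a; lia.
- rewrite leq_addr expr1 mulN1r -val_eqE /=; congr (- (nat_of_bool _)%:R).
  by apply/eqP/eqP; have := ltn_ord a; lia.
- rewrite leq_addr expr1 mulN1r; case: eqP => //= ba; last by rewrite oppr0.
  by have := ltn_ord a; lia.
Qed.

Definition J2mx : 'M[C]_2 :=
  \matrix_(i, j) ((-1) ^+ (0 < i)%N * (j != i)%:R).

Lemma sl2_J2 (h : SL2 C) : h^T *m J2mx *m h = J2mx.
Proof.
have l1 : lift 0 0 = 1 :> 'I_2 by apply/val_inj.
have dh : h 0 0 * h 1 1 - h 0 1 * h 1 0 = 1.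
  rewrite -(sl2P h) (expand_det_row _ 0) !big_ord_recl big_ord0 /cofactor.
  rewrite !det_mx11 !mxE /= addr0 !expr0 expr1 !mul1r l1.
  have -> : lift 1 0 = 0 :> 'I_2 by apply/val_inj.
  by ring.
have ord2 (i : 'I_2) : i = 0 \/ i = 1.
  by case: i => [[|[|//]] ?]; [left|right]; apply/val_inj.
apply/matrixP => i j; rewrite !(mxE, big_ord_recl, big_ord0) /= l1.
rewrite !(expr0, expr1, mul1r, mulr0, mulr1, addr0, add0r, mulN1r, mulrN1).
case: (ord2 i) => ->; case: (ord2 j) => -> /=;
  rewrite ?(expr0, expr1, mul1r, mulr0, mulr1, mulN1r) -?dh; ring.
Qed.

Lemma Jmx_last2 : Jmx C n *m last2_mx = last2_mx *m J2mx.
Proof.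
apply/matrixP => i j; rewrite !mxE (bigD1 (rev_ord i)) //= big1 => [|k kN]; last first.
  by rewrite JmxE (negPf kN) mulr0 mul0r.
rewrite JmxE eqxx mulr1 addr0 !(mxE, big_ord_recl, big_ord0) /=.
have := ltn_ord i; case: j => [[|[|//]] ?]; rewrite -!val_eqE /= => ilt;
  rewrite ?(mulr0, mulr1, oppr0, addr0, add0r, mul1r, expr0, expr1, mulrN1).
  have -> : (n + n - i.+1 == n.-1 + 0)%N = (i == n.-1 + 1 :> nat)%N.
    by apply/eqP/eqP; lia.
  case: eqP => [e|_]; last by rewrite mulr0 oppr0.
  by rewrite (_ : n <= i)%N ?mulr1 //; lia.
have -> : (n + n - i.+1 == n.-1 + 1)%N = (i == n.-1 + 0 :> nat)%N.
  by apply/eqP/eqP; lia.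
case: eqP => [e|_]; last by rewrite !mulr0.
by rewrite leqNgt (_ : i < n)%N ?mulr1 //; lia.
Qed.

Lemma Jmx_tr : (Jmx C n)^T = - Jmx C n.
Proof.
have aT : (antidiag_mx C n)^T = antidiag_mx C n.
  apply/matrixP => i j; rewrite !mxE; congr (nat_of_bool _)%:R.
  by rewrite eq_sym (can2_eq (@rev_ordK _) (@rev_ordK _)).
by rewrite /Jmx tr_block_mx !trmx0 linearN /= aT opp_block_mx oppr0 opprK.
Qed.

Lemma J2mx_tr : J2mx^T = - J2mx.
Proof.
apply/matrixP => i j; rewrite !mxE.
by case: i => [[|[|//]] ?]; case: j => [[|[|//]] ?];
  rewrite -!val_eqE /= ?(mulr0, mulr1, oppr0, opprK).
Qed.

Lemma last2_Jmx : last2_mx^T *m Jmx C n = J2mx *m last2_mx^T.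
Proof.
apply/trmx_inj; rewrite !trmx_mul !trmxK Jmx_tr J2mx_tr mulNmx mulmxN.
by rewrite Jmx_last2.
Qed.

Lemma last2_orth : (0 < n)%N -> last2_mx^T *m last2_mx = 1%:M.
Proof.
move=> n0; apply/matrixP => i j; rewrite !mxE.
have lt : (n.-1 + i < n + n)%N by have := ltn_ord i; lia.
rewrite (bigD1 (Ordinal lt)) //= big1 ?addr0 => [|k]; rewrite !mxE /=.
  by rewrite eqxx mul1r eqn_add2l.
by rewrite -val_eqE /= => /negPf ->; rewrite mul0r.
Qed.

Fact sl2_emb_subproof (h : SL2 C) :
  (sl2_emb_mx h)^T *m Jmx C n *m sl2_emb_mx h == Jmx C n.
Proof.
apply/eqP; case: (posnP n) => [n0|n_gt0].
  by apply/matrixP => i; exfalso; have := ltn_ord i; lia.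
set E := last2_mx; set J := Jmx C n.
have EE : E^T *m E = 1%:M := last2_orth n_gt0.
have JE : J *m E = E *m J2mx := Jmx_last2.
have EJ : E^T *m J = J2mx *m E^T := last2_Jmx.
have -> : (sl2_emb_mx h)^T = 1%:M + E *m (h^T - 1%:M) *m E^T.
  rewrite /sl2_emb_mx linearD /= trmx1 !trmx_mul trmxK linearB /= trmx1.
  by rewrite mulmxA.
rewrite /sl2_emb_mx -/E; set K := h^T - _; set K' := _ - 1%:M.
have -> : (1%:M + E *m K *m E^T) *m J = J + E *m (K *m J2mx) *m E^T.
  by rewrite mulmxDl mul1mx -!mulmxA EJ.
rewrite mulmxDr mulmx1 [(J + _) *m _]mulmxDl -addrA -[RHS]addr0; congr (J + _).
have -> : J *m (E *m K' *m E^T) = E *m (J2mx *m K') *m E^T.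
  by rewrite !mulmxA JE.
have -> : E *m (K *m J2mx) *m E^T *m (E *m K' *m E^T)
    = E *m (K *m J2mx *m K') *m E^T.
  by rewrite -!mulmxA (mulmxA E^T E) EE mul1mx.
rewrite -2!mulmxDl -2!mulmxDr.
suff -> : K *m J2mx + (J2mx *m K' + K *m J2mx *m K') = 0.
  by rewrite mulmx0 mul0mx.
have KJ : K *m J2mx = h^T *m J2mx - J2mx by rewrite mulmxBl mul1mx.
rewrite -mulmxDl KJ [J2mx + _]addrC subrK mulmxBr mulmx1 sl2_J2.
by rewrite addrA subrK subrr.
Qed.

Definition sl2_emb (h : SL2 C) : Sp C n := MkSp (sl2_emb_subproof h).

End SL2Embedding.

Section DirectSums.
Variables (C : fieldType) (V : lmodType C) (I : eqType) (D : set I).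

Definition sum_of (W : I -> set V) : set V :=
  [set f | exists (s : seq I) (F : I -> V),
     [/\ uniq s, (forall i, i \in s -> D i /\ W i (F i))
       & f = \sum_(i <- s) F i]].

Definition direct_sum (W : I -> set V) (U : set V) : Prop :=
  U = sum_of W /\
  forall (s : seq I) (F : I -> V), uniq s ->
    (forall i, i \in s -> D i /\ W i (F i)) ->
    \sum_(i <- s) F i = 0 -> forall i, i \in s -> F i = 0.

(* The family b, restricted to the index set D, is a basis of U. *)
Definition is_basis (b : I -> V) (U : set V) : Prop :=
  [/\ forall i, D i -> U (b i),
      forall f, U f -> exists (s : seq I) (c : I -> C),
        (forall i, i \in s -> D i) /\ f = \sum_(i <- s) c i *: b i
    & forall (s : seq I) (c : I -> C), uniq s -> (forall i, i \in s -> D i) ->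
        \sum_(i <- s) c i *: b i = 0 -> forall i, i \in s -> c i = 0].

End DirectSums.

Definition is_line (C : fieldType) (V : lmodType C) (U : set V) : Prop :=
  exists2 v : V, v <> 0 & U = range (fun c : C => c *: v).

Section Branching.
Variables (C : fieldType) (n : nat).

Notation fn := (Sp C n -> C^o).
Implicit Types (mu : n.-1.-tuple nat) (lam gam : n.-tuple nat).
Implicit Types (Phi : Lgroup C n -> fn -> fn).

(* A word of length n - 1 in the alphabet {>=, <=}; true stands for >=. *)
Definition order_type := n.-1.-tuple bool.

Definition has_order_type (sigma : order_type) mu lam : Prop :=
  forall i, (i < n.-1)%N ->
    if nth true sigma i then (nth 0%N lam i.+1 <= nth 0%N mu i)%N
    else (nth 0%N mu i <= nth 0%N lam i.+1)%N.

Definition Bsigma (sigma : order_type) : set fn :=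
  sum_of [set p | LambdaB C p.1 p.2 /\ has_order_type sigma p.1 p.2]
         (fun p : n.-1.-tuple nat * n.-tuple nat => Wspace C p.1 p.2).

(* The rearrangement x_1 >= y_1 >= ... >= x_n >= y_n; indices start at 0. *)
Definition rearr mu lam : seq nat := sort geq (mu ++ rcons lam 0%N).
Definition xseq mu lam (i : nat) : nat := nth 0%N (rearr mu lam) i.*2.
Definition yseq mu lam (i : nat) : nat := nth 0%N (rearr mu lam) i.*2.+1.

Definition Adim mu lam (i : 'I_n) : nat := (xseq mu lam i - yseq mu lam i)%N.

Record is_representation (Phi : Lgroup C n -> fn -> fn) (B : set fn) : Prop := {
  rep_stable : forall l f, B f -> B (Phi l f);
  rep_linear : forall l (c : C) f g, B f -> B g ->
    Phi l (c *: f + g) = c *: Phi l f + Phi l g;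
  rep_one : forall f, B f -> Phi 1%g f = f;
  rep_mul : forall l m f, B f -> Phi (l * m)%g f = Phi l (Phi m f) }.

(* The properties characterizing the action of L on the branching algebra.
   Only the values of Phi on the branching algebra are relevant. *)
Record is_branching_rep (Phi : Lgroup C n -> fn -> fn) : Prop := {
  brep_rep : is_representation Phi (branching_algebra C n);
  brep_stable : forall mu lam, LambdaB C mu lam ->
    forall l f, Wspace C mu lam f -> Wspace C mu lam (Phi l f);
  brep_iso : forall mu lam, LambdaB C mu lam ->
    exists theta : tensF C (Adim mu lam) -> fn,
      [/\ linear theta, injective theta, range theta = Wspace C mu lam
        & forall l a, Phi l (theta a) = theta (tensF_act l a)];
  brep_aut : forall (sigma : order_type) l,
    [/\ forall f, Bsigma sigma f -> Bsigma sigma (Phi l f),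
        Phi l 1 = 1
      & forall f g, Bsigma sigma f -> Bsigma sigma g ->
          Phi l (f * g) = Phi l f * Phi l g];
  brep_diag : forall (h : SL2 C) f, branching_algebra C n f ->
    Phi [ffun=> h] f = fun g => f (g * sl2_emb n h)%g }.

Definition TL : set (Lgroup C n) :=
  [set l : Lgroup C n | forall i, is_diag_mx (l i)].

(* The element (t_1, ..., t_n) of T_L has components diag(t_i, t_i^-1). *)
Definition TLchar mu lam gam (l : Lgroup C n) : C :=
  \prod_(i < n) (l i 0 0) ^ (2 * (nth 0%N gam i)%:Z
                              - (xseq mu lam i)%:Z - (yseq mu lam i)%:Z).

(* W^(lam/gam/mu) *)
Definition Wweight Phi mu gam lam : set fn :=
  [set f | Wspace C mu lam f /\
     forall l, TL l -> Phi l f = TLchar mu lam gam l *: f].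

(* mu < gam, for gam one longer than mu *)
Definition interlaces (mu gam : seq nat) : Prop :=
  forall i, (i < size mu)%N ->
    (nth 0%N gam i.+1 <= nth 0%N mu i <= nth 0%N gam i)%N.

Definition between mu lam : set (n.-tuple nat) :=
  [set gam | [/\ sorted geq gam, interlaces mu gam
               & interlaces gam (rcons lam 0%N)]].

Definition patterns : set (n.-1.-tuple nat * n.-tuple nat * n.-tuple nat) :=
  [set p | LambdaB C p.1.1 p.1.2 /\ between p.1.1 p.1.2 p.2].

Definition adapted Phi (b : n.-1.-tuple nat * n.-tuple nat * n.-tuple nat -> fn) :
    Prop :=
  forall mu lam gam, patterns (mu, lam, gam) ->
    Wweight Phi mu gam lam (b (mu, lam, gam)) /\ b (mu, lam, gam) <> 0.

End Branching.

Arguments patterns C n : clear implicits.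

(* Main.v *)
Require Import Defs.
From mathcomp Require Import all_boot all_order all_algebra.
From mathcomp Require Import boolp classical_sets functions reals complex.
From mathcomp Require mpoly.
From mathcomp Require Import zify ring.

Set Implicit Arguments.
Unset Strict Implicit.
Unset Printing Implicit Defensive.

Import Order.TTheory GRing.Theory Num.Theory.
Local Open Scope classical_set_scope.
Local Open Scope ring_scope.

(** The x_i and y_i are the entries of the sorted sequence; in this comment, indices
    start at 1.

    Through Phi, the space W^(lam/mu) is the tensor product of the SL2-modules
    F^(x_i - y_i), on which T_L has simple weights: the monomial basis consists
    of weight vectors with exponents (x_i - y_i) - 2 r_i, for
    0 <= r_i <= x_i - y_i ([weight_basis]). With gam_i = x_i - r_i the exponents
    are 2 gam_i - x_i - y_i, and gam runs over the sequences with
    y_i <= gam_i <= x_i. Suppose that lam_i >= mu_i >= lam_(i+2) for all i. Then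
    x_i = min (mu_(i-1), lam_i) and y_i = max (mu_i, lam_(i+1))
    ([rearr_merge]), so that y_i <= gam_i <= x_i means mu < gam < lam^+
    ([betweenP]), and the decomposition follows ([Wspace_direct_sum]).

    That every pair of Lambda_B satisfies these inequalities is one half of the
    branching rule. It is deduced here from Phi ([LambdaB_interlaced]). Let f be
    a vector of W^(lam/mu) whose weight is extremal in every factor, and let h
    be the product, over all i, of the N-th powers of the minors with rows
    1, .., i and columns 1, .., i-1, n. For large N the degree of f h is
    interlaced, with gaps min (mu_(i-1), lam_i) - max (mu_i, lam_(i+1)) + N,
    and these bound the weight (x_i - y_i) + N of f h. So the differences
    min - max are nonnegative. Here f h is not zero, since
    the coordinate ring of Sp_2n is an integral domain ([regular_domain]): the
    group is generated by transvections, two non-vanishing loci meet on each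
    affine line of transvections, and they can be moved along a product.

    The decomposition is canonical because each line contains a vector that does
    not depend on Phi ([pattern_vector]): a monomial in the minors on the first
    k rows and on columns 1, .., j followed by some of n, -n. The degree of
    such a minor has all differences x_i - y_i equal to 0 but possibly one, say
    the j-th, which is then 1. So an element of L acts on the minor through its
    j-th component only, hence as an element of the diagonal subgroup, where Phi
    is right translation; as L acts by automorphisms on each B_sigma, its action
    on monomials is forced ([cv_tower]).

    Finally the spaces W^(lam/mu) generate the branching algebra
    ([branching_generated]). A regular function is a finite sum of weight
    vectors for the two tori ([weight_decomposition]); the components inherit
    the unipotent invariance by independence of characters; and a nonzero
    invariant weight vector has a dominant weight, by reduction to SL2
    ([rank_one]). Vectors taken from the lines are independent, being
    simultaneous eigenvectors of the tori and of T_L with distinct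
    eigenvalues ([adapted_independent]). *)

(** * Regular functions *)

Section PolynomialFunctions.
Variables (C : numFieldType).

Definition poly_fun (f : C -> C) : Prop := exists p : {poly C}, forall s, f s = p.[s].

Lemma poly_nonroot (p : {poly C}) : p != 0 -> exists k : nat, ~~ root p k.+1%:R.
Proof.
move=> p0; pose rs : seq C := [seq i.+1%:R | i <- iota 0 (size p)].
have [/allP h|/allPn [x /mapP [k _ ->]]] := boolP (all (root p) rs); last by exists k.
suff: (size rs < size p)%N by rewrite size_map size_iota ltnn.
apply: max_poly_roots => //; first exact/allP.
by rewrite map_inj_uniq ?iota_uniq // => i j /eqP; rewrite eqr_nat => /eqP [].
Qed.

(** Sets of functions closed under the operations of an algebra. Regular functions
    on Sp and polynomial functions of one variable are two instances, and a curve
    or a translation carries the first to the second. *)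
Definition function_algebra X (K : set (X -> C)) : Prop :=
  [/\ forall c, K (fun=> c), forall f g, K f -> K g -> K (fun x => f x + g x)
    & forall f g, K f -> K g -> K (fun x => f x * g x)].

Section FunctionAlgebra.
Variables (X : Type) (K : set (X -> C)).
Hypothesis (KP : function_algebra K).

Lemma funalg_sum (I : Type) (r : seq I) (P : pred I) (F : I -> X -> C) :
  (forall i, K (F i)) -> K (fun x => \sum_(i <- r | P i) F i x).
Proof.
case: KP => Kc KD _ KF; elim: r => [|i r IH].
  by under [X in K X]eq_fun do rewrite big_nil; apply: Kc.
under [X in K X]eq_fun do rewrite big_cons.
by case: (P i) => //; apply: KD.
Qed.

Lemma funalg_prod (I : Type) (r : seq I) (P : pred I) (F : I -> X -> C) :
  (forall i, K (F i)) -> K (fun x => \prod_(i <- r | P i) F i x).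
Proof.
case: KP => Kc _ KM KF; elim: r => [|i r IH].
  by under [X in K X]eq_fun do rewrite big_nil; apply: Kc.
under [X in K X]eq_fun do rewrite big_cons.
by case: (P i) => //; apply: KM.
Qed.

Lemma funalg_exp (f : X -> C) k : K f -> K (fun x => f x ^+ k).
Proof.
case: KP => Kc _ KM Kf; elim: k => [|k IH].
  by under [X in K X]eq_fun do rewrite expr0; apply: Kc.
by under [X in K X]eq_fun do rewrite exprS; apply: KM.
Qed.

Lemma funalg_mulmx p q r (A : X -> 'M[C]_(p, q)) (B : X -> 'M[C]_(q, r)) :
  (forall i j, K (fun x => A x i j)) -> (forall i j, K (fun x => B x i j)) ->
  forall i j, K (fun x => (A x *m B x) i j).
Proof.
move=> KA KB i j; under [X in K X]eq_fun do rewrite mxE. 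
by apply: funalg_sum => k; case: KP => _ _ KM; apply: KM.
Qed.

Lemma funalg_addmx p q (A B : X -> 'M[C]_(p, q)) :
  (forall i j, K (fun x => A x i j)) -> (forall i j, K (fun x => B x i j)) ->
  forall i j, K (fun x => (A x + B x) i j).
Proof.
move=> KA KB i j; under [X in K X]eq_fun do rewrite mxE. 
by case: KP => _ KD _; apply: KD.
Qed.

Lemma funalg_constmx p q (A : 'M[C]_(p, q)) i j : K (fun=> A i j).
Proof. by case: KP. Qed.

Lemma funalg_det p (A : X -> 'M[C]_p) :
  (forall i j, K (fun x => A x i j)) -> K (fun x => \det (A x)).
Proof.
move=> KA; apply: funalg_sum => s; case: KP => Kc _ KM.
by apply: KM; [exact: Kc | apply: funalg_prod].
Qed.

(** A regular function is a polynomial in the matrix entries, so it suffices to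
    look at the entries of the map that is composed with it. *)
Lemma regular_pull n (f : Sp C n -> C^o) (phi : X -> Sp C n) :
  regular_fun f -> (forall i j, K (fun x => phi x i j)) -> K (fun x => f (phi x)).
Proof.
case=> p fp Kphi; under [X in K X]eq_fun do rewrite fp mpoly.mevalE.
apply: funalg_sum => m; case: KP => Kc _ KM; apply: KM; first exact: Kc.
apply: funalg_prod => k; apply: funalg_exp.
case/mxvec_indexP: k => i j; under [X in K X]eq_fun do rewrite mxvecE.
exact: Kphi.
Qed.

End FunctionAlgebra.

Lemma poly_fun_algebra : function_algebra poly_fun.
Proof.
split=> [c|f g [p fp] [q gq]|f g [p fp] [q gq]]; first by exists c%:P => s; rewrite hornerC.
  by exists (p + q) => s; rewrite hornerD fp gq.
by exists (p * q) => s; rewrite hornerM fp gq.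
Qed.

Lemma poly_fun_id : poly_fun id.
Proof. by exists 'X => s; rewrite hornerX. Qed.

Lemma regular_algebra n : function_algebra (@regular_fun C n).
Proof.
split=> [c|f g [p fp] [q gq]|f g [p fp] [q gq]].
- by exists (mpoly.mpolyC _ c) => g; rewrite mpoly.mevalC.
- by eexists => h; rewrite fp gq; apply/esym/mpoly.mevalD.
- by eexists => h; rewrite fp gq; apply/esym/mpoly.mevalM.
Qed.

Lemma regular_entry n i j : @regular_fun C n (fun g => g i j).
Proof.
exists (mpoly.mpolyX _ (mpoly.mnm1 (mxvec_index i j))) => g.
by rewrite mpoly.mevalXU mxvecE.
Qed.

Lemma regular_translate n (f : Sp C n -> C^o) (a b : Sp C n) :
  regular_fun f -> regular_fun (fun g => f (a * g * b)%g : C^o).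
Proof.
move=> fr; apply: (regular_pull (regular_algebra n) fr) => i j.
apply: (funalg_mulmx (regular_algebra n)) => {}i {}j; last first.
  exact: (funalg_constmx (regular_algebra n)).
apply: (funalg_mulmx (regular_algebra n)) => {}i {}j.
  exact: (funalg_constmx (regular_algebra n)).
exact: regular_entry.
Qed.

End PolynomialFunctions.

(** * The coordinate ring of the symplectic group is a domain *)

Section Transvections.
Variables (C : numFieldType) (n : nat).
Local Notation J := (Jmx C n).
Local Notation Sp := (Sp C n).
Implicit Types (u v w : 'cV[C]_(n + n)) (g h T : Sp).

Definition sform u v : C := (u^T *m J *m v) 0 0.

Lemma sformE u v : u^T *m J *m v = (sform u v)%:M.
Proof. by rewrite [LHS]mx11_scalar. Qed.

Lemma sformC u v : sform u v = - sform v u.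
Proof.
rewrite /sform -[in LHS](trmxK (_ *m v)) mxE !trmx_mul trmxK Jmx_tr.
by rewrite mulNmx mulmxN mulmxA mxE.
Qed.

Lemma sformDl u v w : sform (u + v) w = sform u w + sform v w.
Proof. by rewrite /sform linearD /= !mulmxDl mxE. Qed.

Lemma sformNl u v : sform (- u) v = - sform u v.
Proof. by rewrite /sform linearN /= !mulNmx mxE. Qed.

Lemma sformDr u v w : sform w (u + v) = sform w u + sform w v.
Proof. by rewrite sformC sformDl opprD -!sformC. Qed.

Lemma sform_id u : sform u u = 0.
Proof.
have /eqP := sformC u u; rewrite -addr_eq0 -mulr2n mulrn_eq0 /=.
by move/eqP.
Qed.

Lemma sform_sp g u v : sform (g *m u) (g *m v) = sform u v.
Proof. by rewrite /sform trmx_mul -!mulmxA (mulmxA g^T) (mulmxA _ g) spP. Qed.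

Definition basis_vec (r : 'I_(n + n)) : 'cV[C]_(n + n) := delta_mx r 0.

(** In the basis of the e_(+-i), the form pairs an index with its opposite. *)
Lemma sform_basis r u : sform (basis_vec r) u = (-1) ^+ (n <= r)%N * u (rev_ord r) 0.
Proof.
rewrite /sform /basis_vec trmx_delta -rowE mxE (bigD1 (rev_ord r)) //= big1 => [|i ir].
  by rewrite mxE JmxE eqxx mulr1 addr0.
by rewrite mxE JmxE (negPf ir) mulr0 mul0r.
Qed.

Definition transvection_mx v (c : C) : 'M[C]_(n + n) := 1%:M + c *: (v *m v^T *m J).

Lemma transvection_mxE v c u : transvection_mx v c *m u = u + (c * sform v u) *: v.
Proof.
rewrite /transvection_mx mulmxDl mul1mx -scalemxAl -!mulmxA [v^T *m _]mulmxA sformE.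
by rewrite mul_mx_scalar scalerA.
Qed.

Fact transvection_subproof v c : (transvection_mx v c)^T *m J *m transvection_mx v c == J.
Proof.
have vJv : v^T *m J *m v = 0 by rewrite sformE sform_id; apply/matrixP=> i j; rewrite !mxE mul0rn.
have -> : (transvection_mx v c)^T = 1%:M - c *: (J *m v *m v^T).
  rewrite /transvection_mx linearD /= trmx1 linearZ /= !trmx_mul trmxK Jmx_tr.
  by rewrite mulNmx scalerN mulmxA.
rewrite /transvection_mx mulmxBl mul1mx mulmxDr mulmx1 mulmxBl.
rewrite -!scalemxAr -!scalemxAl -!mulmxA.
have -> : J *m (v *m (v^T *m (J *m (v *m (v^T *m J))))) = 0.
  by rewrite (mulmxA J v) (mulmxA v^T) (mulmxA (v^T *m J) v) vJv mul0mx !mulmx0.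
by rewrite !scaler0 subr0 subrK.
Qed.

Definition transvection v c : Sp := MkSp (transvection_subproof v c).

(** A substitute for the irreducibility of Sp that is stable under products: these
    elements form a subgroup, so that a set of generators decides. *)
Definition connected : set Sp := [set h | forall f1 f2 : Sp -> C^o,
  regular_fun f1 -> regular_fun f2 -> forall x, f1 x != 0 -> f2 (x * h)%g != 0 ->
  exists y, f1 y != 0 /\ f2 y != 0].

Lemma connected1 : connected 1%g.
Proof. by move=> f1 f2 _ _ x f1x; rewrite mulg1; exists x. Qed.

Lemma connectedM g h : connected g -> connected h -> connected (g * h)%g.
Proof.
move=> cg ch f1 f2 r1 r2 x f1x; rewrite mulgA => f2x.
have [||y [f1y f2y]] := cg f1 (fun y => f2 (y * h)%g : C^o) r1 _ x f1x.
- by have := regular_translate 1%g h r2; under eq_fun do rewrite mul1g.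
- by [].
- exact: ch f2y.
Qed.

Lemma connectedV g : connected g -> connected (g^-1)%g.
Proof.
move=> cg f1 f2 r1 r2 x f1x f2x.
have [||y [? ?]] := cg f2 f1 r2 r1 (x * g^-1)%g => //; last by exists y.
by rewrite -mulgA mulVg mulg1.
Qed.

(** The line x (1 + s v v^T J) joins x to its translate. On it both functions are
    polynomials in s, and neither is zero: the first at s = 0, the second at s = c. *)
Lemma connected_transvection v c : connected (transvection v c).
Proof.
move=> f1 f2 r1 r2 x f1x f2x.
have K : forall i j, poly_fun (fun s => (x * transvection v s)%g i j).
  apply: (funalg_mulmx (poly_fun_algebra C)).
    by move=> i j; apply: (funalg_constmx (poly_fun_algebra C)).
  apply: (funalg_addmx (poly_fun_algebra C)).
    by move=> i j; apply: (funalg_constmx (poly_fun_algebra C)).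
  move=> i j; under [X in poly_fun X]eq_fun do rewrite mxE.
  have [Kc _ KM] := poly_fun_algebra C.
  by apply: KM; [exact: poly_fun_id | exact: Kc].
have [p pE] := regular_pull (poly_fun_algebra C) r1 K.
have [q qE] := regular_pull (poly_fun_algebra C) r2 K.
have tv0 : transvection v 0 = 1%g by apply/val_inj; rewrite /= /transvection_mx scale0r addr0.
have p0 : p != 0.
  apply: contraNneq f1x => p0; have := pE 0; rewrite tv0 mulg1 => ->.
  by rewrite p0 horner0.
have q0 : q != 0 by apply: contraNneq f2x => q0; rewrite qE q0 horner0.
have [|k] := @poly_nonroot _ (p * q); first by rewrite mulf_neq0.
rewrite rootM negb_or => /andP[pk qk].
by exists (x * transvection v k.+1%:R)%g; rewrite pE qE.
Qed.

Section Stage.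
Variable k : nat.

(** The indices of the e_(+-i) that an element has already been made to fix, when
    it is reduced to 1 by transvections; the vectors of [late] are those orthogonal
    to them, the only ones along which the reduction may still go on. *)
Definition early (r : 'I_(n + n)) : bool := (r < k)%N || (rev_ord r < k)%N.

Lemma early_rev r : early (rev_ord r) = early r.
Proof. by rewrite /early rev_ordK orbC. Qed.

Definition late v : Prop := forall r, early r -> v r 0 = 0.
Definition fixes_early g : Prop := forall r, early r -> g *m basis_vec r = basis_vec r.

Lemma lateD u v : late u -> late v -> late (u + v).
Proof. by move=> lu lv r er; rewrite mxE lu // lv // addr0. Qed.

Lemma lateN u : late u -> late (- u).
Proof. by move=> lu r er; rewrite mxE lu // oppr0. Qed.

Lemma late_basis r : ~~ early r -> late (basis_vec r).
Proof.
by move=> er s es; rewrite mxE; case: eqP er => // <-; rewrite es.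
Qed.

Lemma late_sform v r : late v -> early r -> sform v (basis_vec r) = 0.
Proof.
by move=> lv er; rewrite sformC sform_basis lv ?mulr0 ?oppr0 // early_rev.
Qed.

Lemma late_sp g u : fixes_early g -> late u -> late (g *m u).
Proof.
move=> fg lu r er; have er' : early (rev_ord r) by rewrite early_rev.
have := sform_sp g (basis_vec (rev_ord r)) u.
rewrite fg // !sform_basis rev_ordK lu // mulr0 => /eqP.
by rewrite mulf_eq0 signr_eq0 /= => /eqP.
Qed.

(** The moves that preserve what has been achieved. *)
Definition mover T : Prop := connected T /\ fixes_early T.

Lemma moverM T T' : mover T -> mover T' -> mover (T * T')%g.
Proof.
move=> [cT fT] [cT' fT']; split; first exact: connectedM.
by move=> r er; rewrite /= -mulmxA fT' // fT.
Qed.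

Lemma mover_transvection v c : late v -> mover (transvection v c).
Proof.
move=> lv; split=> [|r er]; first exact: connected_transvection.
by rewrite /= transvection_mxE late_sform // mulr0 scale0r addr0.
Qed.

(** The transvection along v - u, suitably scaled. It fixes the vectors orthogonal
    to v - u. *)
Lemma move_step u v : late u -> late v -> sform u v != 0 ->
  exists2 T, mover T & T *m u = v /\
    forall x, sform u x = sform v x -> T *m x = x.
Proof.
move=> lu lv uv; exists (transvection (v - u) (- (sform u v)^-1)).
  by apply: mover_transvection; apply: lateD => //; apply: lateN.
split=> [|x ux]; rewrite /= transvection_mxE sformDl sformNl.
  rewrite sform_id subr0 [sform v u]sformC mulNr mulrN opprK mulVf // scale1r.
  by rewrite addrC subrK.
by rewrite ux subrr mulr0 scale0r addr0.
Qed.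

Lemma move_via u w v : late u -> late w -> late v -> sform u w != 0 -> sform w v != 0 ->
  exists2 T, mover T & T *m u = v /\
    forall x, sform u x = sform w x -> sform w x = sform v x -> T *m x = x.
Proof.
move=> lu lw lv uw wv; have [T1 m1 [T1u f1]] := move_step lu lw uw.
have [T2 m2 [T2w f2]] := move_step lw lv wv.
exists (T2 * T1)%g; first exact: moverM.
by split=> [|x ux wx]; rewrite /= -mulmxA ?T1u // f1 // f2.
Qed.

Hypothesis ltkn : (k < n)%N.
Let i0 := Ordinal ltkn.
Let e := basis_vec (epos i0).
Let e' := basis_vec (eneg i0).

Lemma late_e : late e.
Proof. by apply: late_basis; rewrite /early /= ltnn; lia. Qed.
Lemma late_e' : late e'.
Proof. by apply: late_basis; rewrite /early /=; lia. Qed.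

Lemma sform_ee' : sform e e' = 1.
Proof.
have -> : sform e e' = (-1) ^+ (n <= epos i0)%N * (e' (eneg i0) 0) by apply: sform_basis.
by rewrite mxE !eqxx leqNgt ltkn mulr1.
Qed.

(** The two vectors may be orthogonal; the intermediate vector is then one of e',
    g e' and e' + g e', as one of these is orthogonal neither to g e nor to e. *)
Lemma move_e g : fixes_early g -> exists2 T, mover T & T *m (g *m e) = e.
Proof.
move=> fg; have lu := late_sp fg late_e; have lu' := late_sp fg late_e'.
have uu' : sform (g *m e) (g *m e') = 1 by rewrite sform_sp sform_ee'.
have ne x : sform e x != 0 -> sform x e != 0 by rewrite sformC oppr_eq0.
have [ue'|ue'] := eqVneq (sform (g *m e) e') 0; last first.
  have [|T mT [? _]] := move_via lu late_e' late_e ue'; last by exists T.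
  by apply: ne; rewrite sform_ee' oner_eq0.
have [eu'|eu'] := eqVneq (sform e (g *m e')) 0; last first.
  have [||T mT [? _]] := move_via lu lu' late_e; last by exists T.
    by rewrite uu' oner_eq0.
  exact: ne.
have [||T mT [? _]] := move_via lu (lateD late_e' lu') late_e; last by exists T.
  by rewrite sformDr ue' uu' add0r oner_eq0.
by apply: ne; rewrite sformDr eu' sform_ee' addr0 oner_eq0.
Qed.

(** The moves fix e, as e pairs in the same way with all the vectors involved; if
    g e' and e' are orthogonal, e + e' is an intermediate vector. *)
Lemma move_e' g : fixes_early g -> g *m e = e ->
  exists2 T, mover T & T *m (g *m e') = e' /\ T *m e = e.
Proof.
move=> fg ge; have lu' := late_sp fg late_e'.
have eu' : sform e (g *m e') = 1 by rewrite -{1}ge sform_sp sform_ee'.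
have ce x : sform e x = 1 -> sform x e = -1 by rewrite [sform x e]sformC => ->.
have [u'e'|u'e'] := eqVneq (sform (g *m e') e') 0; last first.
  have [T mT [Tu' fT]] := move_step lu' late_e' u'e'; exists T => //; split => //.
  by apply: fT; rewrite !ce ?sform_ee'.
have [||T mT [Tu' fT]] := move_via lu' (lateD late_e lu') late_e'.
- by rewrite sformDr sform_id addr0 ce // oppr_eq0 oner_eq0.
- by rewrite sformDl sform_ee' u'e' addr0 oner_eq0.
exists T => //; split=> //; apply: fT.
  by rewrite sformDl sform_id add0r.
by rewrite sformDl sform_id add0r !ce ?sform_ee'.
Qed.

End Stage.

(** Decreasing induction on the number of hyperbolic planes that are fixed: moving
    the images of e and e' back gives one more fixed plane. *)
Lemma connected_fixes k g : (k <= n)%N -> fixes_early (n - k) g -> connected g.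
Proof.
elim: k g => [|k IH] g kn fg.
  suff -> : g = 1%g by exact: connected1.
  apply/val_inj/matrixP => i j; have := fg j; rewrite subn0 /early /= => fj.
  have /matrixP/(_ i 0) : g *m basis_vec j = basis_vec j by apply: fj; have := ltn_ord j; lia.
  by rewrite /basis_vec -colE !mxE andbT.
have lt : (n - k.+1 < n)%N by lia.
have [T [cT fT] Te] := move_e lt fg.
have f1 : fixes_early (n - k.+1) (T * g)%g.
  by move=> r er; rewrite /= -mulmxA fg // fT.
have [|T' [cT' fT'] [T'e' T'e]] := move_e' (ltkn := lt) f1; first by rewrite /= -mulmxA Te.
suff /(connectedM (connectedV cT')) : connected (T' * (T * g))%g.
  by rewrite mulKg => /(connectedM (connectedV cT)); rewrite mulKg.
apply: IH => [|r er]; first lia.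
have [rE|rN] := boolP (early (n - k.+1) r).
  by rewrite /= -!mulmxA fg // fT // fT'.
have [->|->] : r = epos (Ordinal lt) \/ r = eneg (Ordinal lt).
- move: er rN; rewrite /early /= => er rN.
  have r_lt := ltn_ord r; have [rn|rn] := ltnP r n; [left|right]; apply/val_inj => /=; lia.
- rewrite /= -!mulmxA. by rewrite Te T'e.
- by rewrite /= -mulmxA.
Qed.

(** The non-vanishing loci of f1 and f2 are joined by a product of transvections. *)
Theorem regular_domain (f1 f2 : Sp -> C^o) : regular_fun f1 -> regular_fun f2 ->
  (exists x, f1 x != 0) -> (exists x, f2 x != 0) -> exists x, f1 x * f2 x != 0.
Proof.
move=> r1 r2 [x f1x] [y f2y].
have cxy : connected (x^-1 * y)%g.
  by apply: (@connected_fixes n) => // r; rewrite subnn.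
have [|z [z1 z2]] := cxy f1 f2 r1 r2 x f1x; first by rewrite mulVKg.
by exists z; rewrite mulf_neq0.
Qed.

End Transvections.

(** * Minors and their invariance *)

Section Minors.
Variables (C : numFieldType) (m : nat).
Local Notation n := m.+1.
Local Notation Sp := (Sp C n).
Implicit Types (g t s u v : Sp).

(** Indices as natural numbers, to describe rows and columns by arithmetic: with
    n = m + 1, the labels n and -n have the indices m and m + 1. *)
Definition ix (k : nat) : 'I_(n + n) := inord k.

Lemma ixK k : (k < n + n)%N -> ix k = k :> nat.
Proof. exact: inordK. Qed.

Lemma ix_val (i : 'I_(n + n)) : ix i = i.
Proof. by apply/val_inj; rewrite /= ixK. Qed.

Definition minor_col (j T c : nat) : nat := if (c < j)%N then c else (T + (c - j))%N.

Definition minor_mx (j d T : nat) (g : 'M[C]_(n + n)) : 'M[C]_(j + d) :=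
  \matrix_(r, c) g (ix r) (ix (minor_col j T c)).

(** The minor on the first j + d rows, and on the first j columns followed by the d
    columns from T on. With T = m or T = m + 1 the last ones are among n, -n. *)
Definition minor (j d T : nat) : Sp -> C^o := fun g => \det (minor_mx j d T g).

Lemma regular_minor j d T : regular_fun (minor j d T).
Proof.
apply: (funalg_det (regular_algebra C n)) => r c.
by under [X in regular_fun X]eq_fun do rewrite mxE; apply: regular_entry.
Qed.

Lemma sum_low (k N : nat) (F : nat -> C) : (k <= N)%N ->
  (forall l, (k <= l)%N -> (l < N)%N -> F l = 0) -> \sum_(l < N) F l = \sum_(l < k) F l.
Proof.
move=> kN F0; rewrite (big_ord_widen _ F kN) [RHS]big_mkcond /=.
by apply: eq_bigr => l _; case: ltnP => // kl; apply: F0.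
Qed.

(** Left multiplication by a lower triangular matrix acts on the first k rows by a
    triangular matrix. This gives both the invariance under the lower unipotent
    group and the weight for the torus. *)
Lemma minor_lower j d T v g : (j + d <= n)%N -> is_trig_mx v ->
  minor j d T (v * g)%g = \prod_(r < j + d) v (ix r) (ix r) * minor j d T g.
Proof.
move=> jd /is_trig_mxP vt.
pose V : 'M[C]_(j + d) := \matrix_(r, l) v (ix r) (ix l).
have -> : minor j d T (v * g)%g = \det (V *m minor_mx j d T g).
  congr (\det _); apply/matrixP => r c; rewrite !mxE.
  under eq_bigr => l _ do rewrite -{1 2}[l]ix_val.
  rewrite (@sum_low (j + d) _ (fun l => v (ix r) (ix l) * g (ix l) _)); first last.
  - by move=> l kl lN; rewrite vt ?mul0r // !ixK //; have := ltn_ord r; lia.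
  - lia.
  by apply: eq_bigr => l _; rewrite !mxE.
rewrite det_mulmx det_trig; first by congr (_ * _); apply: eq_bigr => r _; rewrite mxE.
apply/is_trig_mxP => r l rl; rewrite mxE vt // !ixK //.
all: by have := ltn_ord r; have := ltn_ord l; lia.
Qed.

Lemma Sp_sub_col u (c l : 'I_(n + n)) : Sp_sub u -> (m <= c <= m.+1)%N ->
  u l c = (l == c)%:R.
Proof.
move=> us mc; have [|] := us ord_max; first by [].
move=> /matrixP/(_ l 0); rewrite !mxE andbT => up /matrixP/(_ l 0).
rewrite !mxE andbT => un.
have [->|->] : c = epos (ord_max : 'I_n) \/ c = eneg (ord_max : 'I_n) => //.
by have [cm|cm] := eqVneq (c : nat) m; [left|right]; apply/val_inj => /=; lia.
Qed.

(** The columns n and -n of an element of Sp_(2n-2) are those of the identity, and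
    the columns 1, .., j only see the columns before them. *)
Lemma minor_upper j d T g u : (j <= m)%N -> (j + d <= n)%N -> (m <= T)%N -> (T + d <= m.+2)%N ->
  is_trig_mx (u : 'M_(n + n))^T -> Sp_sub u ->
  minor j d T (g * u)%g = minor j d T g * \prod_(c < j) u (ix c) (ix c).
Proof.
move=> jm jd mT Td /is_trig_mxP ut us.
have {}ut (a b : 'I_(n + n)) : (b < a)%N -> u a b = 0 by move=> /ut; rewrite mxE.
pose U : 'M[C]_(j + d) :=
  \matrix_(l, c) u (ix (minor_col j T l)) (ix (minor_col j T c)).
have colN (c : 'I_(j + d)) : (minor_col j T c < n + n)%N.
  by rewrite /minor_col; have := ltn_ord c; case: ifP => _; lia.
have cole (c : 'I_(j + d)) : (j <= c)%N -> (m <= minor_col j T c <= m.+1)%N.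
  by move=> jc; rewrite /minor_col ltnNge jc /=; have := ltn_ord c; lia.
have col_inj (c l : 'I_(j + d)) : (minor_col j T c == minor_col j T l) = (c == l).
  apply/eqP/eqP => [|-> //]; rewrite /minor_col => e; apply/val_inj => /=.
  have := ltn_ord c; have := ltn_ord l; move: e; do 2!case: ifP; lia.
have -> : minor j d T (g * u)%g = \det (minor_mx j d T g *m U).
  congr (\det _); apply/matrixP => r c; rewrite !mxE.
  have [cj|jc] := ltnP c j.
    have cE : minor_col j T c = c by rewrite /minor_col cj.
    under eq_bigr => l _ do rewrite -{1 2}[l]ix_val.
    rewrite (@sum_low j _ (fun l => g (ix r) (ix l) * u (ix l) _)); first last.
    - by move=> l kl lN; rewrite [u _ _]ut ?mulr0 // cE !ixK //; lia.
    - lia.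
    rewrite big_split_ord /= [X in _ = _ + X]big1 ?addr0 => [|l _].
      by apply: eq_bigr => l _; rewrite !mxE /minor_col /= ltn_ord.
    rewrite !mxE [u _ _]ut ?mulr0 // cE !ixK //. all: try lia.
    by have := cole (rshift j l); rewrite /= leq_addr => /(_ isT); lia.
  have uE (l : 'I_(n + n)) : u l (ix (minor_col j T c)) = (l == ix (minor_col j T c))%:R.
    by apply: Sp_sub_col => //; rewrite ixK //; apply: cole.
  rewrite (bigD1 (ix (minor_col j T c))) //= uE eqxx mulr1 big1 => [|l lc]; last first.
    by rewrite uE (negPf lc) mulr0.
  rewrite addr0 (bigD1 c) //= !mxE uE eqxx mulr1 big1 ?addr0 // => l lc.
  by rewrite !mxE uE -val_eqE /= !ixK // col_inj (negPf lc) mulr0.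
rewrite det_mulmx; congr (_ * _); rewrite -det_tr det_trig; last first.
  apply/is_trig_mxP => c l cl; rewrite !mxE ut // !ixK //.
  rewrite /minor_col; have := ltn_ord l; do 2!case: ifP; lia.
rewrite big_split_ord /= [X in _ * X]big1 ?mulr1 => [|c _].
  by apply: eq_bigr => c _; rewrite !mxE /minor_col /= ltn_ord.
rewrite !mxE Sp_sub_col ?eqxx // ixK //.
by apply: cole; rewrite /= leq_addr.
Qed.

End Minors.

(** * Non-vanishing of the minors *)

Lemma det_mx2 (K : comPzRingType) (A : 'M[K]_2) :
  \det A = A 0 0 * A 1 1 - A 0 1 * A 1 0.
Proof.
rewrite (expand_det_row _ 0) !big_ord_recl big_ord0 /cofactor !det_mx11 !mxE /=.
have l1 : lift 0 0 = 1 :> 'I_2 by apply/val_inj.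
have l0 : lift 1 0 = 0 :> 'I_2 by apply/val_inj.
by rewrite l1 l0 addr0 expr0 expr1 mul1r mulN1r mulrN.
Qed.

Section Levi.
Variables (C : numFieldType) (n : nat).
Local Notation s := (antidiag_mx C n).

Lemma antidiagE p (A : 'M[C]_(n, p)) i j : (s *m A) i j = A (rev_ord i) j.
Proof.
rewrite mxE (bigD1 (rev_ord i)) //= mxE eqxx mul1r big1 ?addr0 // => k ki.
by rewrite mxE (negPf ki) mul0r.
Qed.

Lemma antidiagEr p (A : 'M[C]_(p, n)) i j : (A *m s) i j = A i (rev_ord j).
Proof.
rewrite mxE (bigD1 (rev_ord j)) //= mxE rev_ordK eqxx mulr1 big1 ?addr0 // => k kj.
by rewrite mxE -{1}[j]rev_ordK (inj_eq rev_ord_inj) eq_sym (negPf kj) mulr0.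
Qed.

Fact levi_subproof (A B : 'M[C]_n) (AB : A *m B = 1%:M) (g := block_mx A 0 0 (s *m B^T *m s)) :
  g^T *m Jmx C n *m g == Jmx C n.
Proof.
have sT : s^T = s.
  apply/matrixP => i j; rewrite !mxE; congr (nat_of_bool _)%:R.
  by rewrite eq_sym (can2_eq (@rev_ordK _) (@rev_ordK _)).
rewrite /g /Jmx tr_block_mx !trmx0 !trmx_mul trmxK sT !mulmx_block.
rewrite !mulmx0 !mul0mx !addr0 !add0r.
rewrite -!mulmxA (mulmxA s s) antidiag_mxK mul1mx mulNmx !mulmxN.
rewrite (mulmxA s s) antidiag_mxK mul1mx (mulmx1C AB) mulmx1 (mulmxA A^T).
by rewrite -trmx_mul (mulmx1C AB) trmx1 mul1mx !mul0mx.
Qed.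

(** The Levi factor GL_n, as diag (A, s A^(-t) s). *)
Definition levi A B AB : Sp C n := MkSp (@levi_subproof A B AB).

Fact siegel_subproof (X : 'M[C]_n) (sX : s *m X = X^T *m s) (g := block_mx 1%:M X 0 1%:M) :
  g^T *m Jmx C n *m g == Jmx C n.
Proof.
rewrite /g /Jmx tr_block_mx !trmx0 !trmx1 !mulmx_block !mulmx0 !mul0mx !mul1mx !mulmx1.
by rewrite !addr0 !add0r mulNmx sX mul0mx add0r addNr.
Qed.

(** The unipotent radical of the Siegel parabolic subgroup. *)
Definition siegel X sX : Sp C n := MkSp (@siegel_subproof X sX).

End Levi.

Section NonVanishing.
Variables (C : numFieldType) (m : nat).
Local Notation n := m.+1.

Definition witness_vec : 'cV[C]_n := \col_r (r < m)%:R.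
(** The product of diag (A, s A^(-t) s) and of [1, X; 0, 1] has first rows [A, A X].
    The aim is to have the identity in columns 1, .., n-1, a column of ones in
    column n, and a column without two equal consecutive entries in column -n. The
    matrix X has to be symmetric about the antidiagonal, which Toeplitz matrices
    are; its entries r - c + 1 give [witness_q] in column -n. *)
Definition witness_A (e : C) : 'M[C]_n := 1%:M + e *: (witness_vec *m delta_mx 0 ord_max).
Definition witness_X : 'M[C]_n := \matrix_(r, c) (r%:R - c%:R + 1).

Lemma witness_AE e r c : witness_A e r c = (r == c)%:R + e * ((r < m)%N && (c == ord_max))%:R.
Proof.
rewrite !mxE big_ord_recl big_ord0 addr0 !mxE eqxx /=; congr (_ + _ * _).
by rewrite -natrM mulnb.
Qed.

Lemma witness_AB : witness_A 1 *m witness_A (- 1) = 1%:M.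
Proof.
have vv : delta_mx 0 ord_max *m witness_vec = 0 :> 'M_1.
  by apply/matrixP => i j; rewrite -rowE !mxE /= ltnn.
rewrite /witness_A scale1r scaleN1r mulmxBr mulmx1 mulmxDl mul1mx -!mulmxA.
by rewrite (mulmxA (delta_mx _ _) witness_vec) vv mul0mx mulmx0 addr0 addrK.
Qed.

Lemma witness_sX : antidiag_mx C n *m witness_X = witness_X^T *m antidiag_mx C n.
Proof.
apply/matrixP => i j; rewrite antidiagE antidiagEr !mxE /= !subSS.
by rewrite !natrB -1?ltnS // addrAC; ring.
Qed.

Definition witness_q (r : nat) : nat := r.+1 + (r < m) * n.

Definition witness (g : Sp C n) : Prop :=
  (forall r c, (r <= m)%N -> (c <= m)%N ->
     g (ix m r) (ix m c) = ((r == c) + (r < m) * (c == m))%:R) /\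
  (forall r, (r <= m)%N -> g (ix m r) (ix m n) = (witness_q r)%:R).

Lemma witness_exists : exists g, witness g.
Proof.
exists (levi witness_AB * siegel witness_sX)%g; split=> [r c rm cm|r rm] /=.
  rewrite mulmx_block !mul0mx !mulmx1 !mulmx0 !addr0.
  have -> : ix m r = lshift n (inord r) by apply/val_inj; rewrite /= ixK ?inordK //; lia.
  have -> : ix m c = lshift n (inord c) by apply/val_inj; rewrite /= ixK ?inordK //; lia.
  by rewrite block_mxEul witness_AE mul1r -!val_eqE /= !inordK // natrD mulnb.
rewrite mulmx_block !mul0mx !mulmx1 !mulmx0 !addr0.
have -> : ix m r = lshift n (inord r) by apply/val_inj; rewrite /= ixK ?inordK //; lia.
have -> : ix m n = rshift n 0 by apply/val_inj; rewrite /= ixK ?addn0 //; lia.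
rewrite block_mxEur /witness_A mulmxDl mul1mx scale1r -mulmxA -rowE !mxE big_ord_recl big_ord0.
by rewrite !mxE /= addr0 subr0 inordK // subr0 /witness_q natrD natrM -!natr1; ring.
Qed.

(** The first j columns are those of the identity, so only a block of size at most 2
    contributes. *)
Lemma minor_witness j d T g : witness g -> (j <= m)%N ->
  (j + d <= n)%N -> (m <= T)%N -> (T + d <= m.+2)%N ->
  minor j d T g = \det (\matrix_(r < d, c < d) g (ix m (j + r)) (ix m (T + c))).
Proof.
move=> [gl _] jm jd mT Td; rewrite /minor -[minor_mx _ _ _ _]submxK.
have -> : ulsubmx (minor_mx j d T g) = 1%:M.
  apply/matrixP => r c; rewrite !mxE /= /minor_col ltn_ord gl; last 2 first.
  - by have := ltn_ord r; lia.
  - by have := ltn_ord c; lia.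
  rewrite -val_eqE /= (_ : (c == m :> nat) = false) ?muln0 ?addn0 //.
  by have := ltn_ord c; lia.
have -> : dlsubmx (minor_mx j d T g) = 0.
  apply/matrixP => r c; rewrite !mxE /= /minor_col ltn_ord gl; last 2 first.
  - by have := ltn_ord r; lia.
  - by have := ltn_ord c; lia.
  rewrite (_ : (c == m :> nat) = false) ?muln0 ?addn0; last by have := ltn_ord c; lia.
  by rewrite (_ : (j + r == c)%N = false) //; have := ltn_ord c; lia.
rewrite det_ublock det1 mul1r; congr (\det _); apply/matrixP => r c.
by rewrite !mxE /= /minor_col ltnNge leq_addr addKn.
Qed.

Lemma minor1_witness j g : witness g -> (j <= m)%N ->
  minor j 1 m g != 0 /\ minor j 1 n g != 0.
Proof.
move=> gw jm; rewrite !minor_witness ?det_mx11 ?mxE //; try lia.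
case: gw => gl gr; rewrite /= !addn0 gl // gr //.
split; rewrite pnatr_eq0 ?eqxx; last by rewrite /witness_q.
by rewrite -lt0n; lia.
Qed.

Lemma minor2_witness j g : witness g -> (j.+1 <= m)%N -> minor j 2 m g != 0.
Proof.
move=> gw jm; rewrite minor_witness ?det_mx2 ?mxE //; try lia.
case: gw => gl gr. rewrite /= !addn0 !addn1 !gr; try lia.
rewrite !gl; try lia.
rewrite eqxx muln1 -!natrM subr_eq0 eqr_nat /witness_q.
by case: ltnP => ?; case: ltnP => ?; apply/eqP; lia.
Qed.

Lemma minor0_one j T : (j <= m)%N -> minor j 0 T (1%g : Sp C n) = 1.
Proof.
move=> jm; rewrite /minor (_ : minor_mx _ _ _ _ = 1%:M) ?det1 //.
apply/matrixP => r c; rewrite !mxE /minor_col.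
have rj : (r < j)%N by have := ltn_ord r; lia.
have cj : (c < j)%N by have := ltn_ord c; lia.
by rewrite cj -!val_eqE /= !ixK //; lia.
Qed.

End NonVanishing.

(** * The sorted sequence of an interlaced pair *)

Section Interlacing.

(** The sequence x_1, y_1, x_2, .. of an interlaced pair: each max and min of
    mu_i and lam_(i+1) takes the places of y_i and x_(i+1). *)
Fixpoint merge_pair (x : nat) (mu lam : seq nat) : seq nat :=
  match mu, lam with
  | a :: mu', b :: lam' => x :: maxn a b :: merge_pair (minn a b) mu' lam'
  | _, _ => [:: x; 0%N]
  end.

(** The bounds of gam_i in mu < gam < lam^+. By the default value 0 of [nth], they
    vanish beyond the last entry. *)
Definition upper (mu lam : seq nat) (i : nat) : nat :=
  if i is j.+1 then minn (nth 0%N mu j) (nth 0%N lam i) else nth 0%N lam 0.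

Definition lower (mu lam : seq nat) (i : nat) : nat :=
  maxn (nth 0%N mu i) (nth 0%N lam i.+1).

Lemma merge_pair_perm x mu lam : size mu = size lam ->
  perm_eq (mu ++ rcons (x :: lam) 0%N) (merge_pair x mu lam).
Proof.
move=> sz; apply/permP => p; elim: mu x lam sz => [|a mu IH] x [|b lam] //= [sz].
have := IH (minn a b) lam sz; rewrite !count_cat /= => <-.
have : (p (maxn a b) + p (minn a b) = p a + p b)%N.
  by rewrite /maxn /minn; case: ltnP => _; rewrite addnC.
lia.
Qed.

Lemma nth_merge_pair x mu lam i : size mu = size lam -> (i <= size mu)%N ->
  nth 0%N (merge_pair x mu lam) i.*2 = upper mu (x :: lam) i /\
  nth 0%N (merge_pair x mu lam) i.*2.+1 = lower mu (x :: lam) i.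
Proof.
elim: mu x lam i => [|a mu IH] x [|b lam] // i; first by case: i.
case: i => [|i] //= [sz] im.
have [-> ->] := IH (minn a b) lam i sz im; split => //.
by case: i im => [|i] im.
Qed.

Lemma size_merge_pair x mu lam : size mu = size lam ->
  size (merge_pair x mu lam) = (size mu).+1.*2.
Proof. by elim: mu x lam => [|a mu IH] x [|b lam] //= [sz]; rewrite IH. Qed.

Variable m : nat.
Implicit Types (mu : m.-tuple nat) (lam gam : m.+1.-tuple nat).

(** Equivalent to lam_i >= mu_i >= lam_(i+2) for sorted sequences. *)
Definition interlaced mu lam : Prop :=
  forall i, (i <= m)%N -> (lower mu lam i <= upper mu lam i)%N.

Lemma rearr_merge mu lam (il : interlaced mu lam) :
  rearr (n := m.+1) mu lam = merge_pair (head 0%N lam) mu (behead lam).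
Proof.
have sz : size mu = size (behead lam) by rewrite size_behead !size_tuple.
have lE : tval lam = head 0%N lam :: behead lam by case: lam {il sz} => [[|x s] //].
apply: (@sorted_eq _ geq).
- by move=> a b c /= ba ac; apply: leq_trans ac ba.
- by move=> a b /= /andP[ab ba]; apply/eqP; rewrite eqn_leq ab ba.
- by apply: sort_sorted => a b /=; apply: leq_total.
- apply/(sortedP 0%N) => k; rewrite size_merge_pair // size_tuple => km.
  have nm := nth_merge_pair (head 0%N lam) sz; rewrite -lE size_tuple in nm.
  have im : (k./2 <= m)%N by lia.
  have [eX eY] := nm _ im.
  rewrite -[k in nth _ _ k]odd_double_half -[k in nth _ _ k.+1]odd_double_half.
  have [ko|ko] := boolP (odd k); last by rewrite add0n eX eY; apply: il.
  have im' : (k./2.+1 <= m)%N by lia.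
  have [eX' _] := nm _ im'.
  rewrite add1n -doubleS eX' eY /upper /lower /=; lia.
- rewrite /rearr perm_sort lE; exact: merge_pair_perm.
Qed.

End Interlacing.

(** * Weight vectors common to all admissible representations *)

Section Generators.
Variables (C : numFieldType) (m : nat).
Local Notation n := m.+1.
Local Notation fn := (Sp C n -> C^o).
Implicit Types (mu : m.-tuple nat) (lam gam : n.-tuple nat) (f : fn).
Implicit Types (Phi : Lgroup C n -> fn -> fn).

Lemma xseqE mu lam i : interlaced mu lam -> (i <= m)%N ->
  xseq (n := n) mu lam i = upper mu lam i /\ yseq (n := n) mu lam i = lower mu lam i.
Proof.
move=> il im; have sz : size mu = size (behead lam) by rewrite size_behead !size_tuple.
have lE : tval lam = head 0%N lam :: behead lam by case: lam {il sz} => [[|x s] //].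
rewrite /xseq /yseq rearr_merge //.
by have [|-> ->] := @nth_merge_pair (head 0%N lam) _ _ i sz; rewrite -?lE // size_tuple.
Qed.

Lemma Adim_interlaced mu lam (i : 'I_n) : interlaced mu lam ->
  Adim (n := n) mu lam i = (upper mu lam i - lower mu lam i)%N.
Proof.
move=> il; have im : (i <= m)%N by rewrite -ltnS.
by have [e1 e2] := xseqE il im; rewrite /Adim e1 e2.
Qed.

Lemma Fmx_trivial k (h : 'M[C]_2) (r c : 'I_k.+1) : k = 0%N -> Fmx k h r c = 1.
Proof. by move=> k0; subst k; rewrite !ord1 mxE /= !expr0 mul1r coefC. Qed.

Lemma tensF_act_eq k (l l' : Lgroup C n) (a : tensF C k) :
  (forall i, k i = 0%N \/ l i = l' i) -> tensF_act l a = tensF_act l' a.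
Proof.
move=> ll; apply/ffunP => r; rewrite !ffunE; apply: eq_bigr => c _; congr (_ * _).
apply: eq_bigr => i _; have [k0|->//] := ll i.
by rewrite !Fmx_trivial.
Qed.

Lemma Wspace_branching mu lam f : Wspace C (n := n) mu lam f -> branching_algebra C n f.
Proof. by case. Qed.

(** This reduces the action of L on a multiplicity space with few nontrivial factors
    to the diagonal subgroup, where it is known. *)
Lemma Phi_eq Phi mu lam (l l' : Lgroup C n) f : is_branching_rep Phi ->
  LambdaB C (n := n) mu lam -> Wspace C (n := n) mu lam f ->
  (forall i, Adim (n := n) mu lam i = 0%N \/ l i = l' i) -> Phi l f = Phi l' f.
Proof.
move=> PhiP ml Wf ll; have [theta [_ _ rt act]] := brep_iso PhiP ml.
have [a _ <-] : range theta f by rewrite rt.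
by rewrite !act (tensF_act_eq _ ll).
Qed.

Definition fn_tuple k (a : nat -> nat) : k.-tuple nat := mktuple (fun i : 'I_k => a i).

Lemma nth_fn_tuple k a i : nth 0%N (fn_tuple k a) i = if (i < k)%N then a i else 0%N.
Proof.
case: ltnP => ik; last by rewrite nth_default // size_tuple.
rewrite (_ : i = Ordinal ik) // -tnth_nth; exact: tnth_mktuple.
Qed.

Lemma tcharD (a b c : seq nat) (t : Sp C n) :
  (forall i, nth 0%N c i = (nth 0%N a i + nth 0%N b i)%N) -> tchar c t = tchar a t * tchar b t.
Proof. by move=> abc; rewrite -big_split; apply: eq_bigr => i _; rewrite abc exprD. Qed.

Lemma WspaceM mu lam f mu' lam' f' mu'' lam'' :
  Wspace C (n := n) mu lam f -> Wspace C (n := n) mu' lam' f' ->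
  (forall i, nth 0%N mu'' i = (nth 0%N mu i + nth 0%N mu' i)%N) ->
  (forall i, nth 0%N lam'' i = (nth 0%N lam i + nth 0%N lam' i)%N) ->
  Wspace C (n := n) mu'' lam'' (f * f').
Proof.
move=> [[fr fi] fw] [[fr' fi'] fw'] mm ll; split; first split.
- by have [_ _ KM] := regular_algebra C n; apply: KM.
- by move=> v g u hv hu hs; rewrite /= -[LHS]/(f _ * f' _) fi // fi'.
- move=> t g s ht hs hs'; rewrite -[LHS]/(f _ * f' _) fw // fw' //.
  by rewrite (tcharD _ mm) (tcharD _ ll) -[(f * f') g]/(f g * f' g); ring.
Qed.

Lemma tchar_fn_tuple k (a : nat -> nat) (t : Sp C n) : (k <= n)%N ->
  tchar (fn_tuple k a) t = \prod_(i < k) t (ix m i) (ix m i) ^+ a i.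
Proof.
move=> kn; rewrite (big_ord_widen n (fun i => t (ix m i) (ix m i) ^+ a i)) //.
rewrite [RHS]big_mkcond /=; apply: eq_bigr => i _; rewrite nth_fn_tuple.
have -> : ix m i = epos i by apply/val_inj; rewrite /= ixK //; have := ltn_ord i; lia.
by case: ifP.
Qed.

(** The weight omega_k = (1, .., 1, 0, .., 0), as a function. *)
Definition ones (k : nat) : nat -> nat := fun i => (i < k)%N.

Lemma prod_ones (F : nat -> C) k N : (k <= N)%N ->
  \prod_(i < N) F i ^+ ones k i = \prod_(i < k) F i.
Proof.
move=> kN; rewrite (big_ord_widen N F) // [RHS]big_mkcond /=.
by apply: eq_bigr => i _; rewrite /ones; case: ifP.
Qed.

Lemma Wspace_minor j d T : (j <= m)%N -> (j + d <= n)%N -> (m <= T)%N -> (T + d <= m.+2)%N ->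
  Wspace C (n := n) (fn_tuple m (ones j)) (fn_tuple n (ones (j + d))) (minor j d T).
Proof.
move=> jm jd mT Td; split; first split; first exact: regular_minor.
  move=> v g u [vt v1] [ut u1] us; rewrite minor_upper // minor_lower //.
  by rewrite big1 ?mul1r ?big1 ?mulr1.
move=> t g s /is_diag_mxP td /is_diag_mxP sd ss; rewrite minor_upper //; last first.
  by apply/is_trig_mxP => a b ab; rewrite mxE sd // neq_ltn ab orbT.
rewrite minor_lower //; last by apply/is_trig_mxP => a b ab; rewrite td // neq_ltn ab.
rewrite !tchar_fn_tuple // (prod_ones (fun i => t (ix m i) (ix m i))) //.
by rewrite (prod_ones (fun i => s (ix m i) (ix m i))) //; ring.
Qed.

End Generators.

Section CanonicalVectors.
Variables (C : numFieldType) (m : nat).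
Local Notation n := m.+1.
Local Notation fn := (Sp C n -> C^o).
Implicit Types (sigma : order_type n) (mu lam : nat -> nat) (w : nat -> int) (f : fn).
Implicit Types (Phi : Lgroup C n -> fn -> fn).

Definition TLweight w (l : Lgroup C n) : C := \prod_(i < n) (l i 0 0) ^ w i.

(** A nonzero vector of W^(lam/mu) that every admissible representation makes a
    T_L-weight vector of the same weight w. The order type allows products: L acts
    by automorphisms on B_sigma only. *)
Record canonical_vector (sigma : order_type n) (mu lam : nat -> nat) (w : nat -> int) (f : fn) :
    Prop := CanonicalVector {
  cv_W : Wspace C (n := n) (fn_tuple m mu) (fn_tuple n lam) f;
  cv_mu : forall i, (i.+1 < m)%N -> (mu i.+1 <= mu i)%N;
  cv_lam : forall i, (i.+1 < n)%N -> (lam i.+1 <= lam i)%N;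
  cv_sigma : forall i, (i < m)%N ->
    if nth true sigma i then (lam i.+1 <= mu i)%N else (mu i <= lam i.+1)%N;
  cv_neq0 : exists x, f x != 0;
  cv_act : forall Phi, is_branching_rep Phi -> forall l, TL l -> Phi l f = TLweight w l *: f }.

Lemma sorted_fn_tuple k (a : nat -> nat) : (forall i, (i.+1 < k)%N -> (a i.+1 <= a i)%N) ->
  sorted geq (fn_tuple k a).
Proof.
move=> ha; apply/(sortedP 0%N) => i; rewrite size_tuple => ik.
by rewrite /= !nth_fn_tuple ik (ltnW ik) ha.
Qed.

Lemma cv_LambdaB sigma mu lam w f : canonical_vector sigma mu lam w f ->
  LambdaB C (n := n) (fn_tuple m mu) (fn_tuple n lam).
Proof.
move=> [W sm sl _ [x fx] _]; split; try exact: sorted_fn_tuple.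
by exists f => //; apply: contraNnot fx => ->.
Qed.

Lemma cv_Bsigma sigma mu lam w f : canonical_vector sigma mu lam w f -> Bsigma sigma f.
Proof.
move=> cf; exists [:: (fn_tuple m mu, fn_tuple n lam)], (fun=> f); split => //=; last first.
  by rewrite big_seq1.
move=> i; rewrite inE => /eqP ->; split; last exact: (cv_W cf).
split; first exact: cv_LambdaB cf.
by move=> k km /=; rewrite !nth_fn_tuple km ltnS km; apply: (cv_sigma cf).
Qed.

(** The product is not zero as the coordinate ring is a domain, and its weight is the
    sum since both factors lie in the same B_sigma. *)
Lemma canonical_vectorM sigma mu lam w f mu' lam' w' f' :
  canonical_vector sigma mu lam w f -> canonical_vector sigma mu' lam' w' f' ->
  canonical_vector sigma (fun i => mu i + mu' i)%N (fun i => lam i + lam' i)%N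
    (fun i => w i + w' i) (f * f').
Proof.
move=> cf cf'; split.
- apply: WspaceM (cv_W cf) (cv_W cf') _ _ => i; rewrite !nth_fn_tuple; by case: ifP.
- by move=> i im; have := cv_mu cf im; have := cv_mu cf' im; lia.
- by move=> i im; have := cv_lam cf im; have := cv_lam cf' im; lia.
- by move=> i im; have := cv_sigma cf im; have := cv_sigma cf' im; case: ifP => _; lia.
- have [[rf _] _] := cv_W cf; have [[rf' _] _] := cv_W cf'.
  have [x fx] := regular_domain rf rf' (cv_neq0 cf) (cv_neq0 cf'); by exists x.
move=> Phi PhiP l hl; have [_ _ PhiM] := brep_aut PhiP sigma l.
rewrite PhiM ?(cv_act cf PhiP hl) ?(cv_act cf' PhiP hl); [|exact: cv_Bsigma cf|exact: cv_Bsigma cf'].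
have -> : TLweight (fun i => w i + w' i) l = TLweight w l * TLweight w' l; last first.
  apply/funext => x; rewrite -[LHS]/((TLweight w l * f x) * (TLweight w' l * f' x)).
  by rewrite -[RHS]/((_ * _) * (f x * f' x)); ring.
rewrite -big_split; apply: eq_bigr => i _; rewrite expfzDr //.
have l01 : l i 0 1 = 0 by have /is_diag_mxP -> := hl i.
have := sl2P (l i); rewrite det_mx2 l01.
by rewrite mul0r subr0; apply: contra_eq_neq => ->; rewrite mul0r eq_sym oner_neq0.
Qed.

Lemma canonical_vector1 sigma :
  canonical_vector sigma (fun=> 0%N) (fun=> 0%N) (fun=> 0) 1.
Proof.
split => //; last first.
- move=> Phi PhiP l hl; have [_ -> _] := brep_aut PhiP sigma l.
  by rewrite /TLweight big1 ?scale1r.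
- by exists 1%g; rewrite -[X in X != 0]/(1 : C) oner_neq0.
- by move=> i im; case: ifP.
split; first split.
- by have [Kc _ _] := regular_algebra C n; apply: Kc.
- by [].
move=> t g s ht hs hs'; rewrite !tchar_fn_tuple // !big1 ?mul1r // => i _; exact: expr0.
Qed.

Lemma canonical_vectorX sigma mu lam w f k : canonical_vector sigma mu lam w f ->
  canonical_vector sigma (fun i => k * mu i)%N (fun i => k * lam i)%N
    (fun i => k%:Z * w i) (f ^+ k).
Proof.
move=> cf; elim: k => [|k IH].
  have := canonical_vector1 sigma; rewrite expr0.
  by under [X in _ -> canonical_vector _ _ _ X _]eq_fun do rewrite mul0r.
have := canonical_vectorM cf IH; rewrite -exprS.
by under [X in _ -> canonical_vector _ _ _ X _]eq_fun do rewrite intS mulrDl mul1r.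
Qed.

End CanonicalVectors.

(** * The action of L on the generating minors *)

Section GeneratorVectors.
Variables (C : numFieldType) (m : nat).
Local Notation n := m.+1.
Local Notation fn := (Sp C n -> C^o).
Implicit Types (sigma : order_type n) (f : fn).

Lemma minor_diag j d T (g t : Sp C n) : is_diag_mx t ->
  minor j d T (g * t)%g =
  minor j d T g * \prod_(c < j + d) t (ix m (minor_col j T c)) (ix m (minor_col j T c)).
Proof.
move=> /is_diag_mxP td.
pose D : 'rV[C]_(j + d) := \row_c t (ix m (minor_col j T c)) (ix m (minor_col j T c)).
have -> : minor j d T (g * t)%g = \det (minor_mx j d T g *m diag_mx D).
  congr (\det _); apply/matrixP => r c; rewrite mul_mx_diag !mxE.
  rewrite (bigD1 (ix m (minor_col j T c))) //= big1 ?addr0 // => l lc.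
  by rewrite td ?mulr0.
by rewrite det_mulmx det_diag; congr (_ * _); apply: eq_bigr => c _; rewrite mxE.
Qed.

Lemma sl2_emb_diag (h : SL2 C) (i j : 'I_(n + n)) : is_diag_mx h ->
  sl2_emb n h i j =
  (i == j)%:R * (if i == m :> nat then h 0 0 else if i == n :> nat then h 1 1 else 1).
Proof.
move=> /is_diag_mxP hd; rewrite /= /sl2_emb_mx mxE mxE.
have -> : (last2_mx C n *m (sl2_mx h - 1%:M) *m (last2_mx C n)^T) i j =
   (i == m :> nat)%:R * (h 0 0 - 1) * (j == m :> nat)%:R
   + (i == n :> nat)%:R * (h 1 1 - 1) * (j == n :> nat)%:R.
  rewrite !(mxE, big_ord_recl, big_ord0) /= !addn0 !addn1.
  have l1 : lift 0 0 = 1 :> 'I_2 by apply/val_inj.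
  by rewrite !l1 !(hd 0 1) // !(hd 1 0) //=; ring.
have [->|ij] := eqVneq i j.
  case: eqVneq => [->|_]; first by rewrite (_ : (m == n) = false) /=; [ring|lia].
  by case: eqVneq => _ /=; ring.
have {}ij : (i != j :> nat) by [].
rewrite !mul0r add0r; case: eqVneq => [im|_]; case: eqVneq => [jm|_] /=;
  case: eqVneq => [im'|_]; case: eqVneq => [jm'|_] /=; try ring.
all: by exfalso; lia.
Qed.

Lemma upper_fn_tuple (mu lam : nat -> nat) i : (i <= m)%N ->
  upper (fn_tuple m mu) (fn_tuple n lam) i =
  if i is j.+1 then minn (mu j) (lam j.+1) else lam 0%N.
Proof.
by case: i => [|i] im; rewrite /upper !nth_fn_tuple // im ltnS im.
Qed.

Lemma lower_fn_tuple (mu lam : nat -> nat) i : (i <= m)%N ->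
  lower (fn_tuple m mu) (fn_tuple n lam) i =
  if (i < m)%N then maxn (mu i) (lam i.+1) else 0%N.
Proof.
by move=> im; rewrite /lower !nth_fn_tuple ltnS; case: ifP.
Qed.

Lemma interlaced_fn_tuple (mu lam : nat -> nat) :
  (forall i, (i < m)%N -> (mu i <= lam i)%N) ->
  (forall i, (i.+1 < m)%N -> (lam i.+2 <= mu i)%N) ->
  (forall i, (i.+1 < n)%N -> (lam i.+1 <= lam i)%N) ->
  (forall i, (i.+1 < m)%N -> (mu i.+1 <= mu i)%N) ->
  interlaced (fn_tuple m mu) (fn_tuple n lam).
Proof.
move=> h1 h2 h3 h4 i im; rewrite upper_fn_tuple // lower_fn_tuple //.
case: ltnP => // im'; case: i im im' => [|i] im im'.
  by have := h1 0%N im'; have := h3 0%N; lia.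
have := h1 i.+1 im'; have := h2 i im'; have := h3 i.+1; have := h4 i im'; lia.
Qed.

(** Here x_i - y_i is 1 for i = j and 0 otherwise, so an element of L acts through
    its j-th component, by right translation; the column n (e = 0) or -n (e = 1)
    determines the sign of the weight. *)
Lemma cv_minor1 sigma j e : (j <= m)%N -> (e <= 1)%N ->
  canonical_vector sigma (ones j) (ones j.+1)
    (fun i => (i == j)%:R * (-1) ^+ e) (minor j 1 (m + e) : fn).
Proof.
move=> jm e1; have W := @Wspace_minor C m j 1 (m + e) jm.
rewrite addn1 in W; have {}W := W _ _ _; rewrite -addnA addn1 in W.
have {W}W : Wspace C (n := n) (fn_tuple m (ones j)) (fn_tuple n (ones j.+1)) (minor j 1 (m + e)).
  by apply: W; rewrite ?leq_addr //; lia.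
have nz : exists x : Sp C n, minor j 1 (m + e) x != 0.
  have [g gw] := witness_exists C m; exists g.
  have [n0 n1] := minor1_witness gw jm.
  by case: e e1 {W} => [|[|]] // _; rewrite ?addn0 ?addn1.
have sl (k i : nat) : (ones k i.+1 <= ones k i)%N by rewrite /ones; lia.
have LB : LambdaB C (n := n) (fn_tuple m (ones j)) (fn_tuple n (ones j.+1)).
  split; try by apply: sorted_fn_tuple => i _; apply: sl.
  by exists (minor j 1 (m + e)) => //; have [x fx] := nz; apply: contraNnot fx => ->.
split => // [i im|Phi PhiP l hl].
  by rewrite /ones; case: ifP => _; lia.
have il : interlaced (fn_tuple m (ones j)) (fn_tuple n (ones j.+1)).
  by apply: interlaced_fn_tuple => i _; rewrite /ones; lia.
rewrite (Phi_eq (l' := [ffun=> l (inord j)]) PhiP LB W) => [|i]; last first.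
  have [ij|ij] := eqVneq (i : nat) j; [right|left].
    by rewrite ffunE; congr (l _); apply/val_inj; rewrite /= inordK.
  have im : (i <= m)%N by rewrite -ltnS.
  rewrite Adim_interlaced // upper_fn_tuple // lower_fn_tuple // /ones.
  by case: (nat_of_ord i) ij im => [|k] ij im; case: ifP => ?; lia.
rewrite (brep_diag PhiP _ (Wspace_branching W)); apply/funext => g.
have dl := hl (inord j); set h := l (inord j) in dl *.
rewrite minor_diag; last first.
  by apply/is_diag_mxP => a b ab; rewrite sl2_emb_diag // -val_eqE (negPf ab) mul0r.
rewrite -[RHS]/(_ * minor j 1 (m + e) g) mulrC; congr (_ * _).
rewrite big_split_ord /= [X in X * _]big1 => [|c _]; last first.
  rewrite sl2_emb_diag // eqxx /minor_col /= ltn_ord ixK; last by have := ltn_ord c; lia.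
  by rewrite !ifN ?mulr1 //; have := ltn_ord c; lia.
rewrite big_ord_recl big_ord0 !mul1r mulr1 sl2_emb_diag // eqxx mul1r.
rewrite /minor_col /= !addn0 ltnn subnn addn0 ixK; last lia.
rewrite /TLweight (bigD1 (inord j)) //= inordK // eqxx mul1r -/h.
rewrite big1 => [|i ij]; last first.
  rewrite (_ : (i == j :> nat) = false) ?mul0r ?expr0z //.
  by apply: contraNF ij => /eqP ij; apply/eqP/val_inj; rewrite /= inordK.
rewrite mulr1; case: e e1 {W nz} => [|[|]] // _.
  by rewrite addn0 eqxx expr0 expr1z.
rewrite addn1 (_ : (n == m) = false) ?eqxx ?expr1; last lia.
have := sl2P h; rewrite det_mx2; have h01 : h 0 1 = 0 by have /is_diag_mxP -> := dl.
rewrite h01 mul0r subr0 => h1; have h0 : h 0 0 != 0.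
  by apply: contra_eq_neq h1 => ->; rewrite mul0r eq_sym oner_neq0.
by rewrite -invr_expz expr1z; apply: (mulfI h0); rewrite h1 mulfV.
Qed.

(** All the x_i - y_i vanish, so L acts trivially. *)
Lemma cv_trivial sigma mu lam f :
  Wspace C (n := n) (fn_tuple m mu) (fn_tuple n lam) f -> (exists x, f x != 0) ->
  (forall i, (i.+1 < m)%N -> (mu i.+1 <= mu i)%N) ->
  (forall i, (i.+1 < n)%N -> (lam i.+1 <= lam i)%N) ->
  (forall i, (i < m)%N ->
    if nth true sigma i then (lam i.+1 <= mu i)%N else (mu i <= lam i.+1)%N) ->
  interlaced (fn_tuple m mu) (fn_tuple n lam) ->
  (forall i, (i <= m)%N -> (upper (fn_tuple m mu) (fn_tuple n lam) i <=
     lower (fn_tuple m mu) (fn_tuple n lam) i)%N) ->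
  canonical_vector sigma mu lam (fun=> 0) f.
Proof.
move=> W nz sm sl os il ul; split => // Phi PhiP l hl.
have LB : LambdaB C (n := n) (fn_tuple m mu) (fn_tuple n lam).
  split; try exact: sorted_fn_tuple.
  by exists f => //; have [x fx] := nz; apply: contraNnot fx => ->.
rewrite /TLweight big1 ?scale1r => [|i _]; last by rewrite expr0z.
rewrite (Phi_eq (l' := 1%g) PhiP LB W) => [|i]; last first.
  left; have im : (i <= m)%N by rewrite -ltnS.
  by rewrite Adim_interlaced //; have := ul i im; lia.
by rewrite (rep_one (brep_rep PhiP)) //; apply: Wspace_branching W.
Qed.

(** The two minors of degrees (omega_(j+1), omega_(j+1)) and (omega_j, omega_(j+2))
    give the same sorted sequence; the order type tells which one is in B_sigma. *)
Lemma cv_minor_even sigma j : (j < m)%N -> exists f : fn,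
  canonical_vector sigma (ones (j + nth true sigma j)) (ones (j.+2 - nth true sigma j))
    (fun=> 0) f.
Proof.
move=> jm; case E: (nth true sigma j); rewrite /= ?addn0 ?addn1 ?subn0 ?subn1 /=.
  exists (minor j.+1 0 m); apply: cv_trivial; first (by
    have := @Wspace_minor C m j.+1 0 m; rewrite addn0; apply; lia);
  first by exists 1%g; rewrite minor0_one ?oner_neq0.
  all: try by move=> i _; rewrite /ones; lia.
  - move=> i im; rewrite /ones; have [->|] := eqVneq i j; first by rewrite E; lia.
    by case: ifP => _; lia.
  - by apply: interlaced_fn_tuple => i _; rewrite /ones; lia.
  - move=> i im; rewrite upper_fn_tuple // lower_fn_tuple // /ones.
    by case: i im => [|i] im; case: ifP => ?; lia.
exists (minor j 2 m); apply: cv_trivial; first (by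
  have := @Wspace_minor C m j 2 m; rewrite addn2; apply; lia);
first by have [g gw] := witness_exists C m; exists g; apply: minor2_witness.
all: try by move=> i _; rewrite /ones; lia.
- move=> i im; rewrite /ones; have [->|] := eqVneq i j; first by rewrite E; lia.
  by case: ifP => _; lia.
- by apply: interlaced_fn_tuple => i _; rewrite /ones; lia.
- move=> i im; rewrite upper_fn_tuple // lower_fn_tuple // /ones.
  by case: i im => [|i] im; case: ifP => ?; lia.
Qed.

End GeneratorVectors.

(** * Monomials in the minors *)

Section Monomials.
Variables (C : numFieldType) (m : nat).
Local Notation n := m.+1.
Local Notation fn := (Sp C n -> C^o).
Implicit Types (sigma : order_type n) (f : fn).

Section Tower.
Variables (sigma : order_type n) (X Y gam : nat -> nat).
Hypotheses (X0 : forall i, (m < i)%N -> X i = 0%N) (Y0 : forall i, (m <= i)%N -> Y i = 0%N).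
Hypotheses (YX : forall i, (Y i <= gam i <= X i)%N) (XY : forall i, (X i.+1 <= Y i)%N).

(** The degree of the product over j >= k of
      a_j ^ (gam_j - Y_j) * b_j ^ (X_j - gam_j) * c_j ^ (Y_j - X_(j+1)),
    where a_j, b_j are the two minors of [cv_minor1] and c_j is the one of
    [cv_minor_even]. For k = 0, the sequences interlace as prescribed by sigma: one
    of mu_i, lam_(i+1) is Y_i and the other one X_(i+1). *)
Definition tower_mu (k i : nat) : nat :=
  (X (maxn i.+1 k) + (k <= i) * nth true sigma i * (Y i - X i.+1))%N.

Definition tower_lam (k i : nat) : nat :=
  (X (maxn i k) + (k < i) * ~~ nth true sigma i.-1 * (Y i.-1 - X i))%N.

Definition tower_weight (k i : nat) : int :=
  if (k <= i)%N then 2 * (gam i)%:Z - (X i)%:Z - (Y i)%:Z else 0.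

(** Induction on the number of factors, from the last one down. *)
Lemma cv_tower k : (k <= n)%N ->
  exists f : fn, canonical_vector sigma (tower_mu (n - k)) (tower_lam (n - k))
    (tower_weight (n - k)) f.
Proof.
elim: k => [|k IH] kn.
  exists 1; have := canonical_vector1 C sigma.
  have -> : tower_mu (n - 0) = fun=> 0%N.
    apply/funext => i; rewrite /tower_mu subn0 X0 ?leq_maxr //.
    by case: leqP => //= ni; rewrite Y0 ?muln0 //; lia.
  have -> : tower_lam (n - 0) = fun=> 0%N.
    apply/funext => i; rewrite /tower_lam subn0 X0 ?leq_maxr //.
    by case: ltnP => //= ni; rewrite Y0 ?muln0 //; lia.
  have -> // : tower_weight (n - 0) = fun=> 0.
  apply/funext => i; rewrite /tower_weight subn0; case: leqP => // ni.
  by have := YX i; rewrite X0 // Y0; lia.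
have [f cf] := IH (ltnW kn); set j := (n - k.+1)%N.
have jE : (n - k = j.+1)%N by rewrite /j; lia.
rewrite jE in cf; have jm : (j <= m)%N by rewrite /j; lia.
have ca := canonical_vectorX (gam j - Y j) (cv_minor1 C sigma jm (leq0n 1)).
have cb := canonical_vectorX (X j - gam j) (cv_minor1 C sigma jm (leqnn 1)).
have cab := canonical_vectorM (canonical_vectorM ca cb) cf.
(* For j = m the sequence ends, and there is no third factor. *)
have [g cg] : exists g : fn, canonical_vector sigma
    (fun i => (Y j - X j.+1) * ones (j + nth true sigma j) i)%N
    (fun i => (Y j - X j.+1) * ones (j.+2 - nth true sigma j) i)%N (fun=> 0) g.
  have [jm'|mj] := ltnP j m.
    have [g cg] := cv_minor_even C sigma jm'; exists (g ^+ (Y j - X j.+1)).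
    have := canonical_vectorX (Y j - X j.+1) cg.
    by under [X in canonical_vector _ _ _ X _ -> _]eq_fun do rewrite mulr0.
  exists 1; rewrite Y0 // sub0n.
  exact: canonical_vector1.
have := canonical_vectorM cg cab; set f' := g * _ => cf'; exists f'.
move: cf'; congr (canonical_vector _ _ _ _ _); apply/funext => i.
- have := YX j; have := XY j; rewrite /tower_mu /ones.
  have [ij|[ij| ->]] : (i < j)%N \/ (j < i)%N \/ i = j by lia.
  + have -> : maxn i.+1 j.+1 = j.+1 by lia.
    have -> : maxn i.+1 j = j by lia.
    have -> : (i < j + nth true sigma j)%N by lia.
    have -> : (j < i)%N = false by lia.
    rewrite (_ : (i < j)%N) // (_ : (j <= i)%N = false) ?mul0n ?muln1; lia.
  + have -> : maxn i.+1 j.+1 = i.+1 by lia.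
    have -> : maxn i.+1 j = i.+1 by lia.
    have -> : (i < j + nth true sigma j)%N = false by lia.
    by rewrite (_ : (i < j)%N = false) ?ij ?(ltnW ij) ?muln0 ?add0n //; lia.
  + have -> : maxn j.+1 j.+1 = j.+1 by lia.
    have -> : maxn j.+1 j = j.+1 by lia.
    rewrite ltnn leqnn !muln0 !add0n !mul0n addn0 mul1n addnC mulnC => _ _; congr (_ + _ * _)%N.
    by case: (nth true sigma j) => /=; lia.
- have := YX j; have := XY j; rewrite /tower_lam /ones.
  have [ij|[ij| ->]] : (i < j)%N \/ (j < i)%N \/ i = j by lia.
  + have -> : maxn i j.+1 = j.+1 by lia.
    have -> : maxn i j = j by lia.
    have -> : (i < j.+1)%N by lia.
    have -> : (i < j.+2 - nth true sigma j)%N by case: (nth true sigma j) => /=; lia.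
    have -> : (j.+1 < i)%N = false by lia.
    by rewrite (_ : (j < i)%N = false) ?mul0n ?muln1; lia.
  + have -> : maxn i j.+1 = i by lia.
    have -> : maxn i j = i by lia.
    have -> : (i < j.+1)%N = false by lia.
    rewrite !muln0 !add0n => _ _.
    have [->|ij1] := eqVneq i j.+1.
      rewrite ltnn leqnn /= mul0n mul0n addn0 mul1n addnC mulnC; congr (_ + _ * _)%N.
      by case: (nth true sigma j) => /=; lia.
    have -> : (i < j.+2 - nth true sigma j)%N = false.
      by case: (nth true sigma j) => /=; lia.
    by rewrite muln0 add0n ij (_ : (j.+1 < i)%N) //; lia.
  + have -> : maxn j j.+1 = j.+1 by lia.
    have -> : maxn j j = j by lia.
    have -> : (j < j.+2 - nth true sigma j)%N by case: (nth true sigma j) => /=; lia.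
    by rewrite ltnS leqnn ltnn (ltnNge j.+1) leqnSn /= !mul0n !muln1; lia.
- have := YX j; have := XY j; rewrite /tower_weight expr0 expr1.
  have [ij|ij|->] := ltngtP i j => /=; rewrite ?mulr0n ?mulr1n; try lia.
Qed.

End Tower.

End Monomials.

(** * Weights of the tensor products *)

Section TensorWeights.
Variables (C : numFieldType) (n : nat).
Implicit Types (l : Lgroup C n).

Lemma sl2_diag (h : SL2 C) : is_diag_mx h ->
  [/\ h 0 0 != 0, h 1 1 = (h 0 0)^-1, h 0 1 = 0 & h 1 0 = 0].
Proof.
move=> /is_diag_mxP hd; have h01 := hd 0 1 isT; have h10 := hd 1 0 isT.
have := sl2P h; rewrite det_mx2 h01 mul0r subr0 => h1.
have h0 : h 0 0 != 0 by apply: contra_eq_neq h1 => ->; rewrite mul0r eq_sym oner_neq0.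
by split=> //; apply: (mulfI h0); rewrite h1 mulfV.
Qed.

(** On the monomial e1^(k-c) e2^c, diag (z, 1/z) acts by z^(k - 2c). *)
Lemma Fmx_diag k (h : SL2 C) (r c : 'I_k.+1) : is_diag_mx h ->
  Fmx k h r c = (r == c)%:R * h 0 0 ^ (k%:Z - 2 * c%:Z).
Proof.
move=> /sl2_diag [h0 h1 h01 h10]; rewrite mxE h01 h10 scale0r addr0 add0r.
rewrite -polyC_exp exprZn mul_polyC coefZ coefZ coefXn mulrA [RHS]mulrC -val_eqE /=; congr (_ * _).
have ck : (c <= k)%N by rewrite -ltnS.
rewrite h1 exprVn exprnN exprnP -expfzDr //; congr (_ ^ _); lia.
Qed.

Definition tens_weight (k : 'I_n -> nat) (r : {dffun forall i, 'I_(k i).+1}) l : C :=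
  \prod_(i < n) (l i 0 0) ^ ((k i)%:Z - 2 * (r i)%:Z).

Lemma tensF_act_diag k l (a : tensF C k) r : TL l ->
  tensF_act l a r = tens_weight r l * a r.
Proof.
move=> hl; rewrite ffunE (bigD1 r) //= [X in _ + X]big1 ?addr0 => [|c cr].
  by congr (_ * _); apply: eq_bigr => i _; rewrite Fmx_diag ?eqxx ?mul1r.
have [i ci] : exists i, c i != r i.
  apply/existsP; apply: contraNT cr; rewrite negb_exists => /forallP h.
  by apply/eqP/ffunP => i; have := h i; rewrite negbK => /eqP.
rewrite (bigD1 i) //= Fmx_diag // [r i == _]eq_sym (negPf ci).
by rewrite !mul0r.
Qed.

Fact sl2_two_subproof : \det (\matrix_(i < 2, j < 2)
  ((i == j :> nat)%:R * (if (i == 0 :> nat)%N then 2 else 2^-1)) : 'M[C]_2) == 1.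
Proof. by rewrite det_mx2 !mxE /= !mul1r !mul0r subr0 mulfV // pnatr_eq0. Qed.

(** As 2 is not a root of unity, these elements separate integral weights. *)
Definition TL_two (i : 'I_n) : Lgroup C n :=
  [ffun j => if j == i then MkSL2 sl2_two_subproof else 1%g].

Lemma TL_twoP i : TL (TL_two i).
Proof.
move=> j; rewrite ffunE; case: ifP => _; last exact: scalar_mx_is_diag.
apply/is_diag_mxP => a b ab /=.
by rewrite mxE (_ : (a == b :> nat) = false) ?mul0r //; apply: negPf.
Qed.

Lemma prod_TL_two (w : 'I_n -> int) i : \prod_(j < n) (TL_two i j 0 0) ^ w j = 2 ^ w i.
Proof.
rewrite (bigD1 i) //= big1 ?mulr1 => [|j ji]; rewrite ffunE.
  by rewrite eqxx /= mxE eqxx mul1r.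
by rewrite (negPf ji) /= mxE eqxx exp1rz.
Qed.

Lemma two_exp_inj (a b : int) : (2 : C) ^ a = 2 ^ b -> a = b.
Proof.
have t0 : (2 : C) != 0 by rewrite pnatr_eq0.
move=> ab; apply/subr0_eq; have : (2 : C) ^ (a - b) = 1.
  by rewrite expfzDr // ab -expfzDr // subrr expr0z.
have pow k : (2 : C) ^+ k = 1 -> k = 0%N.
  by rewrite -natrX => /eqP; rewrite pnatr_eq1 => /eqP; case: k => // k; rewrite expnS; lia.
case: (a - b) => k; first by rewrite -exprnP => /pow ->.
by rewrite NegzE -exprnN => /eqP; rewrite invr_eq1 => /eqP/pow.
Qed.

Lemma TL_separates (w w' : 'I_n -> int) :
  (forall l, TL l -> \prod_(i < n) (l i 0 0) ^ w i = \prod_(i < n) (l i 0 0) ^ w' i) ->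
  forall i, w i = w' i.
Proof.
move=> h i; have := h _ (TL_twoP i); rewrite !prod_TL_two.
exact: two_exp_inj.
Qed.

End TensorWeights.

(** * Independence of eigenvectors and of characters *)

Section Eigenvectors.
Variables (C : fieldType) (V : lmodType C) (I : eqType) (T : Type).
Variables (B : set V) (A : T -> V -> V) (c : T -> I -> C).
Hypotheses (B0 : B 0) (BL : forall a u v, B u -> B v -> B (a *: u + v)).
Hypothesis (AL : forall t a u v, B u -> B v -> A t (a *: u + v) = a *: A t u + A t v).

Lemma closed_sum (J : eqType) (s : seq J) (F : J -> V) :
  (forall i, i \in s -> B (F i)) -> B (\sum_(i <- s) F i).
Proof.
elim: s => [|j s IH] BF; first by rewrite big_nil.
rewrite big_cons -[F j]scale1r; apply: BL; first by apply: BF; rewrite mem_head.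
by apply: IH => i si; apply: BF; rewrite inE si orbT.
Qed.

Lemma operator0 t : A t 0 = 0.
Proof.
have := AL t 1 B0 B0; rewrite !scale1r addr0.
by move/(congr1 (fun v => v - A t 0)); rewrite addrK subrr => <-.
Qed.

Lemma operator_sum (J : eqType) t (s : seq J) (F : J -> V) :
  (forall i, i \in s -> B (F i)) -> A t (\sum_(i <- s) F i) = \sum_(i <- s) A t (F i).
Proof.
elim: s => [|j s IH] BF.
  by rewrite !big_nil operator0.
have BF' i : i \in s -> B (F i) by move=> si; apply: BF; rewrite inE si orbT.
rewrite !big_cons -[F j]scale1r AL ?IH ?scale1r //; last exact: closed_sum.
by apply: BF; rewrite mem_head.
Qed.

(** The usual elimination: applying an operator and subtracting the eigenvalue of one
    of the vectors gives a shorter relation. The operators are linear on B only. *)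
Lemma eigen_independent (s : seq I) (F : I -> V) : uniq s ->
  (forall i, i \in s -> B (F i) /\ forall t, A t (F i) = c t i *: F i) ->
  (forall i j, i \in s -> j \in s -> i != j -> exists t, c t i != c t j) ->
  \sum_(i <- s) F i = 0 -> forall i, i \in s -> F i = 0.
Proof.
elim: s F => [|j s IH] F //= /andP[js us] eF sep sF0.
have BF i : i \in j :: s -> B (F i) by move=> /eF [].
have Fs i : i \in s -> F i = 0.
  move=> si; have ij : i != j by apply: contraNneq js => <-.
  have [t tij] : exists t, c t i != c t j by apply: sep; rewrite ?inE ?si ?eqxx ?orbT.
  have eF' k : k \in s -> B ((c t k - c t j) *: F k) /\
      forall t', A t' ((c t k - c t j) *: F k) = c t' k *: ((c t k - c t j) *: F k).
    move=> sk; have [Bk ek] := eF k (mem_behead (s := j :: s) sk).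
    split; first by rewrite -[_ *: _]addr0; apply: BL.
    move=> t'; have := AL t' (c t k - c t j) Bk B0; rewrite addr0 => ->.
    by rewrite operator0 addr0 ek !scalerA mulrC.
  have sep' k l : k \in s -> l \in s -> k != l -> exists t, c t k != c t l.
    by move=> sk sl; apply: sep; rewrite inE ?sk ?sl orbT.
  (* The relation A t - c t j produces, in which F j does not occur. *)
  suff s0 : \sum_(k <- s) (c t k - c t j) *: F k = 0.
    have /eqP := IH _ us eF' sep' s0 i si.
    by rewrite scaler_eq0 subr_eq0 (negPf tij) => /eqP.
  have := operator_sum t BF; rewrite sF0 operator0.
  move=> /esym e1; have e2 : c t j *: \sum_(k <- j :: s) F k = 0 by rewrite sF0 scaler0.
  rewrite big_cons (proj2 (eF j _)) ?mem_head // in e1.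
  rewrite big_cons scalerDr in e2.
  have: c t j *: F j + \sum_(k <- s) A t (F k) - (c t j *: F j + c t j *: \sum_(k <- s) F k) = 0.
    by rewrite e1 e2 subrr.
  rewrite opprD addrACA subrr add0r scaler_sumr -sumrB => e3.
  rewrite -[RHS]e3 [LHS]big_seq [RHS]big_seq; apply: eq_bigr => k sk.
  by rewrite (proj2 (eF k _)) ?inE ?sk ?orbT // scalerBl.
move=> i; rewrite inE => /predU1P[->|/Fs //].
move: sF0; rewrite big_cons big_seq big1 ?addr0 // => k; exact: Fs.
Qed.

End Eigenvectors.

(** Dedekind's independence of characters: on the functions supported on D, the
    characters are eigenvectors of the translations. *)
Lemma characters_independent (C : fieldType) (G : Type) (e : G) (op : G -> G -> G) (D : set G) (I : eqType)
    (chi : I -> G -> C) (s : seq I) (d : I -> C) :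
  D e -> (forall x y, D x -> D y -> D (op x y)) ->
  (forall i, chi i e = 1) ->
  (forall i x y, D x -> D y -> chi i (op x y) = chi i x * chi i y) ->
  uniq s ->
  (forall i j, i \in s -> j \in s -> i != j -> exists2 x, D x & chi i x != chi j x) ->
  (forall x, D x -> \sum_(i <- s) chi i x * d i = 0) -> forall i, i \in s -> d i = 0.
Proof.
move=> De DM chie chiM us sep s0.
pose F i : G -> C^o := fun x => if `[< D x >] then chi i x * d i else 0.
pose A (x : {x | D x}) (v : G -> C^o) : G -> C^o :=
  fun y => if `[< D y >] then v (op (sval x) y) else 0.
have H i : i \in s -> F i = 0.
  apply: (@eigen_independent _ _ _ _ setT A (fun x i => chi i (sval x))) => //.
  - move=> t a u v _ _; apply/funext => y; rewrite -[RHS]/(a * A t u y + A t v y) /A.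
    by case: asboolP => // _; rewrite mulr0 addr0.
  - move=> j sj; split=> // t; apply/funext => y; rewrite -[RHS]/(_ * F j y) /A /F.
    case: asboolP => [Dy|]; last by rewrite mulr0.
    case: asboolP => [_|[]]; last by apply: DM => //; case: t.
    by rewrite chiM ?mulrA //; case: t.
  - move=> j k sj sk jk; have [x Dx xjk] := sep j k sj sk jk.
    by exists (exist _ x Dx).
  - apply/funext => x; rewrite -[RHS]/(0 : C).
    have -> : (\sum_(j <- s) F j) x = \sum_(j <- s) F j x.
      by elim: (s) => [|k r IH]; rewrite ?big_nil // !big_cons -IH.
    rewrite /F; case: asboolP => Dx; first exact: s0.
    by rewrite big1.
move=> i si; have /(congr1 (fun f => f e)) := H i si.
by rewrite /F asboolT // chie mul1r.
Qed.

(** * The weights of a multiplicity space and the branching rule *)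

Section MultiplicitySpaces.
Variables (C : numFieldType) (m : nat).
Local Notation n := m.+1.
Local Notation fn := (Sp C n -> C^o).
Implicit Types (sigma : order_type n) (mu : m.-tuple nat) (lam gam : n.-tuple nat) (f : fn).
Implicit Types (Phi : Lgroup C n -> fn -> fn).

Section WeightBasis.
Variables (Phi : Lgroup C n -> fn -> fn) (mu : m.-tuple nat) (lam : n.-tuple nat).
Hypotheses (PhiP : is_branching_rep Phi) (ml : LambdaB C (n := n) mu lam).
Local Notation k := (Adim (n := n) mu lam).
Local Notation D := {dffun forall i, 'I_(k i).+1}.

(** The images of the pure tensors of monomials. Their weights are pairwise distinct,
    so a weight vector is a multiple of one of them. *)
Lemma weight_basis : exists e : D -> fn,
  [/\ forall r, Wspace C (n := n) mu lam (e r) /\ e r <> 0,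
      forall r l, TL l -> Phi l (e r) = tens_weight r l *: e r,
      forall f, Wspace C (n := n) mu lam f -> exists a : D -> C, f = \sum_r a r *: e r
    & forall f (w : 'I_n -> int), Wspace C (n := n) mu lam f -> f <> 0 ->
        (forall l, TL l -> Phi l f = (\prod_(i < n) (l i 0 0) ^ w i) *: f) ->
        exists r : D, (forall i, w i = (k i)%:Z - 2 * (r i)%:Z) /\ exists c : C, f = c *: e r].
Proof.
have [theta [th_lin th_inj th_range th_act]] := brep_iso PhiP ml.
have th0 : theta 0 = 0.
  have := th_lin 1 0 0; rewrite !scale1r addr0.
  by move/(congr1 (fun v => v - theta 0)); rewrite addrK subrr => <-.
have thZ c a : theta (c *: a) = c *: theta a by have := th_lin c a 0; rewrite !addr0 th0 addr0.
have thD a b : theta (a + b) = theta a + theta b.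
  by have := th_lin 1 a b; rewrite !scale1r.
pose dl (r : D) : tensF C k := [ffun s => (s == r)%:R].
have dl_sum (a : tensF C k) : a = \sum_r a r *: dl r.
  apply/ffunP => s; rewrite sum_ffunE (bigD1 s) //= big1 => [|r rs].
    by rewrite !ffunE eqxx addr0 -[RHS]/(a s * 1) mulr1.
  by rewrite !ffunE eq_sym (negPf rs) -[LHS]/(a r * 0) mulr0.
have th_sum (a : tensF C k) : theta a = \sum_r a r *: theta (dl r).
  by rewrite {1}(dl_sum a) (big_morph theta thD th0); apply: eq_bigr => r _; rewrite thZ.
have Wth a : Wspace C (n := n) mu lam (theta a) by rewrite -th_range; exists a.
exists (fun r => theta (dl r)); split.
- move=> r; split=> // /(congr1 (fun f => f)); rewrite -th0 => /th_inj/ffunP/(_ r).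
  by rewrite !ffunE eqxx => /eqP; rewrite oner_eq0.
- move=> r l hl; rewrite th_act -thZ; congr theta; apply/ffunP => s.
  rewrite tensF_act_diag // !ffunE; case: eqP => [->//|_].
  by rewrite mulr0 -[RHS]/(_ * 0) mulr0.
- by move=> f; rewrite -th_range => -[a _ <-]; exists a; exact: th_sum.
move=> f w; rewrite -th_range => -[a _ <-] a0 aw.
have wt r l : TL l -> tens_weight r l * a r = (\prod_(i < n) (l i 0 0) ^ w i) * a r.
  move=> hl; rewrite -tensF_act_diag //; have := aw l hl.
  by rewrite th_act -thZ => /th_inj ->; rewrite ffunE.
have wr r : a r != 0 -> forall i, w i = (k i)%:Z - 2 * (r i)%:Z.
  by move=> ar; apply: TL_separates => l hl; apply/esym/(mulIf ar)/wt.
have [r ar] : exists r, a r != 0.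
  apply/existsP; apply: contra_notT a0; rewrite negb_exists => /forallP a0.
  rewrite -th0; congr theta; apply/ffunP => r; rewrite ffunE.
  by have := a0 r; rewrite negbK => /eqP.
exists r; split; [exact: wr | exists (a r)].
rewrite th_sum (bigD1 r) //= big1 ?addr0 // => s sr.
have [->|/wr ws] := eqVneq (a s) 0; first by rewrite scale0r.
case/eqP: sr; apply/ffunP => i; apply/val_inj => /=.
by have := ws i; rewrite (wr r ar) => /addrI/oppr_inj/(@mulfI int 2 isT)[->].
Qed.

End WeightBasis.

Lemma order_type_exists mu lam : exists sigma : order_type n, has_order_type sigma mu lam.
Proof.
exists (mktuple (fun i : 'I_m => nth 0%N lam i.+1 <= nth 0%N mu i)%N) => i im.
rewrite (_ : nth true _ i = (nth 0%N lam i.+1 <= nth 0%N mu i)%N).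
  by case: leqP => // /ltnW.
by rewrite (_ : i = Ordinal im) // -tnth_nth; exact: tnth_mktuple.
Qed.

Lemma order_type_upper sigma mu lam i : has_order_type sigma mu lam -> (i < m)%N ->
  if nth true sigma i
  then upper mu lam i.+1 = nth 0%N lam i.+1 /\ lower mu lam i = nth 0%N mu i
  else upper mu lam i.+1 = nth 0%N mu i /\ lower mu lam i = nth 0%N lam i.+1.
Proof.
move=> os im; have := os i im; rewrite /upper /lower /=; case: (nth true sigma i) => h; split; lia.
Qed.

Lemma upper_over mu lam i : (m < i)%N -> upper mu lam i = 0%N.
Proof. by case: i => // i mi; rewrite /upper [nth _ lam _]nth_default ?minn0 // size_tuple. Qed.

Lemma lower_over mu lam i : (m <= i)%N -> lower mu lam i = 0%N.
Proof. by move=> mi; rewrite /lower !nth_default // size_tuple. Qed.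

Lemma upper_lower mu lam i : (upper mu lam i.+1 <= lower mu lam i)%N.
Proof. rewrite /upper /lower; lia. Qed.

Lemma Wspace_Bsigma sigma mu lam f : LambdaB C (n := n) mu lam ->
  has_order_type sigma mu lam -> Wspace C (n := n) mu lam f -> Bsigma sigma f.
Proof.
move=> ml os Wf; exists [:: (mu, lam)], (fun=> f); split => //=; last by rewrite big_seq1.
by move=> i; rewrite inE => /eqP ->.
Qed.

Lemma tuple_ext k (s t : k.-tuple nat) : (forall i, (i < k)%N -> nth 0%N s i = nth 0%N t i) -> s = t.
Proof.
move=> st; apply/val_inj/(@eq_from_nth _ 0%N); rewrite ?size_tuple // => i; exact: st.
Qed.

(** The branching rule, from the existence of Phi: multiplying by a large power h of
    minors separates the entries of the degree without changing the order type, and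
    the weight of a product of extremal vectors is bounded by the gaps of its degree. *)
Lemma LambdaB_interlaced Phi mu lam : is_branching_rep Phi ->
  LambdaB C (n := n) mu lam -> interlaced mu lam.
Proof.
move=> PhiP ml; have [sigma os] := order_type_exists mu lam.
have [e [eW eT _ _]] := weight_basis PhiP ml.
pose r0 : {dffun forall i, 'I_(Adim (n := n) mu lam i).+1} := [ffun i => ord0].
set f := e r0; have [Wf f0] := eW r0.
pose N := (\sum_(i < n) lower mu lam i)%N.
have lN i : (lower mu lam i <= N)%N.
  have [im|mi] := ltnP i n; last by rewrite lower_over //; lia.
  by rewrite /N (bigD1 (Ordinal im)) //= leq_addr.
(* The sorted sequence of the degree of h, the product of the a_j ^ N. *)
pose X i := (N * (n - i))%N; pose Y i := (N * (m - i))%N.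
have XY i : X i.+1 = Y i by [].
have YX i : (i <= m)%N -> X i = (N + Y i)%N by move=> im; rewrite /X /Y subSn // mulnS.
have [h ch] : exists h : fn, canonical_vector sigma (tower_mu sigma X Y 0)
    (tower_lam sigma X Y 0) (tower_weight X Y X 0) h.
  have := @cv_tower C m sigma X Y X _ _ _ _ n (leqnn n); rewrite subnn; apply.
  - by move=> i mi; rewrite /X (_ : n - i = 0)%N ?muln0 //; lia.
  - by move=> i mi; rewrite /Y (_ : m - i = 0)%N ?muln0 //; lia.
  - by move=> i; rewrite leqnn andbT /X /Y leq_mul2l; apply/orP; right; lia.
  - by move=> i.
have muE i : tower_mu sigma X Y 0 i = Y i by rewrite /tower_mu maxn0 XY subnn muln0 addn0.
have lamE i : tower_lam sigma X Y 0 i = X i.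
  by rewrite /tower_lam maxn0; case: i => [|i]; rewrite ?XY ?subnn ?muln0 ?addn0.
set mu' := fn_tuple m (fun i => nth 0%N mu i + Y i)%N.
set lam' := fn_tuple n (fun i => nth 0%N lam i + X i)%N.
have mu'E i : (i < m)%N -> nth 0%N mu' i = (nth 0%N mu i + Y i)%N.
  by move=> im; rewrite nth_fn_tuple im.
have lam'E i : (i <= m)%N -> nth 0%N lam' i = (nth 0%N lam i + X i)%N.
  by move=> im; rewrite nth_fn_tuple ltnS im.
have Wfh : Wspace C (n := n) mu' lam' (f * h).
  apply: WspaceM Wf (cv_W ch) _ _ => i; rewrite !nth_fn_tuple ?muE ?lamE;
    by case: ltnP => // ?; rewrite nth_default // size_tuple.
have fh0 : f * h <> 0.
  have [[rf _] _] := Wf; have [[rh _] _] := cv_W ch.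
  have [|x fhx] := regular_domain rf rh _ (cv_neq0 ch).
    apply/not_existsP => fx; apply: f0; apply/funext => x.
    by have /negP := fx x; rewrite negbK => /eqP.
  by move/(congr1 (fun g : fn => g x)) => /eqP; apply/negP.
have [sm sl _] := ml.
have snth (s : seq nat) i : sorted geq s -> (nth 0%N s i.+1 <= nth 0%N s i)%N.
  move=> ss; have [si|si] := ltnP i.+1 (size s); last by rewrite nth_default.
  by have /(sortedP 0%N) := ss; apply.
have LB : LambdaB C (n := n) mu' lam'.
  split; last by exists (f * h).
  - apply/(sortedP 0%N) => i; rewrite size_tuple /= => im.
    rewrite !mu'E ?(ltnW im) //; apply: leq_add; first exact: snth.
    by rewrite /Y leq_mul2l; apply/orP; right; lia.
  - apply/(sortedP 0%N) => i; rewrite size_tuple /= => im.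
    rewrite !lam'E //; last lia; apply: leq_add; first exact: snth.
    by rewrite /X leq_mul2l; apply/orP; right; lia.
have os' : has_order_type sigma mu' lam'.
  move=> i im; rewrite mu'E // lam'E //; have := os i im.
  by rewrite XY !leq_add2r.
have upE i : (i <= m)%N -> upper mu' lam' i = (upper mu lam i + X i)%N.
  case: i => [|i] im; first by rewrite /upper lam'E.
  by rewrite /upper mu'E // lam'E // XY addn_minl.
have loE i : (i <= m)%N -> lower mu' lam' i = (lower mu lam i + Y i)%N.
  have [im|mi] := ltnP i m => im'; first by rewrite /lower mu'E // lam'E // XY addn_maxl.
  by rewrite !lower_over // /Y (_ : m - i = 0)%N ?muln0 //; lia.
have il' : interlaced mu' lam'.
  by move=> i im; rewrite upE // loE // YX //; have := lN i; lia.
(* The weights of f and of h add up, as both are in B_sigma. *)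
have fhw l : TL l -> Phi l (f * h) =
    (\prod_(i < n) (l i 0 0) ^ ((Adim (n := n) mu lam i)%:Z + N%:Z)) *: (f * h).
  move=> hl; have [_ _ PhiM] := brep_aut PhiP sigma l.
  rewrite PhiM; [|exact: Wspace_Bsigma Wf|exact: cv_Bsigma ch].
  rewrite eT // (cv_act ch) //.
  apply/funext => x; rewrite -[LHS]/((_ * f x) * (_ * h x)) -[RHS]/(_ * (f x * h x)).
  rewrite mulrACA; congr (_ * _); rewrite -big_split; apply: eq_bigr => i _ /=.
  have im : (i <= m)%N by rewrite -ltnS.
  have [l0 _ _ _] := sl2_diag (hl i); rewrite -expfzDr //; congr (_ ^ _).
  by rewrite ffunE /tower_weight /= (YX _ im); lia.
(* The weight of f h is one of the weights of its multiplicity space, so it is at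
   most the gap of the degree. *)
have [e' [_ _ _ uniq']] := weight_basis PhiP LB.
have [r [wr _]] := uniq' _ _ Wfh fh0 fhw.
move=> i im; have := wr (Ordinal (im : (i < n)%N)).
have := Adim_interlaced (Ordinal (im : (i < n)%N)) il'.
by rewrite /= upE // loE // YX //; have := lN i; lia.
Qed.

End MultiplicitySpaces.

(** * The decomposition of a multiplicity space *)

Section Patterns.
Variables (C : numFieldType) (m : nat).
Local Notation n := m.+1.
Local Notation fn := (Sp C n -> C^o).
Implicit Types (mu : m.-tuple nat) (lam gam : n.-tuple nat) (f : fn).
Implicit Types (Phi : Lgroup C n -> fn -> fn).

Lemma nth_rcons0 (s : seq nat) i : nth 0%N (rcons s 0%N) i = nth 0%N s i.
Proof.
rewrite nth_rcons; have [//|si] := ltnP i (size s).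
by rewrite nth_default //; case: eqP.
Qed.

(** The inequalities of mu < gam and gam < lam^+ that involve gam_i. *)
Lemma betweenP mu lam gam : between (n := n) mu lam gam <->
  forall i, (i <= m)%N -> (lower mu lam i <= nth 0%N gam i <= upper mu lam i)%N.
Proof.
rewrite /between /=; split=> [[sg mg gl] i im|b].
  have := gl i; rewrite !nth_rcons0 size_tuple ltnS => /(_ im) gi.
  have lo : (nth 0%N mu i <= nth 0%N gam i)%N.
    have [im'|mi] := ltnP i m; last by rewrite nth_default // size_tuple.
    by have := mg i; rewrite size_tuple => /(_ im'); lia.
  have up : (nth 0%N gam i <= upper mu lam i)%N.
    case: i im gi {lo} => [|i] im gi; first by rewrite /upper; lia.
    by have := mg i; rewrite size_tuple => /(_ im); rewrite /upper; lia.
  by rewrite up /lower; lia.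
split.
- apply/(sortedP 0%N) => i; rewrite size_tuple /= => im.
  have := b i; have := b i.+1; have := upper_lower mu lam i; lia.
- move=> i; rewrite size_tuple => im.
  by have := b i; have := b i.+1; rewrite /lower /upper; lia.
- move=> i; rewrite size_tuple ltnS !nth_rcons0 => im.
  have := b i im; rewrite /lower /upper.
  by case: i im => [|i] im; lia.
Qed.

Lemma Wspace_lin mu lam (c : C) f g : Wspace C (n := n) mu lam f ->
  Wspace C (n := n) mu lam g -> Wspace C (n := n) mu lam (c *: f + g).
Proof.
move=> [[rf fi] fw] [[rg gi] gw]; split; first split.
- have [Kc KD KM] := regular_algebra C n.
  by apply: KD => //; apply: KM.
- move=> v x u hv hu hs; rewrite -[LHS]/(c * f _ + g _) fi // gi //.
- move=> t x s ht hs hs'; rewrite -[LHS]/(c * f _ + g _) fw // gw //.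
  by rewrite -[(c *: f + g) x]/(c * f x + g x); ring.
Qed.

Lemma branching_lin (c : C) f g : branching_algebra C n f ->
  branching_algebra C n g -> branching_algebra C n (c *: f + g).
Proof.
move=> [rf fi] [rg gi]; split.
- have [Kc KD KM] := regular_algebra C n.
  by apply: KD => //; apply: KM.
- by move=> v x u hv hu hs; rewrite -[LHS]/(c * f _ + g _) fi // gi.
Qed.

Lemma branching0 : branching_algebra C n 0.
Proof. by split=> //; have [Kc _ _] := regular_algebra C n; apply: Kc. Qed.

Lemma Wspace0 mu lam : Wspace C (n := n) mu lam 0.
Proof. by split=> [|t g s _ _ _]; [exact: branching0 | rewrite mulr0]. Qed.

Lemma TLcharE mu lam gam l : interlaced mu lam ->
  TLchar (n := n) mu lam gam l = \prod_(i < n) (l i 0 0 : C) ^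
    (2 * (nth 0%N gam i)%:Z - (upper mu lam i)%:Z - (lower mu lam i)%:Z).
Proof.
move=> il; apply: eq_bigr => i _; have im : (i <= m)%N by rewrite -ltnS.
by have [-> ->] := xseqE il im.
Qed.

(** A monomial in the minors, independent of the representation. *)
Lemma pattern_vector mu lam gam : LambdaB C (n := n) mu lam ->
  interlaced mu lam -> between (n := n) mu lam gam ->
  exists2 v : fn, v <> 0 &
    forall Phi, is_branching_rep Phi -> Wweight (n := n) Phi mu gam lam v.
Proof.
move=> ml il /betweenP b; have [sigma os] := order_type_exists mu lam.
have b' i : (lower mu lam i <= nth 0%N gam i <= upper mu lam i)%N.
  have [im|mi] := leqP i m; first exact: b.
  by rewrite (upper_over _ _ mi) (lower_over _ _ (ltnW mi)) nth_default ?size_tuple.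
have [|||v cv] := @cv_tower C m sigma (upper mu lam) (lower mu lam) (nth 0%N gam) _ _ b' _ n (leqnn n).
- by move=> i; apply: upper_over.
- by move=> i; apply: lower_over.
- by move=> i; apply: upper_lower.
rewrite subnn in cv; exists v.
  by have [x vx] := cv_neq0 cv; move=> v0; move: vx; rewrite v0 eqxx.
have muE : fn_tuple m (tower_mu sigma (upper mu lam) (lower mu lam) 0) = mu.
  apply: tuple_ext => i im; rewrite nth_fn_tuple im /tower_mu maxn0 mul1n.
  have := order_type_upper os im; have := upper_lower mu lam i.
  by case: (nth true sigma i) => /= ul [u e]; rewrite ?mul0n ?mul1n; lia.
have lamE : fn_tuple n (tower_lam sigma (upper mu lam) (lower mu lam) 0) = lam.
  apply: tuple_ext => i im; rewrite nth_fn_tuple im /tower_lam maxn0.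
  case: i im => [|i] im; first by rewrite ltnn /= !mul0n addn0.
  have := order_type_upper os (im : (i < m)%N); have := upper_lower mu lam i.
  by case: (nth true sigma i) => /= ul [u e]; rewrite ?mul0n ?mul1n; lia.
move=> Phi PhiP; split; first by have := cv_W cv; rewrite muE lamE.
by move=> l hl; rewrite (cv_act cv PhiP hl) TLcharE.
Qed.

Section OnePhi.
Variables (Phi : Lgroup C n -> fn -> fn) (mu : m.-tuple nat) (lam : n.-tuple nat).
Hypotheses (PhiP : is_branching_rep Phi) (ml : LambdaB C (n := n) mu lam).
Local Notation D := {dffun forall i, 'I_(Adim (n := n) mu lam i).+1}.

Let il : interlaced mu lam := LambdaB_interlaced PhiP ml.

Lemma Phi_scale l (c : C) f : branching_algebra C n f -> Phi l (c *: f) = c *: Phi l f.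
Proof.
move=> Bf; have := rep_linear (brep_rep PhiP) l c Bf branching0; rewrite addr0 => ->.
rewrite (@operator0 _ _ _ (branching_algebra C n) Phi branching0) ?addr0 //.
by move=> t a u v; apply: (rep_linear (brep_rep PhiP)).
Qed.

Lemma Wweight_scale gam (c : C) f : Wweight (n := n) Phi mu gam lam f ->
  Wweight (n := n) Phi mu gam lam (c *: f).
Proof.
move=> [Wf wf]; split; first by rewrite -[_ *: _]addr0; apply: Wspace_lin => //; apply: Wspace0.
move=> l hl; rewrite Phi_scale; last exact: Wspace_branching Wf.
by rewrite wf // !scalerA mulrC.
Qed.

(** The T_L-weights are simple. *)
Lemma Wweight_range gam (v : fn) : v <> 0 -> Wweight (n := n) Phi mu gam lam v ->
  Wweight (n := n) Phi mu gam lam = range (fun c : C => c *: v).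
Proof.
move=> v0 wv; have [e [_ _ _ uniq_e]] := weight_basis PhiP ml.
have wE f : Wweight (n := n) Phi mu gam lam f -> f <> 0 -> exists r : D,
    (forall i : 'I_n, 2 * (nth 0%N gam i)%:Z - (upper mu lam i)%:Z - (lower mu lam i)%:Z =
       (Adim (n := n) mu lam i)%:Z - 2 * (r i)%:Z) /\ exists c : C, f = c *: e r.
  by move=> [Wf wf] f0; apply: uniq_e => // l hl; rewrite wf // TLcharE.
have [r [wr [c vE]]] := wE v wv v0.
have c0 : c != 0 by apply: contra_notN v0 => /eqP c0; rewrite vE c0 scale0r.
apply/seteqP; split=> f; last by move=> [a _ <-]; exact: Wweight_scale.
move=> wf; have [->|/eqP f0] := eqVneq f 0; first by exists 0; rewrite ?scale0r.
have [r' [wr' [c' fE]]] := wE f wf f0.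
have rr' : r' = r.
  apply/ffunP => i; apply/val_inj => /=.
  by have := wr' i; rewrite (wr i) => /addrI/oppr_inj/(@mulfI int 2 isT)[->].
by exists (c' / c) => //; rewrite vE scalerA divfK // -rr' -fE.
Qed.

(** The pattern of a pure tensor of monomials, found by comparing the weights. *)
Definition gam_of (r : D) : n.-tuple nat :=
  mktuple (fun i : 'I_n => upper mu lam i - r i)%N.

Lemma nth_gam_of r (i : 'I_n) : nth 0%N (gam_of r) i = (upper mu lam i - r i)%N.
Proof. by rewrite -tnth_nth tnth_mktuple. Qed.

Lemma gam_of_bound (r : D) (i : 'I_n) : (lower mu lam i + r i <= upper mu lam i)%N.
Proof.
have im : (i <= m)%N by rewrite -ltnS.
have := ltn_ord (r i); have := Adim_interlaced i il; have := il im.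
by lia.
Qed.

Lemma gam_of_between r : between (n := n) mu lam (gam_of r).
Proof.
apply/betweenP => i im; have := gam_of_bound r (Ordinal (im : (i < n)%N)).
by have := nth_gam_of r (Ordinal (im : (i < n)%N)) => /= ->; lia.
Qed.

Lemma gam_of_inj : injective gam_of.
Proof.
move=> r r' rr'; apply/ffunP => i; apply/val_inj => /=.
have := nth_gam_of r i; rewrite rr' nth_gam_of.
have := gam_of_bound r i; have := gam_of_bound r' i.
by move: (nat_of_ord (r i)) (nat_of_ord (r' i)) => a b; lia.
Qed.

Lemma gam_of_weight r (l : Lgroup C n) : TL l -> TLchar (n := n) mu lam (gam_of r) l = tens_weight r l.
Proof.
move=> hl; rewrite TLcharE //; apply: eq_bigr => i _; congr (_ ^ _).
have := gam_of_bound r i; have := Adim_interlaced i il; rewrite nth_gam_of.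
by move: (nat_of_ord (r i)) => a; lia.
Qed.

Lemma TLchar_separates gam gam' : gam <> gam' ->
  exists2 l : Lgroup C n, TL l & TLchar (n := n) mu lam gam l != TLchar (n := n) mu lam gam' l.
Proof.
apply: contra_notP => h; apply: tuple_ext => i im.
suff /(_ (Ordinal im)) /addIr/addIr/(@mulfI int 2 isT)[] : forall i : 'I_n,
    2 * (nth 0%N gam i)%:Z - (upper mu lam i)%:Z - (lower mu lam i)%:Z =
    2 * (nth 0%N gam' i)%:Z - (upper mu lam i)%:Z - (lower mu lam i)%:Z by [].
apply: (@TL_separates C) => l hl; rewrite -!TLcharE //.
by apply/eqP; apply: contra_notT h => ll'; exists l.
Qed.

Lemma Wspace_direct_sum :
  direct_sum (between (n := n) mu lam) (fun gam => Wweight (n := n) Phi mu gam lam)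
    (Wspace C (n := n) mu lam).
Proof.
split; last first.
  move=> s F us sF; apply: (@eigen_independent C fn _ {l : Lgroup C n | TL l}
    (branching_algebra C n) (fun l => Phi (sval l))
    (fun l gam => TLchar (n := n) mu lam gam (sval l)) branching0) => //.
  - by move=> a u v; apply: branching_lin.
  - by move=> t a u v; apply: (rep_linear (brep_rep PhiP)).
  - move=> gam /sF [_ [Wf wf]]; split; first exact: Wspace_branching Wf.
    by move=> [l hl] /=; apply: wf.
  - move=> gam gam' _ _ /eqP /TLchar_separates [l hl ne].
    by exists (exist _ l hl).
apply/seteqP; split=> f.
  have [e [eW eT espan _]] := weight_basis PhiP ml.
  move=> /espan [a ->].
  exists [seq gam_of r | r <- enum D], (fun gam =>
    if [pick r | gam_of r == gam] is Some r then a r *: e r else 0).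
  have pickE r : [pick r' | gam_of r' == gam_of r] = Some r.
    case: pickP => [r' /eqP/gam_of_inj -> //|/(_ r)]; by rewrite eqxx.
  split; first by rewrite map_inj_uniq ?enum_uniq //; exact: gam_of_inj.
    move=> gam /mapP [r _ ->]; rewrite pickE; split; first exact: gam_of_between.
    apply: Wweight_scale; split; first by have [] := eW r.
    by move=> l hl; rewrite eT // gam_of_weight.
  rewrite big_map big_enum /=; apply: eq_bigr => r _.
  by rewrite pickE.
move=> [s [F [us sF ->]]]; apply: (closed_sum (Wspace0 mu lam)).
  by move=> a u v; apply: Wspace_lin.
by move=> gam /sF [_ []].
Qed.

End OnePhi.

End Patterns.

(** * Dominance in rank one *)

Section RankOne.
Variable C : numFieldType.

Definition mx2 (a b c d : C) : 'M[C]_2 :=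
  \matrix_(i, j) (if (i == 0 :> nat)%N then (if (j == 0 :> nat)%N then a else b)
                  else (if (j == 0 :> nat)%N then c else d)).

Lemma det_mx2E a b c d : \det (mx2 a b c d) = a * d - b * c.
Proof. by rewrite det_mx2 !mxE. Qed.

Fact low_subproof x : \det (mx2 1 0 x 1) == 1.
Proof. by rewrite det_mx2E mul1r mul0r subr0. Qed.
Fact up_subproof x : \det (mx2 1 x 0 1) == 1.
Proof. by rewrite det_mx2E mul1r mulr0 subr0. Qed.
Fact dg_subproof z : \det (if z != 0 then mx2 z 0 0 z^-1 else 1%:M) == 1.
Proof.
case: (eqVneq z 0) => [_|z0] /=; first by rewrite det1.
by rewrite det_mx2E mulfV // mul0r subr0.
Qed.
Fact weyl_subproof x : \det (mx2 x 1 (-1) 0) == 1.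
Proof. by rewrite det_mx2E mulr0 mul1r sub0r opprK. Qed.

Definition low x : SL2 C := MkSL2 (low_subproof x).
Definition up x : SL2 C := MkSL2 (up_subproof x).
(** Extended by 1 at z = 0, to be total. *)
Definition dg z : SL2 C := MkSL2 (dg_subproof z).
Definition weyl x : SL2 C := MkSL2 (weyl_subproof x).

Lemma mx2M a b c d a' b' c' d' : mx2 a b c d *m mx2 a' b' c' d' =
  mx2 (a * a' + b * c') (a * b' + b * d') (c * a' + d * c') (c * b' + d * d').
Proof.
apply/matrixP => i j; rewrite !mxE !big_ord_recl big_ord0 !mxE /= addr0.
by case: ifP; case: ifP.
Qed.

(** For s <> 0 the curve lies in the big cell; this is its triangular decomposition. *)
Lemma weyl_bruhat s : s != 0 -> weyl s = (low (- s^-1) * (dg s * up s^-1))%g.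
Proof.
move=> s0; apply/val_inj; rewrite /= s0 !mx2M; congr mx2; field; exact: s0.
Qed.

(** By [weyl_bruhat], the values of F on the upper unipotents, a polynomial P, and on
    the curve [weyl], a polynomial Q, satisfy
    Q(s) = s^k P(1/s). If k < 0, then s^d P(1/s), with d the size of P, would be
    divisible by s^(d+1); but its coefficient of degree d is P(0) = F(1). *)
Lemma rank_one (F : SL2 C -> C) (k : int) :
  poly_fun (fun s => F (up s)) -> poly_fun (fun s => F (weyl s)) ->
  (forall x h, F (low x * h)%g = F h) ->
  (forall z h, z != 0 -> F (dg z * h)%g = z ^ k * F h) -> F 1%g != 0 -> 0 <= k.
Proof.
move=> [P PE] [Q QE] Flow Fdg F1; case: k Fdg => // k Fdg; exfalso.
have up0 : up 0 = 1%g.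
  apply/val_inj/matrixP => i j; rewrite /= !mxE.
  by case: i => [[|[|]]] // ?; case: j => [[|[|]]].
have P0 : P`_0 != 0 by rewrite -horner_coef0 -PE up0.
pose d := size P; pose R : {poly C} := \sum_(i < d) P`_i *: 'X^(d - i).
(* R(s) = s^d P(1/s); the two sides agree at all positive integers. *)
have RQ : R = Q * 'X^(d + k.+1).
  apply/eqP; rewrite -subr_eq0; apply/negPn/negP => /poly_nonroot [j].
  set s : C := j.+1%:R; have s0 : s != 0 by rewrite pnatr_eq0.
  rewrite /root hornerD hornerN hornerM hornerXn -QE weyl_bruhat // Flow Fdg // PE.
  rewrite horner_sum horner_coef subr_eq0 mulr_sumr mulr_suml => /eqP; apply.
  apply: eq_bigr => i _; rewrite hornerZ hornerXn NegzE -exprnN.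
  have id : (i <= d)%N by apply: ltnW.
  rewrite -[in RHS](subnK id) !exprD exprVn.
  by field; rewrite !expf_neq0.
have := congr1 (fun p : {poly C} => p`_d) RQ.
rewrite coefMXn (_ : (d < d + k.+1)%N = true) ?coef_sum; last lia.
have d0 : (0 < d)%N.
  by rewrite lt0n; apply: contraNneq P0 => /eqP; rewrite size_poly_eq0 => /eqP ->; rewrite coef0.
rewrite (bigD1 (Ordinal d0)) //= coefZ coefXn subn0 eqxx mulr1 big1 => [|i i0].
  by rewrite addr0 => /eqP; rewrite (negPf P0).
rewrite coefZ coefXn (_ : (d == d - i)%N = false) ?mulr0 //.
have := ltn_ord i; have : (i != 0 :> nat) by []; lia.
Qed.

End RankOne.

(** * Embeddings of SL2 along roots *)

Section RootSubgroups.
Variables (C : numFieldType) (m : nat).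
Local Notation n := m.+1.
Local Notation Sp := (Sp C n).
Local Notation J := (Jmx C n).

(** What is used of the homomorphism from SL2 to Sp_2n along a root: its
    compatibility with the triangular subgroups, with w the coroot. *)
Record root_embedding (phi : SL2 C -> Sp) (w : 'I_n -> int) : Prop := RootEmbedding {
  root_mul : forall h h', phi (h * h')%g = (phi h * phi h')%g;
  root_low : forall x, lower_unip (phi (low x));
  root_up : forall x, upper_unip (phi (up x));
  root_torus : forall z, z != 0 -> torus (phi (dg z));
  root_weight : forall z i, z != 0 -> phi (dg z) (epos i) (epos i) = z ^ w i;
  root_poly : forall h : C -> SL2 C, (forall i j, poly_fun (fun s => h s i j)) ->
    forall i j, poly_fun (fun s => phi (h s) i j) }.

Section Construction.
Variables (p : nat) (pos : 'I_p -> 'I_(n + n)) (sg : 'I_p -> bool) (Jp : 'M[C]_p).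
Variable rho : 'M[C]_2 -> 'M[C]_p.
Hypothesis pos_inj : injective pos.

(** Signed basis vectors, which span a subspace stable under SL2. *)
Definition root_cols : 'M[C]_(n + n, p) := \matrix_(r, a) ((-1) ^+ sg a * (r == pos a)%:R).
Local Notation P := root_cols.

Definition root_mx (h : 'M[C]_2) : 'M[C]_(n + n) := 1%:M + P *m (rho h - 1%:M) *m P^T.

Lemma root_orth : P^T *m P = 1%:M.
Proof.
apply/matrixP => a b; rewrite !mxE (bigD1 (pos a)) //= big1 => [|r ra]; rewrite !mxE.
  rewrite eqxx mulr1 addr0 (inj_eq pos_inj); case: eqP => [->|]; last by rewrite mulr0 mulr0.
  by rewrite mulr1 -expr2 sqrr_sign.
by rewrite (negPf ra) mulr0 mul0r.
Qed.

Lemma root_mxE h r c : root_mx h r c = (r == c)%:R +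
  \sum_a \sum_b (((-1) ^+ sg a * (r == pos a)%:R) * (rho h - 1%:M) a b *
    ((-1) ^+ sg b * (c == pos b)%:R)).
Proof.
rewrite !mxE; congr (_ + _); rewrite exchange_big; apply: eq_bigr => b _.
by rewrite !mxE mulr_suml; apply: eq_bigr => a _; rewrite !mxE.
Qed.

Hypotheses (rhoM : forall h h', rho (h *m h') = rho h *m rho h') .
Hypotheses (JP : J *m P = P *m Jp) (JpT : Jp^T = - Jp).
Hypothesis rhoJ : forall h : SL2 C, (rho h)^T *m Jp *m rho h = Jp.

Lemma root_mxM h h' : root_mx (h *m h') = root_mx h *m root_mx h'.
Proof.
rewrite /root_mx mulmxDl mul1mx mulmxDr mulmx1 -addrA; congr (_ + _).
have -> : P *m (rho h - 1%:M) *m P^T *m (P *m (rho h' - 1%:M) *m P^T) =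
    P *m ((rho h - 1%:M) *m (rho h' - 1%:M)) *m P^T.
  by rewrite -!mulmxA (mulmxA P^T P) root_orth mul1mx.
rewrite -!mulmxDl -!mulmxDr rhoM; congr (_ *m _ *m _).
rewrite mulmxBr mulmx1 mulmxBl mul1mx.
by move: (rho h *m rho h') => X; apply/matrixP => i j; rewrite !mxE; ring.
Qed.

Fact root_subproof (h : SL2 C) : (root_mx h)^T *m J *m root_mx h == J.
Proof.
have PJ : P^T *m J = Jp *m P^T.
  have /(congr1 trmx) := JP; rewrite !trmx_mul Jmx_tr JpT mulmxN mulNmx.
  by move/oppr_inj.
set K := rho h - 1%:M; have -> : (root_mx h)^T = 1%:M + P *m K^T *m P^T.
  by rewrite /root_mx linearD /= trmx1 !trmx_mul trmxK mulmxA.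
rewrite /root_mx -/K mulmxDl mul1mx mulmxDr mulmx1 mulmxDl.
have -> : P *m K^T *m P^T *m J = P *m (K^T *m Jp) *m P^T by rewrite -!mulmxA PJ.
have -> : J *m (P *m K *m P^T) = P *m (Jp *m K) *m P^T by rewrite !mulmxA JP.
have -> : P *m (K^T *m Jp) *m P^T *m (P *m K *m P^T) = P *m (K^T *m Jp *m K) *m P^T.
  by rewrite -!mulmxA (mulmxA P^T P) root_orth mul1mx.
rewrite -addrA -!mulmxDl -!mulmxDr.
suff -> : K^T *m Jp + (Jp *m K + K^T *m Jp *m K) = 0 by rewrite mulmx0 mul0mx addr0.
have -> : K^T = (rho h)^T - 1%:M by rewrite linearB /= trmx1.
rewrite /K mulmxBl mul1mx !mulmxBr !mulmx1 mulmxBl rhoJ.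
move: ((rho h)^T *m Jp) (Jp *m rho h) => X Y.
by apply/matrixP => i j; rewrite !mxE; ring.
Qed.

Definition root_sl2 (h : SL2 C) : Sp := MkSp (root_subproof h).

Hypothesis rho_low : forall x a b, a != b -> ~~ (pos b < pos a)%N -> rho (low x) a b = 0.
Hypothesis rho_up : forall x a b, a != b -> ~~ (pos a < pos b)%N -> rho (up x) a b = 0.
Hypothesis rho_unip : forall x a, rho (low x) a a = 1 /\ rho (up x) a a = 1.
Hypothesis rho_dg : forall z a b, a != b -> rho (dg z) a b = 0.
Hypothesis rho_poly : forall h : C -> SL2 C, (forall i j, poly_fun (fun s => h s i j)) ->
  forall a b, poly_fun (fun s => rho (h s) a b).

Lemma root_mx_outside h r c : (forall a, c != pos a) -> root_mx h r c = (r == c)%:R.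
Proof.
move=> ca; rewrite root_mxE big1 ?addr0 // => a _; rewrite big1 // => b _.
by rewrite (negPf (ca b)) !mulr0.
Qed.

Lemma root_mx_outside_row h r c : (forall a, r != pos a) -> root_mx h r c = (r == c)%:R.
Proof.
move=> ca; rewrite root_mxE big1 ?addr0 // => a _; rewrite big1 // => b _.
by rewrite (negPf (ca a)) mulr0 !mul0r.
Qed.

Lemma root_mx_inside h a b : root_mx h (pos a) (pos b) =
  (-1) ^+ sg a * rho h a b * (-1) ^+ sg b.
Proof.
rewrite root_mxE (bigD1 a) //= [X in _ + (_ + X)]big1 => [|a' aa']; last first.
  rewrite big1 // => b' _; rewrite (inj_eq pos_inj) [a == a']eq_sym (negPf aa').
  by rewrite mulr0 !mul0r.
rewrite (bigD1 b) //= [X in _ + (_ + X + _)]big1 => [|b' bb']; last first.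
  by rewrite !(inj_eq pos_inj) [b == b']eq_sym (negPf bb') !mulr0.
rewrite !eqxx !mulr1 !addr0 (inj_eq pos_inj) !mxE.
have [->|ab] := eqVneq a b; rewrite ?subr0 ?add0r //=.
rewrite mulrBr mulrBl -[X in _ + (_ - X)]mulrA mul1r -expr2 sqrr_sign.
by rewrite addrC subrK.
Qed.

Lemma pos_dec r : (exists a, r = pos a) \/ (forall a, r != pos a).
Proof.
have [/existsP [a /eqP ->]|h] := boolP [exists a, r == pos a]; first by left; exists a.
by right=> a; apply: contraNneq h => ->; apply/existsP; exists a.
Qed.

(** Only the entries in rows and columns [pos a] differ from those of the identity,
    and they are those of rho up to sign. *)
Lemma root_sl2_embedding (w : 'I_n -> int) :
  (forall z i a, z != 0 -> epos i = pos a -> rho (dg z) a a = z ^ w i) ->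
  (forall i, (forall a, epos i != pos a) -> w i = 0) ->
  root_embedding root_sl2 w.
Proof.
move=> wa w0.
have sgK (x : C) b : (-1) ^+ b * x * (-1) ^+ b = x by rewrite mulrAC -expr2 sqrr_sign mul1r.
split.
- by move=> h h'; apply/val_inj; rewrite /= root_mxM.
- move=> x; split=> [|r].
    apply/is_trig_mxP => r c rc; rewrite -[LHS]/(root_mx _ r c).
    have rc' : (r == c) = false by apply/negP => /eqP e; move: rc; rewrite e ltnn.
    have [[a ra]|ra] := pos_dec r; last by rewrite root_mx_outside_row // rc'.
    have [[b cb]|cb] := pos_dec c; last by rewrite root_mx_outside // rc'.
    subst r c; rewrite root_mx_inside rho_low ?mulr0 ?mul0r //.
      by apply: contraFneq rc' => ->.
    by rewrite -leqNgt ltnW.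
  have [[a ->]|ra] := pos_dec r; last by rewrite -[LHS]/(root_mx _ _ _) root_mx_outside // eqxx.
  by rewrite -[LHS]/(root_mx _ _ _) root_mx_inside (proj1 (rho_unip x a)) sgK.
- move=> x; split=> [|r].
    apply/is_trig_mxP => r c rc; rewrite mxE -[LHS]/(root_mx _ c r).
    have rc' : (c == r) = false by apply/negP => /eqP e; move: rc; rewrite e ltnn.
    have [[a ra]|ra] := pos_dec r; last by rewrite root_mx_outside // rc'.
    have [[b cb]|cb] := pos_dec c; last by rewrite root_mx_outside_row // rc'.
    subst r c; rewrite root_mx_inside rho_up ?mulr0 ?mul0r //.
      by apply: contraFneq rc' => ->.
    by rewrite -leqNgt ltnW.
  have [[a ->]|ra] := pos_dec r; last by rewrite -[LHS]/(root_mx _ _ _) root_mx_outside // eqxx.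
  by rewrite -[LHS]/(root_mx _ _ _) root_mx_inside (proj2 (rho_unip x a)) sgK.
- move=> z z0; apply/is_diag_mxP => r c rc; rewrite -[LHS]/(root_mx _ r c).
  have rc' : (r == c) = false by apply/negP => /eqP e; move: rc; rewrite e eqxx.
  have [[a ra]|ra] := pos_dec r; last by rewrite root_mx_outside_row // rc'.
  have [[b cb]|cb] := pos_dec c; last by rewrite root_mx_outside // rc'.
  subst r c; rewrite root_mx_inside rho_dg ?mulr0 ?mul0r //.
  by apply: contraFneq rc' => ->.
- move=> z i z0; have [[a ia]|ia] := pos_dec (epos i).
    by rewrite -[LHS]/(root_mx _ _ _) ia root_mx_inside sgK (wa _ i).
  by rewrite -[LHS]/(root_mx _ _ _) root_mx_outside // eqxx w0 ?expr0z.
- move=> h hp i j; have [Kc KD KM] := poly_fun_algebra C.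
  apply: (funalg_addmx (poly_fun_algebra C)) => {}i {}j; first exact: Kc.
  apply: (funalg_mulmx (poly_fun_algebra C)) => {}i {}j; last exact: Kc.
  apply: (funalg_mulmx (poly_fun_algebra C)) => {}i {}j; first exact: Kc.
  apply: (funalg_addmx (poly_fun_algebra C)) => {}i {}j; last exact: Kc.
  exact: rho_poly.
Qed.

Lemma root_sl2_sub : (forall a, pos a != epos ord_max /\ pos a != eneg ord_max) ->
  forall h, Sp_sub (root_sl2 h).
Proof.
move=> pa h i im; have -> : i = ord_max by apply/val_inj => /=; lia.
split; apply/matrixP => r c; rewrite ord1 mxE [RHS]mxE andbT -[LHS]/(root_mx _ _ _);
  by apply: root_mx_outside => a; rewrite eq_sym; have [] := pa a.
Qed.

End Construction.

End RootSubgroups.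

(** * Long and short roots *)

Section Roots.
Variables (C : numFieldType) (m : nat).
Local Notation n := m.+1.

Lemma Jmx_mulE p (A : 'M[C]_(n + n, p)) r a :
  (Jmx C n *m A) r a = (-1) ^+ (n <= r)%N * A (rev_ord r) a.
Proof.
rewrite mxE (bigD1 (rev_ord r)) //= JmxE eqxx mulr1 big1 ?addr0 // => k kr.
by rewrite JmxE (negPf kr) mulr0 mul0r.
Qed.

Lemma sign_eneg (i : 'I_n) (r : 'I_(n + n)) :
  (-1) ^+ (n <= r)%N * (rev_ord r == epos i)%:R = - (r == eneg i)%:R :> C.
Proof.
rewrite (can2_eq (@rev_ordK _) (@rev_ordK _)) -/(eneg i); case: eqP => [->|_]; last first.
  by rewrite mulr0 oppr0.
by rewrite (_ : (n <= eneg i)%N) ?mulr1 //=; have := ltn_ord i; lia.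
Qed.

Lemma sign_epos (i : 'I_n) (r : 'I_(n + n)) :
  (-1) ^+ (n <= r)%N * (rev_ord r == eneg i)%:R = (r == epos i)%:R :> C.
Proof.
rewrite (can2_eq (@rev_ordK _) (@rev_ordK _)) /eneg rev_ordK; case: eqP => [->|_].
  by rewrite mulr1 leqNgt /= ltn_ord.
by rewrite mulr0.
Qed.

Lemma ord2P (i : 'I_2) : i = 0 \/ i = 1.
Proof. by case: i => [[|[|//]] ?]; [left|right]; apply/val_inj. Qed.

Lemma ord2_sum (F : 'I_2 -> C) : \sum_i F i = F 0 + F 1.
Proof.
rewrite !big_ord_recl big_ord0 addr0; congr (_ + F _); exact/val_inj.
Qed.

(** SL2 acting on the span of e_i, e_(-i). *)
Lemma long_root (i : 'I_n) : exists2 phi : SL2 C -> Sp C n,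
  root_embedding phi (fun j => (j == i)%:R) &
  (i < m)%N -> forall h, Sp_sub (phi h).
Proof.
pose pos (a : 'I_2) := if a == 0 then epos i else eneg i.
have pos01 : (pos 0%R < pos 1%R)%N by rewrite /pos /=; have := ltn_ord i; lia.
have pos_inj : injective pos.
  move=> a b; case: (ord2P a) => ->; case: (ord2P b) => -> // e; move: pos01;
    by rewrite e ltnn.
have JP : Jmx C n *m root_cols C pos xpred0 = root_cols C pos xpred0 *m J2mx C.
  apply/matrixP => r a; rewrite Jmx_mulE !mxE ord2_sum !mxE /pos.
  case: (ord2P a) => -> /=; rewrite ?expr0 ?expr1 ?mulr0 ?mulr1 ?mul1r ?add0r ?addr0 ?mulrN1.
    exact: sign_eneg.
  exact: sign_epos.
have unip x a : low x a a = 1 :> C /\ up x a a = 1 :> C.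
  by rewrite !mxE; case: (ord2P a) => ->.
exists (@root_sl2 C m 2 pos xpred0 (J2mx C) id pos_inj JP (J2mx_tr C) (@sl2_J2 C)).
  apply: root_sl2_embedding => //.
  - move=> x a b; rewrite !mxE; case: (ord2P a) => ->; case: (ord2P b) => -> //=.
    by rewrite pos01.
  - move=> x a b; rewrite !mxE; case: (ord2P a) => ->; case: (ord2P b) => -> //=.
    by rewrite pos01.
  - move=> z a b ab; rewrite /=; case: ifP => _; rewrite !mxE; move: ab;
    by case: (ord2P a) => ->; case: (ord2P b) => ->.
  - move=> z j a z0; rewrite /= z0 !mxE; case: (ord2P a) => -> /=.
      by rewrite /pos /= => /lshift_inj ->; rewrite eqxx expr1z.
    rewrite /pos /= => /(congr1 val) /= ; have := ltn_ord j; have := ltn_ord i; lia.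
  - move=> j /(_ 0); rewrite /pos /= (inj_eq (@lshift_inj _ _)) => /negPf -> //.
move=> im h; apply: root_sl2_sub => a; rewrite /pos -!val_eqE /=.
by case: ifP => _ /=; split; apply/eqP; lia.
Qed.

(** SL2 acting on the span of e_i, e_(i+1) and, dually, on that of e_(-i-1), -e_(-i):
    with this sign the two representations are given by the same matrices. *)
Lemma short_root (i j : 'I_n) : (j = i.+1 :> nat) -> exists2 phi : SL2 C -> Sp C n,
  root_embedding phi (fun k => (k == i)%:R - (k == j)%:R) &
  (j < m)%N -> forall h, Sp_sub (phi h).
Proof.
move=> ij.
pose pos (a : 'I_(2 + 2)) := match fintype.split a with
  | inl b => if b == 0 then epos i else epos j
  | inr b => if b == 0 then eneg j else eneg i end.
pose sg (a : 'I_(2 + 2)) := if fintype.split a is inr b then b == 1 else false.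
pose rho (h : 'M[C]_2) : 'M[C]_(2 + 2) := block_mx h 0 0 h.
pose Jp : 'M[C]_(2 + 2) := block_mx 0 (- J2mx C) (- J2mx C) 0.
have sl (a : 'I_2) : fintype.split (lshift 2 a) = inl a by rewrite -[lshift _ _]/(unsplit (inl a)) unsplitK.
have sr (a : 'I_2) : fintype.split (rshift 2 a) = inr a by rewrite -[rshift _ _]/(unsplit (inr a)) unsplitK.
have posl a : pos (lshift 2 a) = if a == 0 then epos i else epos j by rewrite /pos sl.
have posr a : pos (rshift 2 a) = if a == 0 then eneg j else eneg i by rewrite /pos sr.
have sgl a : sg (lshift 2 a) = false by rewrite /sg sl.
have sgr a : sg (rshift 2 a) = (a == 1) by rewrite /sg sr.
have i_lt := ltn_ord i; have j_lt := ltn_ord j.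
have pos_inj : injective pos.
  move=> a b; case: (split_ordP a) => a' ->; case: (split_ordP b) => b' ->;
    rewrite ?posl ?posr; case: (ord2P a') => ->; case: (ord2P b') => -> //=;
    move=> /(congr1 val) /=; lia.
have JP : Jmx C n *m root_cols C pos sg = root_cols C pos sg *m Jp.
  apply/matrixP => r a; rewrite Jmx_mulE [RHS]mxE big_split_ord /= !ord2_sum.
  case: (split_ordP a) => b ->;
    rewrite ?block_mxEul ?block_mxEur ?block_mxEdl ?block_mxEdr !mxE;
    rewrite ?sgl ?sgr ?posl ?posr mulrCA;
    case: (ord2P b) => -> /=; rewrite ?sign_eneg ?sign_epos; ring.
have JpT : Jp^T = - Jp.
  rewrite /Jp tr_block_mx !trmx0 opp_block_mx !oppr0.
  by rewrite !linearN /= J2mx_tr !opprK.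
have rhoJ (h : SL2 C) : (rho h)^T *m Jp *m rho h = Jp.
  rewrite /rho /Jp tr_block_mx !trmx0 !mulmx_block !mulmx0 !mul0mx !addr0 !add0r.
  by rewrite !mulmxN !mulNmx sl2_J2 !mul0mx.
have rhoM h h' : rho (h *m h') = rho h *m rho h'.
  by rewrite /rho mulmx_block !mulmx0 !mul0mx !addr0 !add0r.
exists (@root_sl2 C m (2 + 2) pos sg Jp rho pos_inj JP JpT rhoJ).
  apply: root_sl2_embedding => //.
  - move=> x a b; case: (split_ordP a) => a' ->; case: (split_ordP b) => b' ->;
    rewrite ?block_mxEul ?block_mxEur ?block_mxEdl ?block_mxEdr ?posl ?posr !mxE //;
    case: (ord2P a') => ->; case: (ord2P b') => -> //=; rewrite ?eqxx //; lia.
  - move=> x a b; case: (split_ordP a) => a' ->; case: (split_ordP b) => b' ->;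
    rewrite ?block_mxEul ?block_mxEur ?block_mxEdl ?block_mxEdr ?posl ?posr !mxE //;
    case: (ord2P a') => ->; case: (ord2P b') => -> //=; rewrite ?eqxx //; lia.
  - move=> x a; case: (split_ordP a) => a' ->;
    by rewrite ?block_mxEul ?block_mxEdr !mxE; case: (ord2P a') => ->.
  - move=> z a b; case: (split_ordP a) => a' ->; case: (split_ordP b) => b' ->;
    rewrite ?block_mxEul ?block_mxEur ?block_mxEdl ?block_mxEdr ?mxE //=; case: ifP => _; rewrite ?mxE;
    by case: (ord2P a') => ->; case: (ord2P b') => -> //=; rewrite ?eqxx.
  - move=> h hp a b; have [Kc _ _] := poly_fun_algebra C.
    case: (split_ordP a) => a' ->; case: (split_ordP b) => b' ->.
    + by under [X in poly_fun X]eq_fun do rewrite block_mxEul; apply: hp.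
    + by under [X in poly_fun X]eq_fun do rewrite block_mxEur; apply: Kc.
    + by under [X in poly_fun X]eq_fun do rewrite block_mxEdl; apply: Kc.
    + by under [X in poly_fun X]eq_fun do rewrite block_mxEdr; apply: hp.
  - move=> z k a z0; case: (split_ordP a) => a' ->; rewrite ?posl ?posr.
      rewrite block_mxEul /= z0 !mxE; case: (ord2P a') => -> /= /lshift_inj ->.
        by rewrite eqxx -val_eqE /= ij (_ : (i == i.+1 :> nat) = false) ?subr0 ?expr1z //; lia.
      rewrite eqxx -val_eqE /= ij (_ : (i.+1 == i :> nat) = false); last lia.
      by rewrite sub0r -exprN1.
    have := ltn_ord k.
    by case: (ord2P a') => -> /= k_lt /(congr1 val) /=; lia.
  - move=> k ka; have := ka (lshift 2 0); have := ka (lshift 2 1).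
    by rewrite !posl /= !(inj_eq (@lshift_inj _ _)) => /negPf -> /negPf ->; rewrite subr0.
move=> jm h; apply: root_sl2_sub => a.
by case: (split_ordP a) => b ->; rewrite ?posl ?posr -!val_eqE; case: (ord2P b) => -> /=;
  split; apply/eqP; lia.
Qed.

End Roots.

(** * Weight vectors for the tori *)

Section TorusWeights.
Variables (C : numFieldType) (m : nat).
Local Notation n := m.+1.
Local Notation Sp := (Sp C n).
Local Notation fn := (Sp -> C^o).
Implicit Types (f : fn) (t g u v : Sp).

Lemma torus_inv t (i : 'I_n) : torus t ->
  t (epos i) (epos i) * t (eneg i) (eneg i) = 1.
Proof.
move=> /is_diag_mxP td; have /matrixP/(_ (epos i) (eneg i)) := spP t.
rewrite -mulmxA mxE (bigD1 (epos i)) //= big1 => [|k ki]; last first.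
  by rewrite mxE td ?mul0r.
rewrite addr0 [X in X * _ = _]mxE Jmx_mulE JmxE eqxx /= leqNgt ltn_ord /= !mul1r.
by rewrite -/(eneg i).
Qed.

Lemma torus_neq0 t r : torus t -> t r r != 0.
Proof.
move=> tt; have h (i : 'I_n) := torus_inv i tt.
have [i [->|->]] : exists i : 'I_n, r = epos i \/ r = eneg i.
- case: (split_ordP r) => a ->; first by exists a; left.
  exists (rev_ord a); right; apply/val_inj => /=; have := ltn_ord a; lia.
- by apply: contra_eq_neq (h i) => ->; rewrite mul0r eq_sym oner_neq0.
- by apply: contra_eq_neq (h i) => ->; rewrite mulr0 eq_sym oner_neq0.
Qed.

Lemma torus_entry t u g r c : torus t -> torus u ->
  (t * g * u)%g r c = t r r * g r c * u c c.
Proof.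
move=> /is_diag_mxP td /is_diag_mxP ud; rewrite mxE (bigD1 c) //= big1 => [|k kc].
  rewrite addr0 mxE (bigD1 r) //= big1 ?addr0 // => k kr.
  by rewrite td ?mul0r // eq_sym.
by rewrite ud ?mulr0.
Qed.

Lemma torusV t : torus t -> torus (t^-1)%g /\ forall r, (t^-1)%g r r = (t r r)^-1 :> C.
Proof.
move=> tt; have /is_diag_mxP td := tt.
have tE r c : t r r * (t^-1)%g r c = (r == c)%:R.
  have /(congr1 (fun g : Sp => g r c)) := mulgV t; rewrite [RHS]mxE => <-.
  by rewrite mxE (bigD1 r) //= big1 ?addr0 // => k kr; rewrite td ?mul0r // eq_sym.
have t0 r := torus_neq0 r tt; split; last first.
  by move=> r; apply: (mulfI (t0 r)); rewrite tE eqxx mulfV.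
apply/is_diag_mxP => r c rc; apply: (mulfI (t0 r)); rewrite tE mulr0.
by rewrite (_ : (r == c) = false) //; apply: negPf.
Qed.

Lemma torusM t u : torus t -> torus u -> torus (t * u)%g.
Proof.
move=> tt tu; rewrite -[t]mulg1; apply/is_diag_mxP => r c rc.
by rewrite torus_entry // mxE (_ : (r == c) = false) ?mulr0 ?mul0r //; apply: negPf.
Qed.

Lemma Sp_subM u v : Sp_sub u -> Sp_sub v -> Sp_sub (u * v)%g.
Proof.
move=> su sv i im; rewrite /fixes_e !colE /= -!mulmxA -!colE.
have [u1 u2] := su i im; have [v1 v2] := sv i im.
by rewrite v1 v2 -!colE.
Qed.

Lemma torus1 : torus (1%g : Sp).
Proof. by rewrite /torus /= scalar_mx_is_diag. Qed.

Lemma Sp_sub1 : Sp_sub (1%g : Sp).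
Proof. by move=> i _; rewrite /fixes_e !colE !mul1mx. Qed.

Definition zchar (a : 'I_n -> int) t : C := \prod_(i < n) t (epos i) (epos i) ^ a i.

Lemma zcharM a t u : torus t -> torus u -> zchar a (t * u)%g = zchar a t * zchar a u.
Proof.
move=> tt tu; rewrite -big_split; apply: eq_bigr => i _ /=.
have -> : (t * u)%g (epos i) (epos i) = t (epos i) (epos i) * u (epos i) (epos i) :> C.
  rewrite -[t in LHS]mulg1 torus_entry // [X in _ * X * _ = _]mxE eqxx.
  by rewrite mulr1.
by rewrite expfzMl.
Qed.

Lemma zcharD (a b : 'I_n -> int) t : torus t ->
  zchar (fun i => a i + b i) t = zchar a t * zchar b t.
Proof.
move=> tt; rewrite -big_split; apply: eq_bigr => i _.
by rewrite expfzDr // torus_neq0.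
Qed.

Lemma zchar0 t : zchar (fun=> 0) t = 1.
Proof. by rewrite /zchar big1. Qed.

Lemma zchar1 a : zchar a 1%g = 1.
Proof. by rewrite /zchar big1 // => i _; rewrite mxE eqxx exp1rz. Qed.

Lemma zchar_delta (i : 'I_n) (e : int) t :
  zchar (fun j => if j == i then e else 0) t = t (epos i) (epos i) ^ e.
Proof.
rewrite /zchar (bigD1 i) //= eqxx big1 ?mulr1 // => j /negPf ->.
by rewrite expr0z.
Qed.

Local Notation wt := ({ffun 'I_n -> int} * {ffun 'I_n -> int})%type.

(** Weights of the product of the tori of Sp_2n and Sp_(2n-2). The last entry of the
    second component is normalized to 0, as the last coordinate of the torus of
    Sp_(2n-2) is 1. *)
Definition torus_char (chi : Sp -> Sp -> C) (w : wt) : Prop :=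
  w.2 ord_max = 0 /\ forall t u, torus t -> torus u -> Sp_sub u ->
    chi t u = zchar w.1 t * zchar w.2 u.

Lemma torus_charM chi chi' : (exists w, torus_char chi w) -> (exists w, torus_char chi' w) ->
  exists w, torus_char (fun t u => chi t u * chi' t u) w.
Proof.
move=> [w [w0 wE]] [w' [w0' wE']].
exists ([ffun i => w.1 i + w'.1 i], [ffun i => w.2 i + w'.2 i]).
split=> [|t u tt tu us]; first by rewrite /= ffunE w0 w0'.
rewrite wE // wE' // mulrACA -!zcharD //.
by congr (_ * _); apply: eq_bigr => i _; rewrite ffunE.
Qed.

Lemma torus_char1 : exists w, torus_char (fun _ _ => 1) w.
Proof.
exists ([ffun=> 0], [ffun=> 0]); split=> [|t u _ _ _]; first by rewrite /= ffunE.
by rewrite /zchar !big1 ?mulr1 // => i _; rewrite ffunE.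
Qed.

Lemma torus_charX chi k : (exists w, torus_char chi w) ->
  exists w, torus_char (fun t u => chi t u ^+ k) w.
Proof.
move=> hw; elim: k => [|k IH]; first exact: torus_char1.
by have [w [w0 wE]] := torus_charM hw IH; exists w; split => // t u tt tu us; rewrite exprS; exact: wE.
Qed.

Lemma torus_char_prod (I : Type) (r : seq I) (chi : I -> Sp -> Sp -> C) :
  (forall i, exists w, torus_char (chi i) w) ->
  exists w, torus_char (fun t u => \prod_(i <- r) chi i t u) w.
Proof.
move=> hw; elim: r => [|i r IH].
  by have [w [w0 wE]] := torus_char1; exists w; split => // t u tt tu us; rewrite big_nil; exact: wE.
have [w [w0 wE]] := torus_charM (hw i) IH; exists w; split => // t u tt tu us.
by rewrite big_cons; exact: wE.
Qed.

Lemma zchar_ffun (a : 'I_n -> int) t : zchar [ffun i => a i] t = zchar a t.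
Proof. by apply: eq_bigr => i _; rewrite ffunE. Qed.

Lemma torus_char_entry r c : exists w, torus_char (fun t u => t r r * u c c) w.
Proof.
have eE (x : 'I_(n + n)) : exists i : 'I_n, exists e : int,
    forall t, torus t -> t x x = t (epos i) (epos i) ^ e.
  have [i [->|->]] : exists i : 'I_n, x = epos i \/ x = eneg i.
  - case: (split_ordP x) => a ->; first by exists a; left.
    exists (rev_ord a); right; apply/val_inj => /=; have := ltn_ord a; lia.
  - by exists i, 1 => t _; rewrite expr1z.
  - exists i, (- 1) => t tt; rewrite exprN1; apply: (mulfI (torus_neq0 (epos i) tt)).
    by rewrite torus_inv // mulfV // torus_neq0.
apply: torus_charM.
- have [i [e he]] := eE r.
  exists ([ffun j => if j == i then e else 0], [ffun=> 0]).
  split=> [|t u tt _ _]; first by rewrite /= ffunE.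
  by rewrite he // !zchar_ffun zchar0 mulr1 zchar_delta.
- have [i [e he]] := eE c; have [im|im] := eqVneq i ord_max.
    exists ([ffun=> 0], [ffun=> 0]); split=> [|t u _ tu us]; first by rewrite /= ffunE.
    rewrite he // !zchar_ffun !zchar0 mulr1 im Sp_sub_col ?eqxx ?exp1rz //=.
    by rewrite leqnn leqnSn.
  exists ([ffun=> 0], [ffun j => if j == i then e else 0]).
  split=> [|t u _ tu us]; first by rewrite /= ffunE eq_sym (negPf im).
  by rewrite he // !zchar_ffun zchar0 mul1r zchar_delta.
Qed.

Lemma sum_fibers (T : Type) (I : eqType) (W : T -> I) (x : T -> C) (L : seq T) (s : seq I) :
  uniq s -> {subset [seq W a | a <- L] <= s} ->
  \sum_(a <- L) x a = \sum_(w <- s) \sum_(a <- L | W a == w) x a.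
Proof.
move=> us; elim: L => [|a L IH] Ls.
  by rewrite big_nil big1 // => w _; rewrite big_nil.
rewrite big_cons IH => [|w wL]; last by apply: Ls; rewrite inE wL orbT.
have -> : x a = \sum_(w <- s) (if W a == w then x a else 0).
  rewrite -big_mkcond -big_filter (_ : [seq _ <- _ | _] = [:: W a]) ?big_seq1 //.
  rewrite (eq_filter (a2 := pred1 (W a))) => [|w]; last by rewrite /= eq_sym.
  by apply: filter_pred1_uniq => //; apply: Ls; rewrite mem_head.
rewrite -big_split; apply: eq_bigr => w _ /=; rewrite big_cons.
by case: eqP => //; rewrite add0r.
Qed.

(** Each monomial in the matrix entries is a weight vector; grouping the monomials of
    a polynomial by their weights gives the components. *)
Lemma weight_decomposition f : regular_fun f -> exists (s : seq wt) (F : wt -> fn),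
  [/\ uniq s, f = \sum_(w <- s) F w,
      forall w, w \in s -> w.2 ord_max = 0,
      forall w, regular_fun (F w)
    & forall w t g u, w \in s -> torus t -> torus u -> Sp_sub u ->
        F w (t * g * u)%g = zchar w.1 t * zchar w.2 u * F w g].
Proof.
move=> [p fp].
have /choice [rc rcE] : forall k : 'I_((n + n) * (n + n)),
    exists x : 'I_(n + n) * 'I_(n + n), k = mxvec_index x.1 x.2.
  by move=> k; case/mxvec_indexP: k => i j; exists (i, j).
pose mon (mn : mpoly.multinom _) g : C := \prod_k mxvec g 0 k ^+ mpoly.fun_of_multinom mn k.
pose chi (mn : mpoly.multinom _) t u : C :=
  \prod_k (t (rc k).1 (rc k).1 * u (rc k).2 (rc k).2) ^+ mpoly.fun_of_multinom mn k.
have monE mn t g u : torus t -> torus u -> mon mn (t * g * u)%g = chi mn t u * mon mn g.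
  move=> tt tu; rewrite /mon /chi -big_split; apply: eq_bigr => k _ /=.
  by rewrite (rcE k) !mxvecE -rcE torus_entry // -exprMn; congr (_ ^+ _); ring.
have /choice [W WE] : forall mn, exists w, torus_char (chi mn) w.
  move=> mn; apply: torus_char_prod => k; apply: torus_charX.
  exact: torus_char_entry.
pose F w : fn := fun g =>
  \sum_(mn <- mpoly.msupp p | W mn == w) mpoly.mcoeff mn p * mon mn g.
exists (undup [seq W mn | mn <- mpoly.msupp p]), F; split.
- exact: undup_uniq.
- apply/funext => g; rewrite fp mpoly.mevalE.
  have -> : (\sum_(w <- undup [seq W mn | mn <- mpoly.msupp p]) F w) g =
      \sum_(w <- undup [seq W mn | mn <- mpoly.msupp p]) F w g.
    by elim: undup => [|k r IH]; rewrite ?big_nil // !big_cons -IH.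
  by apply: sum_fibers; [exact: undup_uniq | move=> w; rewrite mem_undup].
- suff /allP h : all (fun w : wt => w.2 ord_max == 0) [seq W mn | mn <- mpoly.msupp p].
    by move=> w; rewrite mem_undup => /h /eqP.
  by elim: (mpoly.msupp p) => //= mn L ->; rewrite (proj1 (WE mn)) eqxx.
- move=> w; apply: (funalg_sum (regular_algebra C n)) => mn.
  have [Kc _ KM] := regular_algebra C n; apply: KM; first exact: Kc.
  apply: (funalg_prod (regular_algebra C n)) => k.
  apply: (funalg_exp (regular_algebra C n)).
  rewrite (rcE k); under [X in regular_fun X]eq_fun do rewrite mxvecE.
  exact: regular_entry.
move=> w t g u ws tt tu us; rewrite /F mulr_sumr; apply: eq_bigr => mn /eqP mnw.
by rewrite monE // (proj2 (WE mn)) // mnw mulrCA.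
Qed.

End TorusWeights.

(** * Dominance of the weights *)

Section Dominance.
Variables (C : numFieldType) (m : nat).
Local Notation n := m.+1.
Local Notation Sp := (Sp C n).
Local Notation fn := (Sp -> C^o).
Implicit Types (f : fn) (t g u v : Sp) (phi : SL2 C -> Sp).

Lemma poly_fun_mx2 (a b c d : C -> C) : poly_fun a -> poly_fun b -> poly_fun c -> poly_fun d ->
  forall i j, poly_fun (fun s => mx2 (a s) (b s) (c s) (d s) i j).
Proof.
move=> pa pb pc pd i j; under [X in poly_fun X]eq_fun do rewrite mxE.
by case: (i == 0 :> nat)%N; case: (j == 0 :> nat)%N.
Qed.

Lemma poly_up i j : poly_fun (fun s : C => up s i j).
Proof. by have [Kc _ _] := poly_fun_algebra C; apply: poly_fun_mx2 => //; apply: poly_fun_id. Qed.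

Lemma poly_weyl i j : poly_fun (fun s : C => weyl s i j).
Proof. by have [Kc _ _] := poly_fun_algebra C; apply: poly_fun_mx2 => //; apply: poly_fun_id. Qed.

Fact sl2_tr_subproof (h : SL2 C) : \det (h : 'M_2)^T == 1.
Proof. by rewrite det_tr sl2P. Qed.

Definition sl2_tr (h : SL2 C) : SL2 C := MkSL2 (sl2_tr_subproof h).

Lemma sl2_trM h h' : sl2_tr (h * h')%g = (sl2_tr h' * sl2_tr h)%g.
Proof. by apply/val_inj; rewrite /= trmx_mul. Qed.

Lemma mx2_tr a b c d : (mx2 a b c d)^T = mx2 a c b d :> 'M[C]_2.
Proof. by apply/matrixP => i j; rewrite !mxE; case: ifP; case: ifP. Qed.

Lemma sl2_tr_low x : sl2_tr (low x) = up x :> SL2 C.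
Proof. by apply/val_inj; rewrite /= mx2_tr. Qed.

Lemma sl2_tr_dg z : z != 0 -> sl2_tr (dg z) = dg z :> SL2 C.
Proof. by move=> z0; apply/val_inj; rewrite /= z0 mx2_tr. Qed.

Lemma zchar_root phi w a z : root_embedding phi w -> z != 0 ->
  zchar a (phi (dg z)) = z ^ (\sum_i w i * a i).
Proof.
move=> rp z0; rewrite /zchar.
have -> : \prod_(i < n) phi (dg z) (epos i) (epos i) ^ a i = \prod_(i < n) z ^ (w i * a i).
  by apply: eq_bigr => i _; rewrite (root_weight rp) // exprz_exp.
apply: (big_ind2 (fun x y => x = z ^ y)) => [|x y x' y' -> ->|//]; first by rewrite expr0z.
by rewrite expfzDr.
Qed.

(** Restriction to a coset of the image of SL2. *)
Lemma dominance_left f (a : 'I_n -> int) phi w g : regular_fun f ->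
  (forall v x, lower_unip v -> f (v * x)%g = f x) ->
  (forall t x, torus t -> f (t * x)%g = zchar a t * f x) -> f g != 0 ->
  root_embedding phi w -> 0 <= \sum_i w i * a i.
Proof.
move=> rf fl ft fg rp.
have phi1 : phi 1%g = 1%g.
  by apply: (mulgI (phi 1%g)); rewrite -(root_mul rp) !mulg1.
have curve (h : C -> SL2 C) : (forall i j, poly_fun (fun s => h s i j)) ->
    poly_fun (fun s => f (phi (h s) * g)%g).
  move=> hp; apply: (regular_pull (poly_fun_algebra C) rf).
  apply: (funalg_mulmx (poly_fun_algebra C)); first exact: (root_poly rp hp).
  by have [Kc _ _] := poly_fun_algebra C => i j; apply: Kc.
apply: (@rank_one C (fun h => f (phi h * g)%g)).
- exact/curve/poly_up.
- exact/curve/poly_weyl.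
- by move=> x h; rewrite (root_mul rp) -mulgA; apply: fl; apply: (root_low rp).
- move=> z h z0; rewrite (root_mul rp) -mulgA (ft _ _ (root_torus rp z0)).
  by rewrite (zchar_root _ rp).
- by rewrite phi1 mul1g.
Qed.

(** Transposition in SL2 exchanges the two sides and the two unipotent subgroups. *)
Lemma dominance_right f (b : 'I_n -> int) phi w g : regular_fun f ->
  (forall u x, upper_unip u -> Sp_sub u -> f (x * u)%g = f x) ->
  (forall t x, torus t -> Sp_sub t -> f (x * t)%g = zchar b t * f x) -> f g != 0 ->
  root_embedding phi w -> (forall h, Sp_sub (phi h)) -> 0 <= \sum_i w i * b i.
Proof.
move=> rf fr ft fg rp sp.
have phi1 : phi 1%g = 1%g.
  by apply: (mulgI (phi 1%g)); rewrite -(root_mul rp) !mulg1.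
have curve (h : C -> SL2 C) : (forall i j, poly_fun (fun s => h s i j)) ->
    poly_fun (fun s => f (g * phi (sl2_tr (h s)))%g).
  move=> hp; apply: (regular_pull (poly_fun_algebra C) rf).
  apply: (funalg_mulmx (poly_fun_algebra C)).
    by have [Kc _ _] := poly_fun_algebra C => i j; apply: Kc.
  apply: (root_poly rp) => i j; under [X in poly_fun X]eq_fun do rewrite mxE.
  exact: hp.
apply: (@rank_one C (fun h => f (g * phi (sl2_tr h))%g)).
- exact/curve/poly_up.
- exact/curve/poly_weyl.
- move=> x h; rewrite sl2_trM sl2_tr_low (root_mul rp) mulgA.
  exact: fr _ _ (root_up rp x) (sp _).
- move=> z h z0; rewrite sl2_trM sl2_tr_dg // (root_mul rp) mulgA.
  by rewrite (ft _ _ (root_torus rp z0) (sp _)) (zchar_root _ rp).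
- have -> : sl2_tr 1%g = 1%g by apply/val_inj; rewrite /= trmx1.
  by rewrite phi1 mulg1.
Qed.

Lemma sum_delta (a : 'I_n -> int) (i : 'I_n) : \sum_k (k == i)%:R * a k = a i.
Proof.
by rewrite (bigD1 i) //= eqxx mul1r big1 ?addr0 // => k /negPf ->; rewrite mul0r.
Qed.

Lemma long_dominance (a : 'I_n -> int) (i : 'I_n) :
  (forall phi w, root_embedding phi w -> ((i < m)%N -> forall h, @Sp_sub C n (phi h)) ->
    0 <= \sum_k w k * a k) -> 0 <= a i.
Proof.
by have [phi rp sp] := long_root C i => /(_ _ _ rp sp); rewrite sum_delta.
Qed.

Lemma short_dominance (a : 'I_n -> int) (i j : 'I_n) : (j = i.+1 :> nat) ->
  (forall phi w, root_embedding phi w -> ((j < m)%N -> forall h, @Sp_sub C n (phi h)) ->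
    0 <= \sum_k w k * a k) -> a j <= a i.
Proof.
move=> ij; have [phi rp sp] := short_root C ij => /(_ _ _ rp sp).
under eq_bigr do rewrite mulrBl.
by rewrite sumrB !sum_delta subr_ge0.
Qed.

Lemma torus_two (i : 'I_n) : exists t, [/\ torus t, (i < m)%N -> Sp_sub t &
  forall a, zchar a t = 2 ^ a i].
Proof.
have [phi rp sp] := long_root C i; have z0 : (2 : C) != 0 by rewrite pnatr_eq0.
exists (phi (dg 2)); split; [exact: (root_torus rp z0) | by move=> im; apply: sp |].
by move=> a; rewrite (zchar_root _ rp z0) sum_delta.
Qed.

Lemma zchar_separates (w w' : {ffun 'I_n -> int} * {ffun 'I_n -> int}) :
  w.2 ord_max = w'.2 ord_max -> w != w' ->
  exists t u, [/\ torus t, torus u, Sp_sub u &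
    zchar w.1 t * zchar w.2 u != zchar w'.1 t * zchar w'.2 u :> C].
Proof.
move=> wm; apply: contra_neqP => h.
have e t u : torus t -> torus u -> Sp_sub u ->
    zchar w.1 t * zchar w.2 u = zchar w'.1 t * zchar w'.2 u :> C.
  by move=> tt tu us; apply/eqP; apply: contra_notT h => ne; exists t, u.
have e1 i : w.1 i = w'.1 i.
  have [t [tt _ tE]] := torus_two i; apply: (@two_exp_inj C).
  by have := e t 1%g tt (torus1 C m) (@Sp_sub1 C m); rewrite !zchar1 !mulr1 !tE.
have e2 i : w.2 i = w'.2 i.
  have [->//|im] := eqVneq i ord_max; have [t [tt ts tE]] := torus_two i.
  have im' : (i < m)%N by have := ltn_ord i; have : (i != m :> nat) by []; lia.
  apply: (@two_exp_inj C).
  by have := e 1%g t (torus1 C m) tt (ts im'); rewrite !zchar1 !mul1r !tE.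
rewrite [w]surjective_pairing [w']surjective_pairing; congr (_, _); exact/ffunP.
Qed.

Lemma conj_lower t v : torus t -> lower_unip v -> lower_unip (t * v * t^-1)%g.
Proof.
move=> tt [/is_trig_mxP vt v1]; have [tt' tE] := torusV tt; split=> [|i].
  by apply/is_trig_mxP => i j ij; rewrite torus_entry // vt // mulr0 mul0r.
by rewrite torus_entry // v1 tE mulr1 mulfV // torus_neq0.
Qed.

Lemma conj_upper t v : torus t -> upper_unip v -> upper_unip (t^-1 * v * t)%g.
Proof.
move=> tt [/is_trig_mxP vt v1]; have [tt' tE] := torusV tt; split=> [|i].
  apply/is_trig_mxP => i j ij; rewrite mxE torus_entry //.
  by have := vt i j ij; rewrite mxE => ->; rewrite mulr0 mul0r.
by rewrite torus_entry // v1 tE mulr1 mulVf // torus_neq0.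
Qed.

Lemma Sp_subP v : Sp_sub v <->
  forall r (c : 'I_(n + n)), (m <= c <= m.+1)%N -> v r c = (r == c)%:R.
Proof.
split=> [vs r c|h i im]; first exact: Sp_sub_col.
have -> : i = ord_max by apply/val_inj => /=; lia.
split; apply/matrixP => r c; rewrite ord1 mxE [RHS]mxE andbT h //=.
  by rewrite leqnn leqnSn.
lia.
Qed.

Lemma conj_sub t v : torus t -> Sp_sub t -> Sp_sub v -> Sp_sub (t^-1 * v * t)%g.
Proof.
move=> tt /Sp_subP ts /Sp_subP vs; have [tt' tE] := torusV tt.
apply/Sp_subP => r c mc; rewrite torus_entry // vs // ts // eqxx mulr1.
case: eqP => [->|_]; last by rewrite mulr0.
by rewrite tE ts // eqxx invr1 mulr1.
Qed.

End Dominance.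

(** * The branching algebra is the sum of the multiplicity spaces *)

Section BranchingAlgebra.
Variables (C : numFieldType) (m : nat).
Local Notation n := m.+1.
Local Notation Sp := (Sp C n).
Local Notation fn := (Sp -> C^o).
Local Notation wt := ({ffun 'I_n -> int} * {ffun 'I_n -> int})%type.
Implicit Types (f : fn) (t g u v : Sp) (mu : m.-tuple nat) (lam gam : n.-tuple nat).

Definition torus_pair : set (Sp * Sp) := [set x | [/\ torus x.1, torus x.2 & Sp_sub x.2]].

Lemma sum_fnE (I : Type) (s : seq I) (P : pred I) (F : I -> fn) g :
  (\sum_(i <- s | P i) F i) g = \sum_(i <- s | P i) F i g.
Proof.
elim: s => [|i s IH]; first by rewrite !big_nil.
by rewrite !big_cons; case: (P i); rewrite -?IH.
Qed.

(** As the tori normalize the unipotent groups, f (t v g u s) = f (t g s) for all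
    t, s in the tori. Both sides are combinations of characters of (t, s), whose
    coefficients are the values of the components at v g u and at g. *)
Lemma weight_component_invariant f (s : seq wt) (F : wt -> fn) : branching_algebra C n f ->
  uniq s -> f = \sum_(w <- s) F w -> (forall w, w \in s -> w.2 ord_max = 0) ->
  (forall w t g u, w \in s -> torus t -> torus u -> Sp_sub u ->
     F w (t * g * u)%g = zchar w.1 t * zchar w.2 u * F w g) ->
  forall w v g u, w \in s -> lower_unip v -> upper_unip u -> Sp_sub u ->
    F w (v * g * u)%g = F w g.
Proof.
move=> [_ fi] us fE s0 Fw w v g u ws lv uu su; apply/subr0_eq.
apply: (@characters_independent C (Sp * Sp) (1%g, 1%g)
  (fun x y => (x.1 * y.1, x.2 * y.2)%g) torus_pair wt
  (fun w x => zchar w.1 x.1 * zchar w.2 x.2) s (fun w => F w (v * g * u)%g - F w g)) ws => //.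
- by split; [exact: torus1 | exact: torus1 | exact: Sp_sub1].
- move=> x y [x1 x2 xs] [y1 y2 ys]; split; [exact: torusM | exact: torusM | exact: Sp_subM].
- by move=> i; rewrite /= !zchar1 mulr1.
- by move=> i x y [x1 x2 xs] [y1 y2 ys]; rewrite /= !zcharM // mulrACA.
- move=> i j si sj ij; have [|t [x [tt xt xs ne]]] := @zchar_separates C m i j _ ij.
    by rewrite !s0.
  by exists (t, x).
move=> [t x] [/= tt xt xs].
have -> : \sum_(i <- s) zchar i.1 t * zchar i.2 x * (F i (v * g * u)%g - F i g) =
    f (t * (v * g * u) * x)%g - f (t * g * x)%g.
  rewrite fE !sum_fnE -sumrB [LHS]big_seq [RHS]big_seq; apply: eq_bigr => i si.
  by rewrite mulrBr (Fw _ t _ x si tt xt xs) (Fw _ t g x si tt xt xs).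
(* Conjugation moves v and u past the elements of the tori. *)
have -> : (t * (v * g * u) * x = (t * v * t^-1) * (t * g * x) * (x^-1 * u * x))%g.
  by rewrite !mulgA mulgVK mulgK.
by rewrite fi ?subrr //; [exact: conj_lower | exact: conj_upper | exact: conj_sub].
Qed.

Lemma tchar_zchar (a : seq nat) t : tchar a t = zchar (fun i : 'I_n => (nth 0%N a i)%:Z) t.
Proof. by []. Qed.

Lemma absz_tuple_sorted k (a : nat -> int) : (forall i, (i < k)%N -> 0 <= a i) ->
  (forall i, (i.+1 < k)%N -> a i.+1 <= a i) ->
  sorted geq (fn_tuple k (fun i => absz (a i))).
Proof.
move=> a0 ai; apply: sorted_fn_tuple => i ik; have := ai i ik.
by have := a0 i (ltnW ik); have := a0 i.+1 ik; lia.
Qed.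

(** The long root n and the short roots give nonnegativity and monotonicity; on the
    right, the roots are those of Sp_(2n-2). *)
Lemma weight_vector_Wspace f (w : wt) : branching_algebra C n f -> f <> 0 ->
  w.2 ord_max = 0 ->
  (forall t g u, torus t -> torus u -> Sp_sub u ->
     f (t * g * u)%g = zchar w.1 t * zchar w.2 u * f g) ->
  exists mu lam, LambdaB C (n := n) mu lam /\ Wspace C (n := n) mu lam f.
Proof.
move=> [rf fi] f0 w0 fw.
have [g fg] : exists g, f g != 0.
  apply/not_existsP => fg; apply: f0; apply/funext => g.
  by have /negP := fg g; rewrite negbK => /eqP.
pose a i := w.1 (inord i : 'I_n); pose b i := w.2 (inord i : 'I_n).
have upper1 : upper_unip (1%g : Sp).
  by split=> [|i]; rewrite ?mxE ?eqxx //= trmx1 scalar_mx_is_trig.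
have lower1 : lower_unip (1%g : Sp).
  by split=> [|i]; rewrite ?mxE ?eqxx //= scalar_mx_is_trig.
have domL (phi : SL2 C -> Sp) z : root_embedding phi z -> 0 <= \sum_i z i * w.1 i.
  apply: (dominance_left (f := f) (g := g)) => //.
  - by move=> v x lv; have := fi v x 1%g lv upper1 (@Sp_sub1 C m); rewrite mulg1.
  - move=> t x tt; have := fw t x 1%g tt (torus1 C m) (@Sp_sub1 C m).
    by rewrite mulg1 zchar1 mulr1.
have domR (phi : SL2 C -> Sp) z : root_embedding phi z -> (forall h, Sp_sub (phi h)) ->
    0 <= \sum_i z i * w.2 i.
  apply: (dominance_right (f := f) (g := g)) => //.
  - by move=> u x uu su; have := fi 1%g x u lower1 uu su; rewrite mul1g.
  - move=> t x tt st; have := fw 1%g x t (torus1 C m) tt st.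
    by rewrite mul1g zchar1 mul1r.
have a0 i : 0 <= a i by apply: (@long_dominance C) => phi z rp _; exact: domL rp.
have b0 i : (i < m)%N -> 0 <= b i.
  move=> im; apply: (@long_dominance C) => phi z rp sp; apply: (domR _ _ rp) => h.
  by apply: sp; rewrite inordK //; apply: ltnW.
have ai i : (i.+1 < n)%N -> a i.+1 <= a i.
  move=> im; apply: (@short_dominance C); first by rewrite !inordK // ltnW.
  by move=> phi z rp _; exact: domL rp.
have bi i : (i.+1 < m)%N -> b i.+1 <= b i.
  move=> im; apply: (@short_dominance C); first by rewrite !inordK //; lia.
  move=> phi z rp sp; apply: (domR _ _ rp) => h.
  by apply: sp; rewrite inordK //; apply: ltnW.
pose mu := fn_tuple m (fun i => absz (b i)); pose lam := fn_tuple n (fun i => absz (a i)).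
have Wf : Wspace C (n := n) mu lam f.
  split=> // t x u tt tu us; rewrite fw // !tchar_zchar; congr (_ * _ * _).
    apply: eq_bigr => i _; congr (_ ^ _).
    by rewrite nth_fn_tuple ltn_ord gez0_abs // /a inord_val.
  apply: eq_bigr => i _; congr (_ ^ _); rewrite nth_fn_tuple.
  case: ltnP => im; first by rewrite gez0_abs ?b0 // /b inord_val.
  by rewrite -[RHS]w0; congr (w.2 _); apply/val_inj => /=; have := ltn_ord i; lia.
exists mu, lam; split=> //; split; last by exists f.
- exact: absz_tuple_sorted.
- exact: absz_tuple_sorted.
Qed.

Lemma branching_generated (K : set fn) : K 0 -> (forall f f', K f -> K f' -> K (f + f')) ->
  (forall mu lam f, LambdaB C (n := n) mu lam -> Wspace C (n := n) mu lam f -> K f) ->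
  forall f, branching_algebra C n f -> K f.
Proof.
move=> K0 KD KW f Bf; have [s [F [us fE s0 Fr Fw]]] := weight_decomposition (proj1 Bf).
rewrite fE big_seq; apply: (big_ind K) => // w ws.
have [->//|/eqP Fw0] := eqVneq (F w) 0.
have BF : branching_algebra C n (F w).
  by split=> // v g u; apply: (weight_component_invariant Bf us fE s0 Fw).
have [|mu [lam [ml Wf]]] := weight_vector_Wspace BF Fw0 (s0 w ws); last exact: KW ml Wf.
by move=> t g u; apply: Fw.
Qed.

End BranchingAlgebra.

(** * Bases adapted to the decomposition *)

Section Span.
Variables (C : fieldType) (V : lmodType C) (I : eqType) (D : set I) (b : I -> V).

(** Indices are not repeated, so that coefficients can be added. *)
Definition in_span (f : V) : Prop := exists (s : seq I) (c : I -> C),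
  [/\ uniq s, forall i, i \in s -> D i & f = \sum_(i <- s) c i *: b i].

Lemma in_span0 : in_span 0.
Proof. by exists [::], (fun=> 0); split; rewrite ?big_nil. Qed.

Lemma in_span_scale c i : D i -> in_span (c *: b i).
Proof.
move=> Di; exists [:: i], (fun=> c); split=> //; last by rewrite big_seq1.
by move=> j; rewrite inE => /eqP ->.
Qed.

Lemma sum_extend (s r : seq I) (c : I -> C) : uniq s -> uniq r -> {subset s <= r} ->
  \sum_(i <- s) c i *: b i = \sum_(i <- r) (if i \in s then c i else 0) *: b i.
Proof.
move=> us ur sr; under [RHS]eq_bigr do rewrite (fun_if (fun x => x *: b _)) scale0r.
rewrite -[RHS]big_mkcond -[RHS]big_filter; apply/perm_big/uniq_perm => //.
  exact: filter_uniq.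
by move=> i; rewrite mem_filter; case: (boolP (i \in s)) => //= /sr ->.
Qed.

Lemma in_spanD f g : in_span f -> in_span g -> in_span (f + g).
Proof.
move=> [s [c [us sD ->]]] [s' [c' [us' sD' ->]]].
exists (undup (s ++ s')), (fun i => (if i \in s then c i else 0) + (if i \in s' then c' i else 0)).
split; first exact: undup_uniq.
  by move=> i; rewrite mem_undup mem_cat => /orP[/sD|/sD'].
rewrite (sum_extend (r := undup (s ++ s'))) ?undup_uniq //; last first.
  by move=> i si; rewrite mem_undup mem_cat si.
rewrite [X in _ + X](sum_extend (r := undup (s ++ s'))) ?undup_uniq //; last first.
  by move=> i si; rewrite mem_undup mem_cat si orbT.
by rewrite -big_split; apply: eq_bigr => i _ /=; rewrite scalerDl.
Qed.

End Span.

Section Basis.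
Variables (C : numFieldType) (m : nat).
Local Notation n := m.+1.
Local Notation Sp := (Sp C n).
Local Notation fn := (Sp -> C^o).
Variable Phi : Lgroup C n -> fn -> fn.
Hypothesis PhiP : is_branching_rep Phi.
Local Notation pat := (m.-tuple nat * n.-tuple nat * n.-tuple nat)%type.
Implicit Types (mu : m.-tuple nat) (lam gam : n.-tuple nat).

Lemma pattern_line mu lam gam : LambdaB C (n := n) mu lam -> between (n := n) mu lam gam ->
  exists2 v : fn, v <> 0 & forall Psi, is_branching_rep Psi ->
    Wweight (n := n) Psi mu gam lam = range (fun c : C => c *: v).
Proof.
move=> ml bg; have [v v0 wv] := pattern_vector ml (LambdaB_interlaced PhiP ml) bg.
by exists v => // Psi PsiP; apply: Wweight_range => //; apply: wv.
Qed.

Lemma adapted_exists : exists b, adapted (n := n) Phi b.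
Proof.
have /choice [b bP] : forall p : pat, exists v : fn, patterns C n p ->
    Wweight (n := n) Phi p.1.1 p.2 p.1.2 v /\ v <> 0.
  move=> [[mu lam] gam]; have [[ml bg]|np] := pselect (patterns C n (mu, lam, gam)); last first.
    by exists 0.
  have [v v0 wv] := pattern_line ml bg; exists v => _; split=> //=.
  by rewrite wv //; exists 1; rewrite ?scale1r.
by exists b => mu lam gam /bP.
Qed.

Lemma adapted_unique b b' : adapted (n := n) Phi b -> adapted (n := n) Phi b' ->
  forall p, patterns C n p -> exists2 c : C, c != 0 & b' p = c *: b p.
Proof.
move=> ab ab' [[mu lam] gam] pp; have [wb b0] := ab _ _ _ pp; have [wb' b0'] := ab' _ _ _ pp.
move: wb'; rewrite (Wweight_range PhiP (proj1 pp) b0 wb) => -[c _ cb].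
exists c => //; by apply: contra_notN b0' => /eqP c0; rewrite -cb c0 scale0r.
Qed.

Definition weight_pair (p : pat) : {ffun 'I_n -> int} * {ffun 'I_n -> int} :=
  ([ffun i : 'I_n => (nth 0%N p.1.2 i)%:Z], [ffun i : 'I_n => (nth 0%N p.1.1 i)%:Z]).

(** Two patterns differ in the degree (mu, lam), which the tori detect, or in gam,
    which T_L detects. *)
Lemma adapted_independent b (s : seq pat) (c : pat -> C) : adapted (n := n) Phi b -> uniq s ->
  (forall p, p \in s -> patterns C n p) ->
  \sum_(p <- s) c p *: b p = 0 -> forall p, p \in s -> c p = 0.
Proof.
move=> ab us sp s0 p ps.
have bW q : q \in s -> Wweight (n := n) Phi q.1.1 q.2 q.1.2 (b q) /\ b q <> 0.
  by case: q => [[mu lam] gam] /sp /ab.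
pose TT := ({x : Sp * Sp | torus_pair x} + {l : Lgroup C n | TL l})%type.
pose A (x : TT) (f : fn) : fn := match x with
  | inl y => fun g => f ((sval y).1 * g * (sval y).2)%g
  | inr l => Phi (sval l) f end.
pose chi (x : TT) (q : pat) : C := match x with
  | inl y => tchar q.1.2 (sval y).1 * tchar q.1.1 (sval y).2
  | inr l => TLchar (n := n) q.1.1 q.1.2 q.2 (sval l) end.
have AL x a u v : branching_algebra C n u -> branching_algebra C n v ->
    A x (a *: u + v) = a *: A x u + A x v.
  by case: x => [//|l]; apply: (rep_linear (brep_rep PhiP)).
have /eqP : c p *: b p = 0; last first.
  by rewrite scaler_eq0 => /orP [/eqP //|/eqP]; have [] := bW p ps.
apply: (@eigen_independent C fn _ TT (branching_algebra C n) A chi (branching0 C m) _ AL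
  s (fun q => c q *: b q)) ps => //.
- by move=> a u v; apply: branching_lin.
- move=> q /bW [[Wq wq] _]; have Bq := Wspace_branching Wq; split.
    by rewrite -[_ *: _]addr0; apply: branching_lin => //; apply: branching0.
  move=> x; have := AL x (c q) _ _ Bq (branching0 C m).
  rewrite addr0 (@operator0 _ _ _ (branching_algebra C n) A (branching0 C m)) // addr0 => ->.
  suff -> : A x (b q) = chi x q *: b q by rewrite !scalerA mulrC.
  case: x => [[[t u] [tt tu su]]|[l hl]] /=; last exact: wq.
  by apply/funext => g; rewrite (proj2 Wq).
move=> q r qs rs qr; have [e|ne] := eqVneq (weight_pair q) (weight_pair r); last first.
  have [|t [u [tt tu su tune]]] := @zchar_separates C m _ _ _ ne.
    by rewrite !ffunE !nth_default ?size_tuple.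
  exists (inl (exist _ (t, u) (And3 tt tu su))); move: tune => /=.
  by rewrite !tchar_zchar /weight_pair /= !zchar_ffun.
have [e1 e2] : q.1.1 = r.1.1 /\ q.1.2 = r.1.2.
  have [/ffunP e2 /ffunP e1] : (weight_pair q).1 = (weight_pair r).1 /\
      (weight_pair q).2 = (weight_pair r).2 by rewrite e.
  split; apply: tuple_ext => i im.
    have im' : (i < n)%N by apply: ltnW.
    by have := e1 (Ordinal im'); rewrite !ffunE => -[].
  by have := e2 (Ordinal im); rewrite !ffunE => -[].
have [ml _] := sp q qs.
have gam_ne : q.2 <> r.2.
  move=> e3; case/eqP: qr; rewrite [q]surjective_pairing [r]surjective_pairing e3.
  by rewrite [q.1]surjective_pairing [r.1]surjective_pairing e1 e2.
have [l hl ne] := TLchar_separates PhiP ml gam_ne.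
by exists (inr (exist _ l hl)); rewrite /= -e1 -e2.
Qed.

Lemma adapted_basis b : adapted (n := n) Phi b ->
  is_basis (patterns C n) b (branching_algebra C n).
Proof.
move=> ab; split.
- by move=> [[mu lam] gam] /ab [[Wb _] _]; exact: Wspace_branching Wb.
- suff h (f : fn) : branching_algebra C n f -> in_span (patterns C n) b f.
    by move=> f /h [s [c [_ sp fE]]]; exists s, c.
  move: f; apply: branching_generated; [exact: in_span0 | exact: in_spanD |].
  move=> mu lam f ml; have [-> _] := Wspace_direct_sum PhiP ml.
  move=> [s [F [_ sF ->]]]; rewrite big_seq.
  apply: (big_ind (in_span (patterns C n) b)); [exact: in_span0 | exact: in_spanD |].
  move=> gam /sF [bg wF]; have pp : patterns C n (mu, lam, gam) by split.
  have [wb b0] := ab _ _ _ pp; move: wF; rewrite (Wweight_range PhiP ml b0 wb).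
  by move=> [c _ <-]; apply: in_span_scale.
- by move=> s c us sp s0; exact: adapted_independent ab us sp s0.
Qed.

End Basis.

Theorem corollary3p8 (R : realType) (n : nat) (n_gt1 : (1 < n)%N)
    (Phi : Lgroup R[i] n -> (Sp R[i] n -> R[i]^o) -> (Sp R[i] n -> R[i]^o))
    (PhiP : is_branching_rep Phi) :
  [/\ forall (mu : n.-1.-tuple nat) (lam : n.-tuple nat), LambdaB R[i] mu lam ->
        [/\ direct_sum (between mu lam) (fun gam => Wweight Phi mu gam lam)
              (Wspace R[i] mu lam),
            forall gam, between mu lam gam -> is_line (Wweight Phi mu gam lam)
          & forall Psi, is_branching_rep Psi -> forall gam, between mu lam gam ->
              Wweight Psi mu gam lam = Wweight Phi mu gam lam],
      exists b, adapted Phi b,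
      forall b, adapted Phi b ->
        is_basis (patterns R[i] n) b (branching_algebra R[i] n)
    & forall b b', adapted Phi b -> adapted Phi b' ->
        forall p, patterns R[i] n p ->
          exists2 c : R[i], c != 0 & b' p = c *: b p].
Proof.
case: n n_gt1 Phi PhiP => [//|m] _ Phi PhiP; split.
- move=> mu lam ml; split=> [|gam bg|Psi PsiP gam bg].
  + exact: (@Wspace_direct_sum R[i] m).
  + have [v v0 wv] := @pattern_line R[i] m Phi PhiP mu lam gam ml bg.
    by exists v; rewrite ?wv.
  + have [v v0 wv] := @pattern_line R[i] m Phi PhiP mu lam gam ml bg.
    by rewrite !wv.
- exact: (@adapted_exists R[i] m).
- exact: (@adapted_basis R[i] m Phi PhiP).
- exact: (@adapted_unique R[i] m Phi PhiP).
Qed.
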